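(* Let $N\ge3$ and suppose that all critical points of the potential $$V(\theta)=-\sum_{1\le i<j\le N}\left(\cos(\theta_i-\theta_j)+\frac12\log\bigl(2-2\cos(\theta_i-\theta_j)\bigr)\right)$$ are nondegenerate. Then there are at least three distinct families of relative equilibria of the $(1+N)$-vortex problem (i.e. at least three relative equilibria, no two of which are related by a rigid rotation and a permutation of the indices $1,\dots,N$), one of which continues to linearly stable relative equilibria of the $(N+1)$-vortex problem when $\varepsilon>0$: for all sufficiently small $\varepsilon>0$ there is a linearly stable relative equilibrium of the $(N+1)$-vortex problem with small circulation $\varepsilon$, and these converge to the given relative equilibrium of the $(1+N)$-vortex problem as $\varepsilon\to0^+$.
   Context: For $(x,y)\in\mathbb{R}^2$ write $(x,y)^\perp=(-y,x)$. The $(N+1)$-vortex problem with circulations $\Gamma_0=1$, $\Gamma_1=\dots=\Gamma_N=\varepsilon$ (where $\varepsilon\in\mathbb{R}$ may have either sign) is the system for pairwise distinct $q_0,\dots,q_N\in\mathbb{R}^2$ $$\dot q_j=\sum_{i=0,\,i\ne j}^N \Gamma_i\frac{(q_j-q_i)^\perp}{|q_j-q_i|^2},\qquad j=0,\dots,N.$$ A relative equilibrium of it is a configuration that is a fixed point in the frame rotating rigidly about the origin at rate $\omega=1$, i.e. $q_j^\perp=\sum_{i\ne j}\Gamma_i\frac{(q_j-q_i)^\perp}{|q_j-q_i|^2}$ for all $j$; the center of vorticity is always taken at the origin: $q_0=-\varepsilon(q_1+\dots+q_N)$. A relative equilibrium of the $(1+N)$-vortex problem is a configuration $(q_0,\dots,q_N)$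 for which there are nonzero real numbers $\varepsilon_k\to0$ and, for each $k$, a relative equilibrium $(q_0^k,\dots,q_N^k)$ of the $(N+1)$-vortex problem with $\varepsilon=\varepsilon_k$, such that $q_j^k\to q_j$ for $j=0,\dots,N$; moreover it is required that, for some $m,M>0$ independent of $k$, $|q_i^k-q_j^k|\ge m$ for $i\neq j$ and $|q_j^k|\le M$ for all $j$. Linear stability: substitute $q_0=-\varepsilon(q_1+\dots+q_N)$ into the equations for $q_1,\dots,q_N$ and write the resulting $2N$ equations in polar coordinates $(r_1,\dots,r_N,\theta_1,\dots,\theta_N)$ of $q_1,\dots,q_N$ in the frame rotating at rate $1$. The linearization at a relative equilibrium always has at least two zero eigenvalues, coming from the rotation and scaling symmetries; the relative equilibrium is called linearly stable if all the remaining $2N-2$ eigenvalues are purely imaginary and nonzero. $V$ is defined for $\theta\in\mathbb{R}^N$ with $\theta_i\not\equiv\theta_j\pmod{2\pi}$ for $i\neq j$. Its Hessian $V_{\theta\theta}$ always has the null vector $(1,\dots,1)^T$; a critical point $\theta$ of $V$ is called nondegenerate if $V_{\theta\theta}(\theta)$ has only one zero eigenvalue. *)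

(* Defs.v *)
From HB Require Import structures.
From mathcomp Require Import all_boot all_order all_fingroup all_algebra.
From mathcomp Require Import all_classical all_reals all_analysis.
From mathcomp Require Import complex.

Set Implicit Arguments.
Unset Strict Implicit.
Unset Printing Implicit Defensive.

Import Order.TTheory GRing.Theory Num.Theory.
Import numFieldNormedType.Exports.

Local Open Scope classical_set_scope.
Local Open Scope ring_scope.

(* The plane is [R * R].  The library norm on [R * R] is the sup norm, so the
   Euclidean structure is introduced separately; the topologies agree. *)
Section Plane.
Variable R : realType.

Definition perp (p : R * R) : R * R := (- p.2, p.1).

Definition dot (p p' : R * R) : R := p.1 * p'.1 + p.2 * p'.2.

Definition enorm (p : R * R) : R := Num.sqrt (dot p p).

Definition radial (t : R) : R * R := (cos t, sin t).

Definition rotation (t : R) (p : R * R) : R * R :=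
  (cos t * p.1 - sin t * p.2, sin t * p.1 + cos t * p.2).

End Plane.

Section Vortices.
Variables (R : realType) (N : nat).

(* Index [ord0] is the strong vortex; [lift ord0 i], for [i : 'I_N], are the
   small ones. *)
Definition config := 'I_N.+1 -> R * R.

Definition circulation (eps : R) (j : 'I_N.+1) : R :=
  if j == ord0 then 1 else eps.

Definition velocity (eps : R) (q : config) (j : 'I_N.+1) : R * R :=
  \sum_(i < N.+1 | i != j)
    (circulation eps i / enorm (q j - q i) ^+ 2) *: perp (q j - q i).

(* Rotation rate 1, center of vorticity at the origin. *)
Definition relative_equilibrium (eps : R) (q : config) : Prop :=
  [/\ injective q,
      q ord0 = - eps *: \sum_(i < N) q (lift ord0 i)
    & forall j, perp (q j) = velocity eps q j].

Definition limit_relative_equilibrium (q : config) : Prop :=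
  exists (eps : nat -> R) (qk : nat -> config),
    [/\ (forall k, eps k != 0) /\ eps k @[k --> \oo] --> (0 : R),
        forall k, relative_equilibrium (eps k) (qk k),
        forall j, qk k j @[k --> \oo] --> q j
      & exists m M : R, [/\ 0 < m, 0 < M,
          forall k i j, i != j -> m <= enorm (qk k i - qk k j)
        & forall k j, enorm (qk k j) <= M]].

Definition same_family (q q' : config) : Prop :=
  exists (t : R) (s : 'S_N),
    q' ord0 = rotation t (q ord0) /\
    forall i : 'I_N, q' (lift ord0 i) = rotation t (q (lift ord0 (s i))).

(* A point of the 2N-dimensional phase space is the row vector
   (r_1, ..., r_N, theta_1, ..., theta_N). *)
Definition polar (x : 'rV[R]_(N + N)) (i : 'I_N) : R * R :=
  lsubmx x ord0 i *: radial (rsubmx x ord0 i).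

Definition complete_config (eps : R) (p : 'I_N -> R * R) : config :=
  fun j => if unlift ord0 j is Some i then p i
           else - eps *: \sum_(i < N) p i.

Definition polar_field (eps : R) (x : 'rV[R]_(N + N)) : 'rV[R]_(N + N) :=
  let v i := velocity eps (complete_config eps (polar x)) (lift ord0 i) in
  let r i := lsubmx x ord0 i in
  let e i := radial (rsubmx x ord0 i) in
  row_mx (\row_(i < N) dot (v i) (e i))
         (\row_(i < N) (dot (v i) (perp (e i)) / r i - 1)).

(* The spectrum, with algebraic multiplicities, is (0, 0) followed by 2N - 2
   nonzero purely imaginary numbers. *)
Definition stable_spectrum (n : nat) (A : 'M[R]_n) : Prop :=
  exists s : (n - 2).-tuple R[i],
    char_poly (map_mx (real_complex R) A)
      = 'X^2 * \prod_(z <- s) ('X - z%:P) /\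
    forall z, z \in s -> complex.Re z = 0 /\ z != 0.

Definition linearly_stable_relative_equilibrium (eps : R) (q : config) : Prop :=
  relative_equilibrium eps q /\
  exists x : 'rV[R]_(N + N),
    [/\ forall i, 0 < lsubmx x ord0 i,
        forall i, q (lift ord0 i) = polar x i
      & stable_spectrum (jacobian (polar_field eps) x)].

(* Off its domain [V_domain], the value of [V] involves the convention
   [ln 0 = 0]. *)
Definition V (t : 'rV[R]_N) : R :=
  - \sum_(i < N) \sum_(j < N | (i < j)%N)
      (cos (t ord0 i - t ord0 j)
       + 2^-1 * ln (2 - 2 * cos (t ord0 i - t ord0 j))).

Definition V_domain (t : 'rV[R]_N) : Prop :=
  forall i j, i != j -> forall k : int, t ord0 i - t ord0 j != 2 * pi * k%:~R.

Definition partial (i : 'I_N) (f : 'rV[R]_N -> R) : 'rV[R]_N -> R :=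
  'D_(delta_mx ord0 i) f.

Definition hessian (f : 'rV[R]_N -> R) (t : 'rV[R]_N) : 'M[R]_N :=
  \matrix_(i < N, j < N) partial j (partial i f) t.

Definition V_critical (t : 'rV[R]_N) : Prop :=
  V_domain t /\ forall i, partial i V t = 0.

Definition V_nondegenerate (t : 'rV[R]_N) : Prop :=
  mup 0 (char_poly (hessian V t)) = 1%N.

End Vortices.

(* Main.v *)
Require Import Defs.
From HB Require Import structures.
From mathcomp Require Import all_boot all_order all_fingroup all_algebra.
From mathcomp Require Import all_classical all_reals all_analysis.
From mathcomp Require Import complex zify ring lra.

(** Eliminate the strong vortex and write the equations for the small vortices
    as a gradient. With p_k = q_k + e (q_1 + ... + q_N), the position relative to
    the strong vortex, let

      Phi_e(q) = (sum |q_k|^2 + e |sum q_k|^2) / 2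
                 - sum log |p_k| - e sum_(i < k) log |q_k - q_i|.

    For small e the relative equilibria are the critical points of Phi_e. When
    e = 0 these are all configurations with every small vortex on the unit
    circle, and the first order term in e of Phi_e on this torus is V, up to a
    constant ([grad_t_circle]).

    Continuation. In polar coordinates the torques are divisible by e
    ([grad_angleE]). The radial equations and the torques divided by e form a
    system that is smooth at e = 0, where its derivative is block triangular with
    blocks 2 I and the Hessian of V. Nondegeneracy leaves the common rotation as
    the only kernel. Adding the mean angle to the torques removes this kernel,
    and as Phi_e is rotation invariant the torques add up to 0, so the added term
    vanishes at the solutions ([constraint_removed]). Every nondegenerate critical
    point of V is thus a limit of relative equilibria, for e of both signs
    ([critical_limit_equilibrium]).

    Stability. The linearization J at such an equilibrium satisfies J P = S,
    where P is the matrix of a symplectic form and S is the Hessian of Phi_e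
    ([symplectic_jacobian]). At a minimum of V and for small e > 0, S is positive
    semidefinite with kernel spanned by the rotation: after radial displacements
    are scaled by sqrt e and S is divided by e, it converges to the direct sum of
    2 I and the Hessian of V ([state_form_definite]). Linear algebra then gives
    the spectrum: the rotation generates a Jordan block of size 2 for the
    eigenvalue 0, and on the complement the definite form S forces all
    eigenvalues onto the imaginary axis ([stable_spectrum_symplectic]).

    Three critical points. The sum Z of the N unit vectors turns with the
    configuration, so its length is an invariant of the family. The first
    critical point is the regular polygon, for which Z = 0. The second is the
    global minimum of V, which exists because exp (- 2 V) is continuous on the
    torus and vanishes at collisions. There Z is not 0: on a critical
    configuration with Z = 0 the second derivative of V along the Moebius field
    - sin theta_i is negative ([V_descent]). The same field shows that V, when
    minimised among the configurations symmetric about the first axis with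
    Z >= 0, has a minimiser with Z > 0, which is then an honest critical point
    ([symmetric_critical]). This is done for two symmetry types, with and without
    a vortex at angle 0. A rotation between the two would preserve the direction
    of Z, hence be trivial, so they lie in different families
    ([axis_not_same]), and at least one of them is not in the family of the
    minimum. *)

Set Implicit Arguments.
Unset Strict Implicit.
Unset Printing Implicit Defensive.

Import Order.TTheory GRing.Theory Num.Theory.
Import numFieldNormedType.Exports.

Local Open Scope classical_set_scope.
Local Open Scope ring_scope.

(** * Spectra of Hamiltonian matrices *)

Lemma char_poly_similar (F : fieldType) n (M A : 'M[F]_n) :
  M \in unitmx -> char_poly (M *m A *m invmx M) = char_poly A.
Proof.
move=> uM.
have e : char_poly_mx (M *m A *m invmx M)
    = map_mx polyC M *m char_poly_mx A *m map_mx polyC (invmx M).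
  rewrite /char_poly_mx mulmxBr mulmxBl !map_mxM; congr (_ - _).
  by rewrite scalar_mxC -mulmxA -map_mxM mulmxV // map_mx1 mulmx1.
rewrite /char_poly e !det_mulmx mulrAC -det_mulmx -map_mxM mulmxV //.
by rewrite map_mx1 det1 mul1r.
Qed.

Lemma char_poly_lblock (F : fieldType) m n (B : 'M[F]_m) (D : 'M[F]_(n, m))
    (C : 'M[F]_n) :
  char_poly (block_mx B 0 D C) = char_poly B * char_poly C.
Proof.
rewrite /char_poly /char_poly_mx map_block_mx scalar_mx_block map_mx0.
by rewrite opp_block_mx add_block_mx subrr det_lblock.
Qed.

Lemma char_poly_right_eigen (F : fieldType) n (C : 'M[F]_n) a :
  root (char_poly C) a -> exists2 y : 'cV[F]_n, y != 0 & C *m y = a *: y.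
Proof.
have -> : char_poly C = char_poly C^T.
  rewrite /char_poly -det_tr /char_poly_mx; congr (\det _).
  by rewrite raddfB /= tr_scalar_mx map_trmx.
rewrite -eigenvalue_root_char => /eigenvalueP [v vC v0].
exists v^T; first by rewrite trmx_eq0.
by rewrite -[C]trmxK -trmx_mul vC linearZ.
Qed.

(** In a basis that completes the rows of U, the matrix is block triangular with
    diagonal blocks B and C. A right eigenvector of C, padded with zeros in front,
    is one of the whole matrix, and the padding says that U kills it. *)
Lemma char_poly_stable_rows (F : fieldType) n r (A : 'M[F]_n)
    (U : 'M[F]_(r, n)) (B : 'M[F]_r) :
  row_free U -> U *m A = B *m U ->
  exists m (C : 'M[F]_m),
    [/\ n = (r + m)%N, char_poly A = char_poly B * char_poly C
      & forall a, root (char_poly C) a -> exists y : 'cV[F]_n,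
          [/\ y != 0, A *m y = a *: y & U *m y = 0]].
Proof.
move=> fU UA; pose m : nat := \rank (U^C)%MS.
have rU : \rank U = r by apply/eqP.
have en : n = (r + m)%N.
  by rewrite /m mxrank_compl rU subnKC // -rU rank_leq_col.
have [W fWU] : exists W : 'M[F]_(m, n), row_full (col_mx U W).
  exists (row_base (U^C)%MS).
  rewrite /row_full -addsmxE.
  have /eqP := addsmx_compl_full U; rewrite /row_full => h.
  apply/eqP; apply: etrans h; apply/eqP; rewrite eqn_leq.
  by rewrite !mxrankS // addsmxS // eq_row_base.
move: m W en fWU => m W en; move: A U B fU UA rU W.
rewrite en => A U B fU UA rU W; set M := col_mx U W => fM.
have uM : M \in unitmx by rewrite -row_full_unit.
exists m, (drsubmx (M *m A *m invmx M)).
have eM : M *m A *m invmx M = block_mx B 0 (dlsubmx (M *m A *m invmx M))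
   (drsubmx (M *m A *m invmx M)).
  have : usubmx (M *m A *m invmx M) = row_mx B 0.
    rewrite -mul_usub_mx -mul_usub_mx col_mxKu UA -mulmxA.
    have -> : U = usubmx M by rewrite col_mxKu.
    rewrite mul_usub_mx mulmxV // -[RHS]mulmx1.
    rewrite scalar_mx_block /block_mx mul_row_col mul0mx addr0.
    by rewrite col_mxKu.
  move=> h; rewrite -[LHS]submxK.
  by rewrite /ulsubmx /ursubmx h row_mxKl row_mxKr.
split => //.
  by rewrite -(char_poly_similar A uM) {1}eM char_poly_lblock.
move=> a /char_poly_right_eigen [y y0 Cy].
have MA : M *m A = M *m A *m invmx M *m M.
  by rewrite mulmxKV.
have My : M *m (invmx M *m col_mx 0 y) = col_mx 0 y.
  by rewrite mulmxA mulmxV // mul1mx.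
exists (invmx M *m col_mx 0 y); split.
- apply/eqP => e0; move: My; rewrite e0 mulmx0 => /esym/eqP.
  by rewrite col_mx_eq0 (negPf y0) andbF.
- apply: (can_inj (mulKmx uM)); rewrite [LHS]mulmxA MA -[LHS]mulmxA My.
  by rewrite eM mul_block_col mulmx0 mul0mx addr0 mulmx0 add0r Cy linearZ /= My
     scale_col_mx scaler0.
- have -> : U = usubmx M by rewrite col_mxKu.
  by rewrite mul_usub_mx My col_mxKu.
Qed.

Lemma row_free_col_mx2 (F : fieldType) n (k s : 'rV[F]_n) :
  k != 0 -> (forall c, s != c *: k) -> row_free (col_mx k s).
Proof.
move=> k0 s_indep; set U := col_mx k s.
rewrite -kermx_eq0; apply/eqP/row_matrixP => i; rewrite row0.
have : row i (kermx U) *m U = 0 by rewrite -row_mul mulmx_ker row0.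
rewrite -[row i _]hsubmxK; set a := lsubmx _; set b := rsubmx _.
rewrite mul_row_col [a]mx11_scalar [b]mx11_scalar !mul_scalar_mx => e.
have [b0|b0] := eqVneq (b 0 0) 0.
  move: e; rewrite b0 scale0r addr0 => /eqP; rewrite scaler_eq0 (negPf k0).
  by rewrite orbF => /eqP ->; rewrite !raddf0 row_mx0.
have := s_indep (- (b 0 0)^-1 * a 0 0).
case/eqP; apply: (scalerI b0); rewrite scalerA mulrA mulrN mulfV // mulN1r.
by apply/eqP; rewrite scaleNr -addr_eq0 addrC e.
Qed.

(** Two independent null vectors would split off a factor X^2 of the
    characteristic polynomial. *)
Lemma mup1_kernel (F : fieldType) n (H : 'M[F]_n) (k v : 'rV[F]_n) :
  mup 0 (char_poly H) = 1%N -> k != 0 -> k *m H = 0 -> v *m H = 0 ->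
  exists c, v = c *: k.
Proof.
move=> mH k0 kH vH; apply: contrapT => hv.
have fU : row_free (col_mx k v).
  by apply: row_free_col_mx2 => // c; apply/eqP => vc; apply: hv; exists c.
have UH : col_mx k v *m H = 0 *m col_mx k v.
  by rewrite mul_col_mx kH vH mul0mx col_mx0.
have [m [C [_ pH _]]] := char_poly_stable_rows fU UH.
have : ('X - 0%:P) ^+ 2 %| char_poly H.
  rewrite pH; apply: dvdp_mulr.
  by rewrite char_poly_trig ?mx0_is_trig // !big_ord_recl big_ord0 mulr1 !mxE expr2.
by rewrite -mup_geq ?mH // monic_neq0 // char_poly_monic.
Qed.

Section StableSpectrum.
Variable R : realType.

Definition qform n (S : 'M[R]_n) (u v : 'rV[R]_n) : R := (u *m S *m v^T) 0 0.

Lemma qform_tr n (S : 'M[R]_n) u v : qform S u v = qform S^T v u.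
Proof.
rewrite /qform; transitivity ((u *m S *m v^T)^T 0 0); first by rewrite [RHS]mxE.
by rewrite !trmx_mul trmxK mulmxA.
Qed.

Lemma qform_sym n (S : 'M[R]_n) u v : S^T = S -> qform S u v = qform S v u.
Proof. by move=> sS; rewrite qform_tr sS. Qed.

Lemma qform_antisym n (P : 'M[R]_n) u v :
  P^T = - P -> qform P u v = - qform P v u.
Proof. by move=> sP; rewrite qform_tr sP /qform mulmxN mulNmx mxE. Qed.

Lemma qform_antisym0 n (P : 'M[R]_n) u : P^T = - P -> qform P u u = 0.
Proof. by move=> /(@qform_antisym _ _ u u) h; lra. Qed.

Lemma map_Re_mulmx m n (M : 'M[R]_(m, n)) (y : 'cV[R[i]]_n) :
  map_mx (@complex.Re R) (map_mx (real_complex R) M *m y)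
  = M *m map_mx (@complex.Re R) y.
Proof.
apply/colP => i; rewrite !mxE (big_morph (@complex.Re R) (id1 := 0) (op1 := +%R)) //.
  by apply: eq_bigr => j _; rewrite !mxE; case: (y j 0) => c d /=; rewrite mul0r subr0.
by move=> [a b] [c d].
Qed.

Lemma map_Im_mulmx m n (M : 'M[R]_(m, n)) (y : 'cV[R[i]]_n) :
  map_mx (@complex.Im R) (map_mx (real_complex R) M *m y)
  = M *m map_mx (@complex.Im R) y.
Proof.
apply/colP => i; rewrite !mxE (big_morph (@complex.Im R) (id1 := 0) (op1 := +%R)) //.
  by apply: eq_bigr => j _; rewrite !mxE; case: (y j 0) => c d /=; rewrite mul0r addr0.
by move=> [a b] [c d].
Qed.

(** Matrices act on row vectors. Since P is antisymmetric, k P is orthogonal to the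
    kernel of S, so k = s J for some s: the span of k and s carries the factor
    X^2. A remaining eigenvalue z has a right eigenvector y with U y = 0, where U
    has rows k and s. Put y = P w with w = a + i b. Then
    S(a, a) = S(b, b) = - Im z P(a, b) and Re z P(a, b) = 0. If P(a, b) = 0 then a
    and b are multiples of k, which U y = 0 excludes; hence Re z = 0, and z = 0 is
    excluded in the same way. *)
Lemma stable_spectrum_symplectic n (J P S : 'M[R]_n) (k : 'rV[R]_n) :
  J *m P = S -> P^T = - P -> P \in unitmx -> S^T = S ->
  k != 0 -> k *m S = 0 ->
  (forall v, 0 <= qform S v v) ->
  (forall v, qform S v v = 0 -> exists c, v = c *: k) ->
  stable_spectrum J.
Proof.
move=> JP aP uP sS k0 kS S_ge0 S_ker.
have JE : J = S *m invmx P by rewrite -JP mulmxK.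
have S_ker' v : S *m v^T = 0 -> exists c, v = c *: k.
  by move=> h; apply: S_ker; rewrite /qform -mulmxA h mulmx0 mxE.
(* k P kills the kernel of S, which is spanned by k^T *)
have /submxP [s sSE] : (k *m P <= S)%MS.
  rewrite submxE; apply/eqP/matrixP => i j; rewrite !mxE.
  have : S *m (col j (cokermx S)) = 0 by rewrite colE mulmxA mulmx_coker mul0mx.
  rewrite -[col _ _]trmxK => /S_ker' [c hc].
  have hcol a : cokermx S a j = c * k 0 a.
    by have := congr1 (fun M : 'rV_n => M 0 a) hc; rewrite !mxE.
  transitivity (c * qform P k k); last by rewrite qform_antisym0 // mulr0.
  rewrite /qform [X in c * X]mxE mulr_sumr; apply: eq_bigr => a _.
  by rewrite hcol (ord1 i) [k^T _ _]mxE mulrCA.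
have kP0 : k *m P != 0.
  apply/eqP => h; move/eqP: k0; apply.
  by rewrite -[k](mulmxK uP) h mul0mx.
have kJ : k *m J = 0 by rewrite JE mulmxA kS mul0mx.
have sJ : s *m J = k by rewrite JE mulmxA -sSE mulmxK.
have s_indep c : s != c *: k.
  apply/eqP => h; move/eqP: kP0; apply.
  by rewrite sSE h -scalemxAl kS scaler0.
pose f := real_complex R.
pose U : 'M[R]_(1 + 1, n) := col_mx k s.
pose B : 'M[R]_(1 + 1) := block_mx 0 0 1%:M 0.
have UJ : U *m J = B *m U.
  by rewrite /U /B mul_col_mx kJ sJ mul_block_col !mul0mx mul1mx addr0 addr0.
have fU : row_free U by apply: row_free_col_mx2.
have fUc : row_free (map_mx f U) by rewrite row_free_map.
have UJc : map_mx f U *m map_mx f J = map_mx f B *m map_mx f U.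
  by rewrite -!map_mxM UJ.
have [m [C [en pJ Ceig]]] := char_poly_stable_rows fUc UJc.
have pB : char_poly (map_mx f B) = 'X^2.
  rewrite -map_char_poly /B char_poly_lblock.
  by rewrite /char_poly /char_poly_mx map_mx0 subr0 det_scalar1 rmorphM /= map_polyX expr2.
have [rs rsE] := closed_field_poly_normal (char_poly C).
have szrs : size rs = (n - 2)%N.
  have := size_char_poly C; rewrite rsE (monicP (char_poly_monic C)) scale1r.
  by rewrite size_prod_XsubC en => -[->]; rewrite addnC addnK.
exists (tcast szrs (in_tuple rs)); split.
  rewrite pJ pB {1}rsE (monicP (char_poly_monic C)) scale1r; congr (_ * _).
  by rewrite (eq_big_seq _ (fun _ _ => erefl)); case: _ / szrs.
move=> z; have -> : (z \in tcast szrs (in_tuple rs)) = (z \in rs).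
  by case: _ / szrs.
rewrite -root_prod_XsubC => rz.
have /Ceig [y [y0 Jy Uy]] : root (char_poly C) z.
  by rewrite rsE (monicP (char_poly_monic C)) scale1r.
(* real and imaginary parts of the eigenvector, pulled back by P *)
pose ya := map_mx (@complex.Re R) y; pose yb := map_mx (@complex.Im R) y.
have Ua : U *m ya = 0.
  by rewrite /ya -map_Re_mulmx Uy; apply/matrixP => i j; rewrite !mxE.
have Ub : U *m yb = 0.
  by rewrite /yb -map_Im_mulmx Uy; apply/matrixP => i j; rewrite !mxE.
pose a := (invmx P *m ya)^T; pose b := (invmx P *m yb)^T.
have yaE : ya = P *m a^T by rewrite trmxK mulKVmx.
have ybE : yb = P *m b^T by rewrite trmxK mulKVmx.
have Sa : S *m a^T = complex.Re z *: (P *m a^T) - complex.Im z *: (P *m b^T).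
  rewrite -JP -mulmxA -yaE -ybE /ya -map_Re_mulmx Jy.
  by apply/colP => i; rewrite !mxE; case: (y i 0) (z) => [? ?] [? ?].
have Sb : S *m b^T = complex.Im z *: (P *m a^T) + complex.Re z *: (P *m b^T).
  rewrite -JP -mulmxA -yaE -ybE /yb -map_Im_mulmx Jy.
  apply/colP => i; rewrite !mxE; case: (y i 0) (z) => [? ?] [? ?] /=.
  by rewrite addrC.
have qSa v : qform S v a = complex.Re z * qform P v a - complex.Im z * qform P v b.
  by rewrite /qform -mulmxA Sa mulmxBr -!scalemxAr !mulmxA !mxE.
have qSb v : qform S v b = complex.Im z * qform P v a + complex.Re z * qform P v b.
  by rewrite /qform -mulmxA Sb mulmxDr -!scalemxAr !mulmxA !mxE.
have Pba := qform_antisym b a aP.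
have Paa := qform_antisym0 a aP; have Pbb := qform_antisym0 b aP.
have ab_indep : ~ (qform S a a = 0 /\ qform S b b = 0).
  case=> /S_ker [c ac] /S_ker [d bd].
  have sPk : (s *m P *m k^T) 0 0 != 0.
    rewrite -/(qform P s k) qform_antisym // oppr_eq0.
    have -> : qform P k s = qform S s s by rewrite /qform sSE.
    by apply/eqP => /S_ker [e /eqP]; rewrite (negPf (s_indep e)).
  have key e : U *m (P *m (e *: k)^T) = 0 -> e = 0.
    rewrite /U mul_col_mx => /eqP; rewrite col_mx_eq0 => /andP [_ /eqP h].
    have := congr1 (fun M : 'M[R]_(1, 1) => M 0 0) h.
    rewrite linearZ /= -!scalemxAr mulmxA mxE [RHS]mxE => /eqP.
    by rewrite mulf_eq0 (negPf sPk) orbF => /eqP.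
  have c0 : c = 0 by apply: key; rewrite -ac -yaE.
  have d0 : d = 0 by apply: key; rewrite -bd -ybE.
  have ya0 : ya = 0 by rewrite yaE ac c0 scale0r trmx0 mulmx0.
  have yb0 : yb = 0 by rewrite ybE bd d0 scale0r trmx0 mulmx0.
  case/eqP: y0; apply/colP => i; apply/eqP; rewrite eq_complex !mxE /=.
  have := congr1 (fun M : 'cV_n => M i 0) ya0.
  have := congr1 (fun M : 'cV_n => M i 0) yb0.
  by rewrite !mxE => -> ->; rewrite eqxx.
have h1 := qSa a; have h2 := qSb b; have h3 := qSb a; have h4 := qSa b.
rewrite Paa Pba Pbb !mulr0 in h1 h2 h3 h4.
rewrite (qform_sym b a sS) in h4.
have [t0|t0] := eqVneq (qform P a b) 0.
  by case: ab_indep; rewrite h1 h2 t0; split; lra.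
split.
  apply/eqP; have : complex.Re z * qform P a b = 0 by lra.
  by move/eqP; rewrite mulf_eq0 (negPf t0) orbF.
apply/eqP => z0; apply: ab_indep; rewrite h1 h2 z0 /=; split; lra.
Qed.

End StableSpectrum.

(** * Continuously differentiable functions *)

Section C1.
Variables (R : realType) (E : normedModType R).
Implicit Types (f g : E -> R) (x v : E).

(** Continuity of the derivative is asked at the point only, and in each fixed
    direction; this is all that the implicit function theorem below uses, and it
    is stable under composition of formulas. *)
Definition C1 f x : Prop :=
  (\forall y \near x, differentiable f y) /\
  forall v, {for x, continuous (fun y => 'D_v f y)}.

Lemma C1_differentiable f x : C1 f x -> differentiable f x.
Proof. by case=> /nbhs_singleton. Qed.

Lemma C1_continuous f x : C1 f x -> {for x, continuous f}.
Proof. by move=> /C1_differentiable; exact: differentiable_continuous. Qed.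

(** The value at x itself is covered because x lies in each of its neighbourhoods. *)
Lemma near_continuous (T : topologicalType) (f g : E -> T) x :
  (\forall y \near x, f y = g y) -> {for x, continuous f} -> {for x, continuous g}.
Proof.
move=> fg cf; rewrite /prop_for /continuous_at -(nbhs_singleton fg).
exact: cvg_trans (near_eq_cvg fg) cf.
Qed.

Lemma C1_cst c x : C1 (fun _ => c) x.
Proof.
split; first by near=> y; exact: differentiable_cst.
move=> v; have -> : (fun y => 'D_v (fun _ : E => c) y) = fun _ => 0.
  by apply/funext => y; exact: derive_cst.
exact: cvg_cst.
Unshelve. all: by end_near. Qed.

Lemma C1D f g x : C1 f x -> C1 g x -> C1 (fun y => f y + g y) x.
Proof.
move=> [df cf] [dg cg]; split.
  near=> y; apply: (@differentiableD _ _ _ f g y).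
    by near: y. by near: y.
move=> v; apply: (near_continuous (f := fun y => 'D_v f y + 'D_v g y)).
  near=> y; rewrite -(@deriveD _ _ _ f g) //; apply: diff_derivable.
    by near: y. by near: y.
by apply: cvgD; [exact: cf|exact: cg].
Unshelve. all: by end_near. Qed.

Lemma C1M f g x : C1 f x -> C1 g x -> C1 (fun y => f y * g y) x.
Proof.
move=> f1 g1; have cf0 := C1_continuous f1; have cg0 := C1_continuous g1.
case: f1 g1 => [df cf] [dg cg]; split.
  near=> y; apply: (@differentiableM _ _ f g y).
    by near: y. by near: y.
move=> v; apply: (near_continuous (f := fun y => f y *: 'D_v g y + g y *: 'D_v f y)).
  near=> y; rewrite -(@deriveM _ _ f g) //; apply: diff_derivable.
    by near: y. by near: y.
by apply: cvgD; apply: cvgM => //; [exact: cg|exact: cf].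
Unshelve. all: by end_near. Qed.

Lemma C1N f x : C1 f x -> C1 (fun y => - f y) x.
Proof.
have -> : (fun y => - f y) = (fun y => -1 * f y) by apply/funext => y; rewrite mulN1r.
by move=> f1; apply: C1M; [exact: C1_cst|exact: f1].
Qed.

Lemma C1B f g x : C1 f x -> C1 g x -> C1 (fun y => f y - g y) x.
Proof. by move=> f1 g1; apply: C1D; [exact: f1|exact: C1N]. Qed.

Lemma C1_sum (I : Type) (r : seq I) (P : pred I) (F : I -> E -> R) x :
  (forall i, P i -> C1 (F i) x) -> C1 (fun y => \sum_(i <- r | P i) F i y) x.
Proof.
move=> F1; elim: r => [|i r IH].
  have -> : (fun y => \sum_(i <- [::] | P i) F i y) = fun _ => 0.
    by apply/funext => y; rewrite big_nil.
  exact: C1_cst.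
have -> : (fun y => \sum_(i <- i :: r | P i) F i y) =
    (fun y => (if P i then F i y else 0) + \sum_(i <- r | P i) F i y).
  by apply/funext => y; rewrite big_cons; case: ifP => //; rewrite add0r.
apply: C1D IH; case Pi: (P i); [exact: F1|exact: C1_cst].
Qed.

Lemma C1_comp (h h' : R -> R) f x :
  (\forall t \near f x, is_derive t (1 : R) h (h' t)) -> {for f x, continuous h'} ->
  C1 f x -> C1 (fun y => h (f y)) x.
Proof.
move=> dh ch f1; have cf0 := C1_continuous f1; case: f1 => [df cf].
have dhf : \forall y \near x, is_derive (f y) (1 : R) h (h' (f y)) by exact: cf0 dh.
split.
  near=> y; apply: (@differentiable_comp _ _ _ _ f h y); first by near: y.
  apply/derivable1_diffP; have dy : is_derive (f y) (1 : R) h (h' (f y)) by near: y.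
  exact: ex_derive.
move=> v; apply: (near_continuous (f := fun y => 'D_v f y * h' (f y))).
  near=> y.
  have dfy : differentiable f y by near: y.
  have dy : is_derive (f y) (1 : R) h (h' (f y)) by near: y.
  have dhy : differentiable h (f y) by apply/derivable1_diffP; exact: ex_derive.
  rewrite [RHS](@deriveE _ _ _ (h \o f)); last exact: differentiable_comp.
  rewrite diff_comp //= deriveE //.
  have := @deriv1E _ _ h (f y); move=> /(_ ex_derive) ->.
  by rewrite derive1E derive_val.
by apply: cvgM; [exact: cf|exact: (cvg_comp _ _ cf0 ch)].
Unshelve. all: by end_near. Qed.

End C1.

Lemma near_forall (I : finType) (T : topologicalType) (P : I -> T -> Prop) (x : T) :
  (forall i, \forall y \near x, P i y) -> \forall y \near x, forall i, P i y.
Proof. exact: filter_forall. Qed.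

Lemma cvg_to_pair (T : Type) (F : set_system T) {FF : Filter F} (U V : topologicalType)
    (f : T -> U) (g : T -> V) (u : U) (v : V) :
  f s @[s --> F] --> u -> g s @[s --> F] --> v -> (f s, g s) @[s --> F] --> (u, v).
Proof.
move=> fu gv.
by have h := @cvg_pair _ _ _ F (nbhs u) (nbhs v) _ _ _ f g fu gv; exact: h.
Qed.

Section Line.
Variables (R : realType) (E : normedModType R).
Implicit Types (f : E -> R).

Lemma line_growth f (a v : E) (t : R) :
  (fun h : R => h^-1 *: (f ((h *: (1 : R) + t) *: v + a) - f (t *: v + a)))
  = (fun h : R => h^-1 *: (f (h *: v + (t *: v + a)) - f (t *: v + a))).
Proof.
apply/funext => h; have -> : h *: (1 : R) = h by exact: mulr1.
by rewrite scalerDl addrA.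
Qed.

Lemma is_derive_line f (a v : E) (t : R) d :
  is_derive (t *: v + a) v f d ->
  is_derive t (1 : R) (fun s : R => f (s *: v + a)) d.
Proof.
case=> [df fd]; apply: DeriveDef.
  by rewrite /derivable line_growth.
by rewrite /derive line_growth.
Qed.
End Line.

(** * An implicit function theorem *)

Section Implicit.
Variables (R : realType) (n : nat).

(** Quantitative invertibility: every matrix whose entries are within eta of those
    of M is still injective. *)
Lemma unit_perturb (M : 'M[R]_n) : M \in unitmx ->
  exists2 eta : R, 0 < eta & forall u : 'rV[R]_n,
    (forall j, `|(u *m M) 0 j| <= eta * \sum_i `|u 0 i|) -> u = 0.
Proof.
move=> uM; pose C : R := \sum_k \sum_j `|invmx M j k|.
have C0 : 0 <= C by apply: sumr_ge0 => i _; apply: sumr_ge0.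
have C1 : 0 < C + 1 by lra.
exists ((C + 1)^-1) => [|u hu]; first by rewrite invr_gt0.
set s : R := \sum_i _ in hu.
have s0 : 0 <= s by apply: sumr_ge0.
have hs : s <= (C + 1)^-1 * s * C.
  rewrite {2}/C mulr_sumr; apply: ler_sum => k _.
  rewrite -{1}[u](mulmxK uM) mxE mulr_sumr; apply: (le_trans (ler_norm_sum _ _ _)).
  by apply: ler_sum => j _; rewrite normrM ler_wpM2r.
have s00 : s = 0.
  apply/eqP; rewrite eq_le s0 andbT leNgt; apply/negP => sp.
  have : s * (C + 1) <= s * C.
    rewrite -(ler_pM2l (_ : 0 < (C + 1)^-1)) ?invr_gt0 // mulrCA mulVf ?mulr1 ?gt_eqF //.
    by rewrite mulrA.
  by nra.
apply/rowP => i; rewrite mxE; apply/eqP; rewrite -normr_eq0.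
have := s00 => /eqP; rewrite psumr_eq0 // => /allP /(_ i); rewrite mem_index_enum.
by move=> /(_ isT).
Qed.

Notation E := (R * 'rV[R]_n)%type.

Lemma derive_row (f : E -> R) (z : E) (h : 'rV[R]_n) : differentiable f z ->
  'D_((0, h) : E) f z = \sum_j h 0 j * 'D_((0, delta_mx 0 j) : E) f z.
Proof.
move=> df; rewrite deriveE //.
have -> : ((0, h) : E) = \sum_j h 0 j *: ((0, delta_mx 0 j) : E).
  rewrite [RHS]surjective_pairing; congr pair.
    rewrite (big_morph fst (id1 := 0) (op1 := +%R)) //=.
    by rewrite big1 // => i _; rewrite scaler0.
  by rewrite (big_morph snd (id1 := 0) (op1 := +%R)) //= {1}[h]row_sum_delta.
rewrite linear_sum; apply: eq_bigr => j _.
by rewrite linearZ deriveE.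
Qed.

(** For fixed e, minimise the sum of the squares of the F i over a small ball
    around x0. At e = 0 the point x0 is the only zero in the ball, so the minimisers
    converge to x0 and are interior for small e. At an interior minimiser the
    gradient of the sum of squares vanishes; it is the vector F multiplied by a
    matrix close to the invertible Jacobian, so F vanishes. This yields a
    convergent branch without any regularity in e. *)
Lemma implicit_zeros (F : 'I_n -> E -> R) (x0 : 'rV[R]_n) :
  (forall i, C1 (F i) (0, x0)) -> (forall i, F i (0, x0) = 0) ->
  \matrix_(j, i) 'D_((0, delta_mx 0 j) : E) (F i) (0, x0) \in unitmx ->
  exists X : R -> 'rV[R]_n, X e @[e --> (0 : R)] --> x0 /\
    \forall e \near (0 : R), forall i, F i (e, X e) = 0.
Proof.
move=> F1 F0; set M := \matrix_(_, _) _ => uM.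
have [eta1 eta10 hM] := unit_perturb uM.
have uMt : M^T \in unitmx by rewrite unitmx_tr.
have [eta2 eta20 hMt] := unit_perturb uMt.
pose eta := Num.min eta1 eta2.
have eta0 : 0 < eta by rewrite lt_min eta10.
(* the derivatives stay eta-close to those at the base point *)
have good : \forall z \near ((0, x0) : E), forall i, differentiable (F i) z /\
    forall j, `|'D_((0, delta_mx 0 j) : E) (F i) z - M j i| <= eta.
  apply: near_forall => i.
  suff h : \forall z \near ((0, x0) : E), forall j,
      `|'D_((0, delta_mx 0 j) : E) (F i) z - M j i| <= eta.
    by have [d _] := F1 i; near=> z; split; near: z.
  apply: near_forall => j; rewrite mxE.
  have [_ /(_ ((0, delta_mx 0 j) : E))] := F1 i.
  by move=> /cvgrPdist_le /(_ _ eta0); apply: filterS => z; rewrite distrC.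
have [e e0 goodE] : exists2 e : R, 0 < e & forall (t : R) (x : 'rV[R]_n), `|t| < e -> `|x - x0| < e ->
    forall i, differentiable (F i) ((t, x) : E) /\
    forall j, `|'D_((0, delta_mx 0 j) : E) (F i) (t, x) - M j i| <= eta.
  move/nbhs_ballP : good => [e /= e0 he]; exists e => // t x te xe; apply: he.
  split; first by rewrite /ball /= sub0r normrN.
  by rewrite -ball_normE /ball_ /= distrC.
pose rho := e / 2.
have rho0 : 0 < rho by rewrite divr_gt0.
have rhoe : rho < e by rewrite /rho; lra.
pose f (z : E) := \sum_i F i z ^+ 2.
have f_cont (t : R) (x : 'rV[R]_n) : `|t| < e -> `|x - x0| < e -> {for ((t, x) : E), continuous f}.
  move=> te xe; apply: differentiable_continuous.
  have -> : f = \sum_i ((F i) * (F i)).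
    by apply/funext => z; rewrite /f fct_sumE.
  apply: differentiable_sum => i; have [d _] := goodE _ _ te xe i.
  exact: differentiableM.
have f0 : f (0, x0) = 0 by rewrite /f big1 // => i _; rewrite F0 expr0n.
have f_eq0 z : f z = 0 -> forall i, F i z = 0.
  move=> /eqP; rewrite psumr_eq0; last by move=> i _; exact: sqr_ge0.
  by move=> /allP h i; have := h i (mem_index_enum i); rewrite /= sqrf_eq0 => /eqP.
have f_ge0 z : 0 <= f z by apply: sumr_ge0 => i _; exact: sqr_ge0.
have f_pos (x : 'rV[R]_n) : `|x - x0| <= rho -> x != x0 -> 0 < f (0, x).
  move=> xr xx0; rewrite lt_def f_ge0 andbT; apply/eqP => /f_eq0 Fx.
  case/eqP: xx0; apply/eqP; rewrite -subr_eq0; apply/eqP; apply: hM => i.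
  (* the mean value theorem along the segment from x0 to x *)
  pose g (s : R) := F i (s *: ((0, x - x0) : E) + ((0, x0) : E)).
  have gE (s : R) : s *: ((0, x - x0) : E) + ((0, x0) : E) = (0, s *: (x - x0) + x0).
    by rewrite [LHS]surjective_pairing /= scaler0 addr0.
  have seg (s : R) : s \in `[0, 1]%R -> `|s *: (x - x0) + x0 - x0| < e.
    rewrite in_itv /= => /andP [s0 s1]; rewrite addrK normrZ (ger0_norm s0).
    by apply: (le_lt_trans _ rhoe); apply: (le_trans _ xr); rewrite ler_piMl.
  pose g' (s : R) : R := 'D_((0, x - x0) : E) (F i) (0, s *: (x - x0) + x0).
  have dg (s : R) : s \in `[0, 1]%R -> is_derive s (1 : R) g (g' s).
    move=> /seg se; apply: is_derive_line; rewrite gE.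
    have e0' : `|0 : R| < e by rewrite normr0.
    have [d _] := goodE _ _ e0' se i.
    by apply: derivableP; exact: diff_derivable.
  have lt01R : (0 : R) < 1 by exact: ltr01.
  have dgo (s : R) : s \in `]0, 1[%R -> is_derive s (1 : R) g (g' s).
    by move=> s01; apply: dg; apply: subset_itv_oo_cc s01.
  have cg : {within `[0, 1], continuous g}.
    apply: derivable_within_continuous => s s01.
    by have := dg s s01 => ?; exact: ex_derive.
  have [c c01] := MVT lt01R dgo cg.
  have c01' : c \in `[0, 1]%R by apply: subset_itv_oo_cc c01.
  rewrite {1 2}/g !gE scale0r add0r scale1r subrK Fx F0 subrr subr0 mulr1.
  have e0' : `|0 : R| < e by rewrite normr0.
  have [d dM] := goodE _ _ e0' (seg c c01') i.
  rewrite /g' derive_row // => /esym eq0.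
  have -> : ((x - x0) *m M) 0 i = \sum_j (x - x0) 0 j *
      (M j i - 'D_((0, delta_mx 0 j) : E) (F i) (0, c *: (x - x0) + x0)).
    rewrite mxE -[LHS]subr0 -[X in _ - X]eq0 -sumrB.
    by apply: eq_bigr => j _; rewrite mulrBr.
  apply: (le_trans (ler_norm_sum _ _ _)); rewrite mulr_sumr; apply: ler_sum => j _.
  rewrite normrM mulrC ler_wpM2r // distrC; apply: (le_trans (dM j)).
  by rewrite /eta ge_min lexx.
pose K := [set x : 'rV[R]_n | `|x - x0| <= rho].
have KE : K = closed_ball x0 rho.
  rewrite closed_ballE //; apply/seteqP; split => x; rewrite /K /closed_ball_ /=;
  by rewrite distrC.
have Kc : compact K.
  apply: bounded_closed_compact; last by rewrite KE; exact: closed_ball_closed.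
  exists (rho + `|x0|); split; first exact: num_real.
  move=> B hB x /= Kx; apply/ltW; apply: le_lt_trans hB.
  by rewrite -[x](subrK x0); apply: (le_trans (ler_normD _ _)); rewrite lerD2r.
have Ke x : K x -> `|x - x0| < e by move=> h; exact: (le_lt_trans h rhoe).
have x0e : `|x0 - x0| < e by rewrite subrr normr0.
have Kx0 : K x0 by rewrite /K /= subrr normr0 ltW.
have minX (t : R) : exists x : 'rV[R]_n, `|t| < e -> K x /\ forall y, K y -> f (t, x) <= f (t, y).
  have [te|te] := boolP (`|t| < e); last by exists x0.
  have [| |c] := @compact_EVT_min _ R (fun x => f (t, x)) K _ Kc.
  - by exists x0.
  - apply: continuous_in_subspaceT => x; rewrite inE => /Ke xe.
    exact: (cvg_comp _ _ (cvg_to_pair (cvg_cst t) cvg_id) (f_cont t x te xe)).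
  rewrite inE => Kcc hc; exists c => _; split => // y Ky; apply: hc.
  by rewrite inE.
have [X hX] := choice minX.
have t_e : \forall t \near (0 : R), `|t| < e by exact: nbhs0_lt.
(* away from x0 the sum of squares stays above its value at (t, x0) *)
have sep (d : R) : 0 < d -> \forall t \near (0 : R), forall x : 'rV[R]_n, K x -> d <= `|x - x0| ->
    f (t, x0) < f (t, x).
  move=> d0; have /compact_near_coveringP := Kc.
  move=> /(_ R (nbhs (0 : R)) (fun t x => d <= `|x - x0| -> f (t, x0) < f (t, x)) _).
  apply => x Kx.
  have [xx0|xx0] := eqVneq x x0.
    have : \forall x' \near x & t \near (0 : R), `|x' - x0| < d.
      have : \forall x' \near x, `|x' - x0| < d.
        rewrite xx0; have /cvgrPdist_lt /(_ _ d0) : (y @[y --> x0] --> x0) by exact: cvg_id.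
        by apply: filterS => y; rewrite distrC.
      by move=> h; exists ([set y : 'rV[R]_n | `|y - x0| < d], setT) => [|[y t] [/= ? _] //]; split => //=; exact: filterT.
    by apply: filterS => -[x' t] /= h1 h2; have := le_lt_trans h2 h1; rewrite ltxx.
  have fx : 0 < f (0, x) / 2 by rewrite divr_gt0 // f_pos.
  have e0' : `|0 : R| < e by rewrite normr0.
  have h1 : \forall t \near (0 : R), f (t, x0) < f (0, x) / 2.
    have c1 : f (t, x0) @[t --> (0 : R)] --> f (0, x0).
      exact: (cvg_comp _ _ (cvg_to_pair cvg_id (cvg_cst x0)) (f_cont _ _ e0' x0e)).
    move/cvgrPdist_lt: c1 => /(_ _ fx); apply: filterS => t.
    by rewrite f0 sub0r normrN; apply: le_lt_trans; exact: ler_norm.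
  have h2 : \forall z \near ((0, x) : E), f (0, x) / 2 < f z.
    have c2 := f_cont 0 x e0' (Ke x Kx).
    move/cvgrPdist_lt: c2 => /(_ _ fx); apply: filterS => z hz.
    by have := le_lt_trans (ler_norm _) hz; lra.
  have h3 : \forall t \near (0 : R) & x' \near x, f (t, x0) < f (t, x').
    case: h2 => -[A B] /= [A0 Bx] AB.
    exists (A `&` [set t | f (t, x0) < f (0, x) / 2], B) => /=.
      by split => //; apply: filterI.
    by move=> [t x'] /= [[At h] Bx']; apply: (lt_trans h); apply: (AB (t, x')).
  case: h3 => -[A B] /= [A0 Bx] AB; exists (B, A) => //= -[x' t] /= [Bx' At] _.
  exact: (AB (t, x')).
have Xnear (d : R) : 0 < d -> \forall t \near (0 : R), `|X t - x0| < d.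
  move=> d0; have hs := sep d d0; near=> t.
  have te : `|t| < e by near: t.
  have [KX Xmin] := hX t te; rewrite ltNge; apply/negP => dX.
  have hst : forall x, K x -> d <= `|x - x0| -> f (t, x0) < f (t, x) by near: t.
  by have := hst _ KX dX; rewrite ltNge Xmin.
exists X; split.
  by apply/cvgrPdist_lt => d d0; near=> t; rewrite distrC; near: t; exact: Xnear.
have hXr := Xnear rho rho0; near=> t => i.
have te : `|t| < e by near: t.
have [KX Xmin] := hX t te.
have Xr : `|X t - x0| < rho by near: t.
have XtE : `|X t - x0| < e by exact: Ke.
have grad j : \sum_i F i (t, X t) * 'D_((0, delta_mx 0 j) : E) (F i) (t, X t) = 0.
  pose v : E := (0, delta_mx 0 j).
  have lineE (s : R) : s *: v + ((t, X t) : E) = (t, s *: delta_mx 0 j + X t).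
    by rewrite [LHS]surjective_pairing /= scaler0 add0r.
  have [r r0 hr] : exists2 r : R, 0 < r & forall s : R, `|s| < r ->
      `|s *: delta_mx 0 j + X t - x0| < rho.
    have : \forall s \near (0 : R), `|s *: delta_mx 0 j + X t - x0| < rho.
      have c : `|s *: (delta_mx 0 j : 'rV[R]_n) + X t - x0| @[s --> (0 : R)] -->
          `|0 *: (delta_mx 0 j : 'rV[R]_n) + X t - x0|.
        apply: cvg_norm; apply: cvgB; last exact: cvg_cst.
        by apply: cvgD; [apply: cvgZr_tmp; exact: cvg_id|exact: cvg_cst].
      have Xr' : `|0 *: (delta_mx 0 j : 'rV[R]_n) + X t - x0| < rho.
        by rewrite scale0r add0r.
      exact: (cvgr_lt _ c).
    move=> /nbhs_ballP [r /= r0 h]; exists r => // s sr; apply: h.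
    by rewrite /ball /= sub0r normrN.
  pose g (s : R) := f (s *: v + ((t, X t) : E)).
  pose g' (s : R) := 2 * \sum_i F i (s *: v + ((t, X t) : E)) * 'D_v (F i) (s *: v + ((t, X t) : E)).
  have dg (s : R) : s \in `](- r), r[%R -> is_derive s (1 : R) g (g' s).
    rewrite in_itv /= -ltr_norml => /hr sr.
    apply: is_derive_line; rewrite /g' lineE.
    have d k : is_derive ((t, s *: delta_mx 0 j + X t) : E) v (F k) ('D_v (F k) (t, s *: delta_mx 0 j + X t)).
      apply: derivableP; apply: diff_derivable.
      by have [] := goodE _ _ te (Ke _ (ltW sr)) k.
    have -> : f = \sum_k (F k * F k).
      by apply/funext => z; rewrite /f fct_sumE.
    apply: is_derive_eq.
    rewrite mulr_sumr; apply: eq_bigr => k _.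
    by rewrite /GRing.scale /=; ring.
  have rr : - r <= r by rewrite ge0_cp // ltW.
  have z0 : (0 : R) \in `](- r), r[%R by rewrite in_itv /= oppr_lt0 r0.
  have := @derive1_at_min R g (- r) r 0 rr _ z0.
  case.
  - by move=> s sr; have := dg s sr => ?; exact: ex_derive.
  - move=> s; rewrite in_itv /= -ltr_norml => /hr sr.
    by rewrite /g !lineE scale0r add0r; apply: Xmin; exact: ltW.
  move=> _; have := dg 0 z0 => -[_ ->].
  rewrite /g' scale0r add0r => /eqP; rewrite mulf_eq0 pnatr_eq0 /= => /eqP.
  by [].
pose u := \row_k F k (t, X t).
have -> : F i (t, X t) = u 0 i by rewrite mxE.
suff -> : u = 0 by rewrite mxE.
apply: hMt => j.
have -> : (u *m M^T) 0 j = \sum_k u 0 k *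
    (M j k - 'D_((0, delta_mx 0 j) : E) (F k) (t, X t)).
  rewrite mxE -[LHS]subr0 -[X in _ - X](grad j) -sumrB.
  by apply: eq_bigr => k _; rewrite mulrBr !mxE.
apply: (le_trans (ler_norm_sum _ _ _)); rewrite mulr_sumr; apply: ler_sum => k _.
have [_ dM] := goodE _ _ te XtE k.
rewrite normrM mulrC ler_wpM2r // distrC; apply: (le_trans (dM j)).
by rewrite /eta ge_min lexx orbT.
Unshelve. all: by end_near. Qed.
End Implicit.

(** * Second order conditions and positive definite forms *)

Section SecondOrder.
Variable R : realType.

Lemma decr_near_right (f : R -> R) (d : R) :
  is_derive (0 : R) (1 : R) f d -> d < 0 -> \forall t \near (0 : R)^'+, f t < f 0.
Proof.
move=> [df fd] d0.
have : (fun h : R => h^-1 *: (f (h *: (1 : R) + 0) - f 0)) @ (0 : R)^' --> d.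
  by rewrite -fd; exact: df.
move/cvgrPdist_lt => /(_ (- d)); rewrite oppr_gt0 => /(_ d0) /nbhs_ballP [e /= e0 he].
exists e => //= t te t0.
have := he t te (lt0r_neq0 t0).
have -> : t *: (1 : R) + 0 = t by rewrite addr0; exact: mulr1.
rewrite distrC => /(le_lt_trans (ler_norm _)) => h.
have : t^-1 * (f t - f 0) < 0 by rewrite -[_ * _]/(t^-1 *: (f t - f 0)); lra.
by rewrite pmulr_rlt0 ?invr_gt0 // subr_lt0.
Qed.

(** A critical point with negative second derivative: the first derivative is
    negative just to the right, and the mean value theorem applies. *)
Lemma second_derivative_decr (f f' : R -> R) (d : R) :
  (\forall t \near (0 : R), is_derive t (1 : R) f (f' t)) -> f' 0 = 0 ->
  is_derive (0 : R) (1 : R) f' d -> d < 0 -> \forall t \near (0 : R)^'+, f t < f 0.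
Proof.
move=> /nbhs_ballP [e /= e0 he] f'0 df' d0.
have [r /= r0 hr] := decr_near_right df' d0.
exists (Num.min e r) => [|t /=]; first by rewrite /= lt_min e0.
rewrite sub0r normrN => + t0; rewrite gtr0_norm // lt_min => /andP [te tr].
have hd (s : R) : s \in `[0, t]%R -> is_derive s (1 : R) f (f' s).
  rewrite in_itv /= => /andP [s0 st]; apply: he.
  by rewrite /ball /= sub0r normrN ger0_norm //; exact: le_lt_trans st te.
have hdo (s : R) : s \in `]0, t[%R -> is_derive s (1 : R) f (f' s).
  by move=> s01; apply: hd; apply: subset_itv_oo_cc s01.
have cf : {within `[0, t], continuous f}.
  apply: derivable_within_continuous => s s01.
  by have := hd s s01 => ?; exact: ex_derive.
have [c c01] := MVT t0 hdo cf; rewrite subr0 => h.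
have : f' c < 0.
  move: c01; rewrite in_itv /= => /andP [c0 ct]; rewrite -f'0; apply: hr => //.
  by rewrite /= sub0r normrN gtr0_norm //; exact: lt_trans ct tr.
by move=> fc; rewrite -subr_lt0 h nmulr_rlt0.
Qed.

Variable n : nat.

Lemma qformE (M : 'M[R]_n) u v : qform M u v = \sum_i \sum_j u 0 i * M i j * v 0 j.
Proof.
rewrite /qform mxE exchange_big; apply: eq_bigr => j _.
by rewrite mxE mulr_suml; apply: eq_bigr => i _; rewrite [v^T _ _]mxE.
Qed.

Lemma rV_norm_coord (v : 'rV[R]_n) i : `|v 0 i| <= `|v|.
Proof.
rewrite [leRHS]/Num.Def.normr /= mx_normrE.
exact: (le_bigmax _ (fun i : 'I_1 * 'I_n => `|v i.1 i.2|) (0, i)).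
Qed.

Lemma qform_continuous (M : 'M[R]_n) : continuous (fun v : 'rV[R]_n => qform M v v).
Proof.
move=> v; apply: differentiable_continuous.
have -> : (fun v : 'rV[R]_n => qform M v v)
    = \sum_i \sum_j (fun v : 'rV[R]_n => v 0 i) * cst (M i j) * (fun v => v 0 j).
  apply/funext => u; rewrite qformE fct_sumE; apply: eq_bigr => i _.
  by rewrite fct_sumE.
apply: differentiable_sum => i; apply: differentiable_sum => j.
have d k : differentiable (fun v : 'rV[R]_n => v 0 k) v by exact: differentiable_coord.
have dc : differentiable (cst (M i j) : 'rV[R]_n -> R) v by exact: differentiable_cst.
exact: (differentiableM (differentiableM (d i) dc) (d j)).
Qed.

Lemma qformZ (M : 'M[R]_n) a v : qform M (a *: v) (a *: v) = a ^+ 2 * qform M v v.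
Proof.
rewrite !qformE mulr_sumr; apply: eq_bigr => i _; rewrite mulr_sumr.
by apply: eq_bigr => j _; rewrite !mxE; ring.
Qed.

Lemma sphere_compact : compact [set v : 'rV[R]_n | `|v| = 1].
Proof.
apply: bounded_closed_compact.
  exists 1; split; first exact: num_real.
  by move=> B hB v /= ->; exact: ltW.
apply: (@preimage_closed _ _ (fun v : 'rV[R]_n => `|v|) [set 1]).
  by move=> v _; exact: norm_continuous.
exact: closed_eq.
Qed.

(** Compactness of the unit sphere. *)
Lemma posdef_lower (M : 'M[R]_n) : (forall v, v != 0 -> 0 < qform M v v) ->
  exists2 c : R, 0 < c & forall v, c * `|v| ^+ 2 <= qform M v v.
Proof.
move=> Mp.
have [ne|empty] := pselect ([set v : 'rV[R]_n | `|v| = 1] !=set0); last first.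
  exists 1 => // v; have [->|v0] := eqVneq v 0.
    by rewrite normr0 expr0n mulr0 /qform mul0mx mul0mx mxE.
  case: empty; exists (`|v|^-1 *: v) => /=.
  by rewrite normrZ normfV normr_id mulVf // normr_eq0.
have [|v] := compact_EVT_min ne sphere_compact (f := fun v => qform M v v).
  by apply: continuous_subspaceT => v; exact: qform_continuous.
rewrite inE /= => v1 hv; exists (qform M v v).
  by apply: Mp; rewrite -normr_eq0 v1 oner_eq0.
move=> u; have [->|u0] := eqVneq u 0.
  by rewrite normr0 expr0n mulr0 /qform mul0mx mul0mx mxE.
have nu0 : `|u| != 0 by rewrite normr_eq0.
have := hv (`|u|^-1 *: u); rewrite inE /= normrZ normfV normr_id mulVf // => /(_ erefl).
rewrite qformZ => h.
have up : 0 < `|u| ^+ 2 by rewrite exprn_gt0 // normr_gt0.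
by move: h; rewrite exprVn mulrC ler_pdivlMr.
Qed.

(** Positive definiteness is an open condition on the entries. *)
Lemma posdef_near (T : Type) (F : set_system T) {FF : Filter F} (K : T -> 'M[R]_n)
    (K0 : 'M[R]_n) :
  (forall i j, K t i j @[t --> F] --> K0 i j) ->
  (forall v, v != 0 -> 0 < qform K0 v v) ->
  \forall t \near F, forall v, v != 0 -> 0 < qform (K t) v v.
Proof.
move=> cK /posdef_lower [c c0 hc].
pose eta := c / 2 / (n%:R * n%:R + 1).
have n0 : 0 < n%:R * n%:R + 1 :> R by rewrite ltr_wpDl // mulr_ge0.
have eta0 : 0 < eta by rewrite !divr_gt0.
have : \forall t \near F, forall ij : 'I_n * 'I_n, `|K0 ij.1 ij.2 - K t ij.1 ij.2| < eta.
  apply: filter_forall => -[i j] /=.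
  by have /cvgrPdist_lt := cK i j; apply.
apply: filterS => t ht v v0.
have nv : 0 < `|v| ^+ 2 by rewrite exprn_gt0 // normr_gt0.
have e : qform K0 v v - qform (K t) v v <= n%:R * n%:R * (eta * `|v| ^+ 2).
  rewrite !qformE -sumrB.
  have -> : n%:R * n%:R * (eta * `|v| ^+ 2) = \sum_(i < n) \sum_(j < n) (eta * `|v| ^+ 2).
    by rewrite sumr_const sumr_const card_ord -mulrA mulr_natl mulr_natl.
  apply: ler_sum => i _; rewrite -sumrB; apply: ler_sum => j _.
  have -> : v 0 i * K0 i j * v 0 j - v 0 i * K t i j * v 0 j
    = (K0 i j - K t i j) * (v 0 i * v 0 j) by ring.
  apply: (le_trans (ler_norm _)); rewrite normrM; apply: ler_pM => //.
    by apply/ltW; exact: (ht (i, j)).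
  by rewrite normrM expr2; apply: ler_pM => //; exact: rV_norm_coord.
have := hc v; suff : n%:R * n%:R * (eta * `|v| ^+ 2) < c * `|v| ^+ 2 by lra.
rewrite mulrA ltr_pM2r // /eta mulrCA -!mulrA gtr_pMr //.
have : n%:R * n%:R / (n%:R * n%:R + 1) < 1 :> R by rewrite ltr_pdivrMr // mul1r; lra.
have : 0 <= n%:R * n%:R / (n%:R * n%:R + 1) :> R by rewrite divr_ge0 ?mulr_ge0 // ltW.
rewrite -!mulrA; lra.
Qed.

End SecondOrder.

(** * Directional derivatives of formulas *)

Section DerivationRules.
Variables (R : realType) (E : normedModType R).
Implicit Types (f g : E -> R) (x v : E).

Lemma is_derive_from_line f (a v : E) d :
  is_derive (0 : R) (1 : R) (fun s : R => f (s *: v + a)) d -> is_derive a v f d.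
Proof.
have ea : 0 *: v + a = a by rewrite scale0r add0r.
have h := line_growth f a v 0.
case=> [df fd]; apply: DeriveDef.
  by move: df; rewrite /derivable h ea.
by move: fd; rewrite /derive h ea.
Qed.

(** The rules from here on are for functions written out as formulas in the
    variable, so that the derivative of a long expression is a proof term of the
    same shape. *)
Lemma der_cst (c : R) x v : is_derive x v (fun _ : E => c) 0.
Proof. exact: is_derive_cst. Qed.

Lemma derD f g x v df dg : is_derive x v f df -> is_derive x v g dg ->
  is_derive x v (fun y : E => f y + g y) (df + dg).
Proof. by move=> hf hg; exact: (is_deriveD hf hg). Qed.

Lemma derN f x v df : is_derive x v f df -> is_derive x v (fun y : E => - f y) (- df).
Proof. by move=> hf; exact: (is_deriveN hf). Qed.

Lemma derB f g x v df dg : is_derive x v f df -> is_derive x v g dg ->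
  is_derive x v (fun y : E => f y - g y) (df - dg).
Proof. by move=> hf hg; exact: (is_deriveB hf hg). Qed.

Lemma derM f g x v df dg : is_derive x v f df -> is_derive x v g dg ->
  is_derive x v (fun y : E => f y * g y) (df * g x + f x * dg).
Proof.
move=> hf hg; have h := is_deriveM hf hg.
by apply: (is_derive_eq h); rewrite /GRing.scale /= addrC mulrC.
Qed.

Lemma derZ c f x v df : is_derive x v f df ->
  is_derive x v (fun y : E => c * f y) (c * df).
Proof. by move=> hf; apply: is_derive_eq (derM (der_cst c x v) hf) _; rewrite mul0r add0r. Qed.

Lemma der_sum (I : Type) (r : seq I) (P : pred I) (F : I -> E -> R) (dF : I -> R) x v :
  (forall i, P i -> is_derive x v (F i) (dF i)) ->
  is_derive x v (fun y : E => \sum_(i <- r | P i) F i y) (\sum_(i <- r | P i) dF i).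
Proof.
move=> h; elim: r => [|i r IH].
  rewrite big_nil (_ : (fun _ => _) = (fun _ : E => 0)); first exact: der_cst.
  by apply/funext => y; rewrite big_nil.
rewrite big_cons (_ : (fun _ => _) =
    (fun y : E => if P i then F i y + \sum_(i <- r | P i) F i y
              else \sum_(i <- r | P i) F i y)); last first.
  by apply/funext => y; rewrite big_cons.
by case Pi: (P i) => //; apply: derD => //; exact: h.
Qed.

Lemma der_comp (h : R -> R) f x v h' df :
  is_derive (f x) (1 : R) h h' -> is_derive x v f df ->
  is_derive x v (fun y : E => h (f y)) (h' * df).
Proof.
move=> hh hf; apply: is_derive_from_line.
have ex : 0 *: v + x = x by rewrite scale0r add0r.
have hf' : is_derive (0 : R) (1 : R) (fun s : R => f (s *: v + x)) df.
  by apply: is_derive_line; rewrite ex.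
apply: (@is_derive1_comp R h (fun s : R => f (s *: v + x))).
by rewrite ex.
Qed.

Lemma der_cos f x v df : is_derive x v f df ->
  is_derive x v (fun y : E => cos (f y)) (- sin (f x) * df).
Proof. by apply: der_comp. Qed.

Lemma der_sin f x v df : is_derive x v f df ->
  is_derive x v (fun y : E => sin (f y)) (cos (f x) * df).
Proof. by apply: der_comp. Qed.

Lemma der_ln f x v df : 0 < f x -> is_derive x v f df ->
  is_derive x v (fun y : E => ln (f y)) ((f x)^-1 * df).
Proof. by move=> f0; apply: der_comp; exact: is_derive1_ln. Qed.

Lemma derV f x v df : f x != 0 -> is_derive x v f df ->
  is_derive x v (fun y : E => (f y)^-1) (- df / f x ^+ 2).
Proof.
move=> fx hf; have dv : derivable f x v by exact: ex_derive.
apply: DeriveDef; first exact: (derivableV fx dv).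
rewrite (deriveV fx dv) derive_val /GRing.scale /= -exprVn exprVn.
by rewrite !mulNr [X in - X]mulrC.
Qed.

Lemma der_near f g x v d : (\forall y \near x, f y = g y) ->
  is_derive x v f d -> is_derive x v g d.
Proof. exact: near_eq_is_derive. Qed.

End DerivationRules.

(** * The potential, its forces and its Hessian *)

Section Cosine.
Variable R : realType.
Implicit Types x y d : R.

Lemma cos_2pi_int x (k : int) : cos (x + 2 * pi * k%:~R) = cos x.
Proof.
have e : forall n y, cos (y + 2 * pi * n%:R) = cos y.
  move=> n y; have := periodicn (@cosD2pi R) n y.
  by rewrite mulr_natr mulr_natl.
case: k => n; first by rewrite -[RHS](e n).
by rewrite -[LHS](e n.+1) NegzE mulrNz mulrN -pmulrn subrK.
Qed.

Lemma sin_2pi_int x (k : int) : sin (x + 2 * pi * k%:~R) = sin x.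
Proof.
have e : forall n y, sin (y + 2 * pi * n%:R) = sin y.
  move=> n y; have := periodicn (@sinD2pi R) n y.
  by rewrite mulr_natr mulr_natl.
case: k => n; first by rewrite -[RHS](e n).
by rewrite -[LHS](e n.+1) NegzE mulrNz mulrN -pmulrn subrK.
Qed.

Lemma reduce_2pi x : exists k : int, 0 <= x + 2 * pi * k%:~R < 2 * pi.
Proof.
have p0 : 0 < 2 * pi :> R by rewrite mulr_gt0 // pi_gt0.
exists (- Num.floor (x / (2 * pi))).
have h1 := floor_itv (x / (2 * pi)).
move: h1 => /andP []; rewrite ler_pdivlMr // ltr_pdivrMr // rmorphN rmorphD /=.
by move=> h1 h2; apply/andP; split; nra.
Qed.

Lemma cos_eq1 x : 0 <= x < 2 * pi -> cos x = 1 -> x = 0.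
Proof.
move=> /andP [x0 x2] c1.
have p0 := pi_gt0 R.
have [xp|xp] := lerP x pi.
  by apply: cos_inj; rewrite ?in_itv /= ?lexx ?x0 ?xp ?pi_ge0 ?cos0.
have : 2 * pi - x = 0 :> R.
  apply: cos_inj; rewrite ?in_itv /= ?lexx ?pi_ge0 //.
    by apply/andP; split; lra.
  by rewrite cos0 -cosN opprB -[RHS]c1 -[LHS](cos_2pi_int _ 1) mulr1 subrK.
lra.
Qed.
End Cosine.

Section Potential.
Variables (R : realType).
Implicit Types d : R.

Definition pair_force d : R := sin d - sin d / (2 - 2 * cos d).

Definition pair_stiffness d : R := cos d + (2 - 2 * cos d)^-1.

Lemma pair_forceN d : pair_force (- d) = - pair_force d.
Proof. by rewrite /pair_force sinN cosN mulNr opprB opprK addrC. Qed.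

Lemma pair_stiffnessN d : pair_stiffness (- d) = pair_stiffness d.
Proof. by rewrite /pair_stiffness cosN. Qed.

Lemma pair_force_2pi d (k : int) : pair_force (d + 2 * pi * k%:~R) = pair_force d.
Proof. by rewrite /pair_force sin_2pi_int cos_2pi_int. Qed.

Lemma chord_gt0 d : cos d != 1 -> 0 < 2 - 2 * cos d.
Proof. by move=> c; have := cos_le1 d; rewrite le_eqVlt (negPf c) /=; lra. Qed.

Lemma chord_neq0 d : cos d != 1 -> 2 - 2 * cos d != 0.
Proof. by move=> /chord_gt0 h; rewrite gt_eqF. Qed.

Lemma der_pair_energy d : cos d != 1 ->
  is_derive d (1 : R) (fun d => cos d + 2^-1 * ln (2 - 2 * cos d)) (- pair_force d).
Proof.
move=> cd.
have dc : is_derive d (1 : R) (fun d => 2 - 2 * cos d) (2 * sin d).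
  have h : is_derive d (1 : R) (fun d : R => 2 - 2 * cos d) (0 - 2 * - sin d).
    exact: (derB (der_cst _ _ _) (derZ _ (is_derive_cos d))).
  by apply: (is_derive_eq h); ring.
have h := derD (is_derive_cos d) (derZ 2^-1 (der_ln (f := fun d : R => 2 - 2 * cos d) (chord_gt0 cd) dc)).
apply: (is_derive_eq h); rewrite /pair_force; field.
exact: chord_neq0.
Qed.

Lemma der_pair_force d : cos d != 1 ->
  is_derive d (1 : R) pair_force (pair_stiffness d).
Proof.
move=> cd.
have dc : is_derive d (1 : R) (fun d => 2 - 2 * cos d) (2 * sin d).
  have h : is_derive d (1 : R) (fun d : R => 2 - 2 * cos d) (0 - 2 * - sin d).
    exact: (derB (der_cst _ _ _) (derZ _ (is_derive_cos d))).
  by apply: (is_derive_eq h); ring.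
have h := derB (is_derive_sin d) (derM (is_derive_sin d) (derV (f := fun d : R => 2 - 2 * cos d) (chord_neq0 cd) dc)).
apply: (is_derive_eq h); rewrite /pair_stiffness.
have e := sin2cos2 d; have n0 := chord_neq0 cd.
transitivity (cos d - cos d / (2 - 2 * cos d) + 2 * sin d ^+ 2 / (2 - 2 * cos d) ^+ 2).
  by field.
by rewrite e; field.
Qed.

Variable N : nat.
Implicit Types (t v : 'rV[R]_N).

Definition angle_force t (i : 'I_N) : R :=
  \sum_(j < N | j != i) pair_force (t 0 i - t 0 j).

(** Distinctness modulo 2 pi, in the form in which the chord length enters V. *)
Lemma V_domainP t : V_domain t <-> forall i j, i != j -> cos (t 0 i - t 0 j) != 1.
Proof.
split=> ht i j ij.
  apply/eqP => c1; have [k hk] := reduce_2pi (t 0 i - t 0 j).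
  have := cos_eq1 hk; rewrite cos_2pi_int => /(_ c1) => /eqP.
  rewrite addr_eq0 => /eqP e; have := ht i j ij (- k).
  by rewrite e rmorphN /= mulrN eqxx.
move=> k; apply/eqP => e; have := ht i j ij.
by rewrite e -[2 * pi * _]add0r cos_2pi_int cos0 eqxx.
Qed.

Lemma V_domain_near t : V_domain t -> \forall u \near t, V_domain u.
Proof.
move=> /V_domainP ht.
suff h : \forall u \near t, forall ij : 'I_N * 'I_N,
    ij.1 != ij.2 -> cos ((u : 'rV[R]_N) 0 ij.1 - u 0 ij.2) != 1.
  by apply: filterS h => u hu; apply/V_domainP => i j ij; exact: (hu (i, j)).
apply: near_forall => -[i j] /=.
have [_|ij] := eqVneq i j; first by near=> u.
have c : cos ((u : 'rV[R]_N) 0 i - u 0 j) @[u --> t] --> cos (t 0 i - t 0 j).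
  apply: (continuous_comp (f := fun u : 'rV[R]_N => u 0 i - u 0 j)); last exact: continuous_cos.
  have cc k : (u : 'rV[R]_N) 0 k @[u --> t] --> t 0 k := @coord_continuous R 1 N 0 k t.
  exact: (cvgB (cc i) (cc j)).
have h : \forall u \near t, cos ((u : 'rV[R]_N) 0 i - u 0 j) < 1.
  by apply: (cvgr_lt _ c); rewrite lt_neqAle cos_le1 ht.
by apply: filterS h => u hu _; rewrite lt_eqF.
Unshelve. all: by end_near. Qed.

Lemma der_coord t v i : is_derive t v (fun u : 'rV[R]_N => u 0 i) (v 0 i).
Proof.
apply: is_derive_from_line.
have -> : (fun s : R => (s *: v + t) 0 i) = (fun s : R => v 0 i * s + t 0 i).
  by apply/funext => s; rewrite !mxE mulrC.
have h := derD (derZ (v 0 i) (is_derive_id (0 : R) (1 : R))) (der_cst (t 0 i) (0 : R) (1 : R)).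
by apply: (is_derive_eq h); rewrite addr0 mulr1.
Qed.

Lemma sum_ltn_sym (F : 'I_N -> 'I_N -> R) : (forall i j, F j i = F i j) ->
  \sum_(i < N) \sum_(j < N | j != i) F i j
  = 2 * \sum_(i < N) \sum_(j < N | (i < j)%N) F i j.
Proof.
move=> sF.
have e (i : 'I_N) : \sum_(j < N | j != i) F i j
    = \sum_(j < N | (i < j)%N) F i j + \sum_(j < N | (j < i)%N) F i j.
  rewrite (bigID (fun j : 'I_N => (i < j)%N)) /=; congr (_ + _); apply: eq_bigl => j.
    by rewrite andb_idl // => /gtn_eqF; rewrite -val_eqE => /= ->.
  by rewrite -leqNgt ltn_neqAle val_eqE.
rewrite (eq_bigr _ (fun i _ => e i)) big_split /= mulr_natl mulr2n; congr (_ + _).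
rewrite (exchange_big_dep predT) //=; apply: eq_bigr => i _.
by apply: eq_bigr => j _.
Qed.

(** Summation by parts for pair interactions with action equal to reaction. *)
Lemma sum_antisym (w : 'I_N -> 'I_N -> R) (a : 'I_N -> R) :
  (forall i j, w j i = - w i j) ->
  \sum_(i < N) a i * \sum_(j < N | j != i) w i j
  = \sum_(i < N) \sum_(j < N | (i < j)%N) w i j * (a i - a j).
Proof.
move=> aw.
have sF i j : w j i * (a j - a i) = w i j * (a i - a j) by rewrite aw; ring.
have := sum_ltn_sym sF => h.
have two : 2 != 0 :> R by rewrite pnatr_eq0.
apply: (mulfI two); rewrite -h; set X := \sum_(i < N) a i * _.
have e : - X = \sum_(i < N) \sum_(j < N | j != i) w i j * a j.
  rewrite [RHS](exchange_big_dep predT) //= -sumrN; apply: eq_bigr => j _.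
  rewrite -mulrN -sumrN mulr_sumr; apply: eq_big => [i|i _]; first by rewrite eq_sym.
  by rewrite -aw mulrC.
have -> : 2 * X = X - - X by ring.
rewrite e -sumrB; apply: eq_bigr => i _; rewrite mulr_sumr -sumrB.
by apply: eq_bigr => j _; ring.
Qed.

Lemma force_antisym t i j :
  pair_force (t 0 j - t 0 i) = - pair_force (t 0 i - t 0 j).
Proof. by rewrite -pair_forceN opprB. Qed.

Lemma der_V t v : V_domain t -> is_derive t v (@V R N) (\sum_i v 0 i * angle_force t i).
Proof.
move=> /V_domainP ht.
have h : is_derive t v (@V R N) (- \sum_(i < N) \sum_(j < N | (i < j)%N)
    (- pair_force (t 0 i - t 0 j) * (v 0 i - v 0 j))).
  apply: derN; apply: der_sum => i _; apply: der_sum => j ij.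
  apply: (@der_comp _ _ (fun d : R => cos d + 2^-1 * ln (2 - 2 * cos d))
    (fun t : 'rV[R]_N => t 0 i - t 0 j)).
    apply: der_pair_energy; apply: ht.
    by rewrite -val_eqE /= ltn_eqF.
  by apply: derB; exact: der_coord.
apply: (is_derive_eq h); rewrite (sum_antisym _ (force_antisym t)) -sumrN.
apply: eq_bigr => i _; rewrite -sumrN; apply: eq_bigr => j _.
by rewrite mulNr opprK.
Qed.

Lemma partial_V t i : V_domain t -> partial i (@V R N) t = angle_force t i.
Proof.
move=> /der_V h; have [_] := h (delta_mx 0 i); rewrite /partial => ->.
rewrite (bigD1 i) //= mxE !eqxx mul1r big1 ?addr0 // => j ji.
by rewrite mxE eqxx (negPf ji) mul0r.
Qed.

Lemma der_angle_force t v i : V_domain t ->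
  is_derive t v (fun u => angle_force u i)
    (\sum_(j < N | j != i) pair_stiffness (t 0 i - t 0 j) * (v 0 i - v 0 j)).
Proof.
move=> /V_domainP ht; apply: der_sum => j ji.
apply: (@der_comp _ _ pair_force (fun t : 'rV[R]_N => t 0 i - t 0 j)).
  by apply: der_pair_force; apply: ht; rewrite eq_sym.
by apply: derB; exact: der_coord.
Qed.

Lemma V_criticalE t : V_critical t <-> V_domain t /\ forall i, angle_force t i = 0.
Proof.
split=> -[td tc]; split=> // i; first by rewrite -partial_V.
by rewrite partial_V.
Qed.

Lemma hessianE t i j : V_domain t -> hessian (@V R N) t i j
  = \sum_(k < N | k != i) pair_stiffness (t 0 i - t 0 k) * ((i == j)%:R - (k == j)%:R).
Proof.
move=> td; rewrite mxE /partial.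
rewrite (@near_eq_derive _ _ _ _ (fun u => angle_force u i)); last first.
  by near=> u; apply: partial_V; near: u; exact: V_domain_near.
have [_ ->] := der_angle_force (delta_mx 0 j) i td.
by apply: eq_bigr => k _; rewrite !mxE !eqxx.
Unshelve. all: by end_near. Qed.

(** The Hessian of V is the Laplacian of the complete graph with edge weights
    [pair_stiffness]; these weights may be negative. *)
Lemma hessian_mul t i v : V_domain t -> \sum_j hessian (@V R N) t i j * v 0 j
  = \sum_(k < N | k != i) pair_stiffness (t 0 i - t 0 k) * (v 0 i - v 0 k).
Proof.
move=> td; transitivity (\sum_j \sum_(k < N | k != i)
    pair_stiffness (t 0 i - t 0 k) * ((i == j)%:R - (k == j)%:R) * v 0 j).
  by apply: eq_bigr => j _; rewrite hessianE // mulr_suml.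
rewrite exchange_big; apply: eq_bigr => k _ /=.
under eq_bigr do rewrite -mulrA.
rewrite -mulr_sumr; congr (_ * _).
have e (l : 'I_N) : \sum_j (l == j)%:R * v 0 j = v 0 l.
  rewrite (bigD1 l) //= eqxx mul1r big1 ?addr0 // => j jl.
  by rewrite eq_sym (negPf jl) mul0r.
by rewrite -(e i) -(e k) -sumrB; apply: eq_bigr => j _; rewrite mulrBl.
Qed.

Lemma hessian_sym t : V_domain t -> (hessian (@V R N) t)^T = hessian (@V R N) t.
Proof.
move=> td; apply/matrixP => i j; rewrite [LHS]mxE.
have [->//|ij] := eqVneq i j.
have e (a b : 'I_N) : a != b ->
    hessian (@V R N) t a b = - pair_stiffness (t 0 a - t 0 b).
  move=> ab; rewrite hessianE // (bigD1 b) /=; last by rewrite eq_sym.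
  rewrite (negPf ab) eqxx.
  rewrite big1 ?addr0; first by rewrite sub0r mulrN1.
  by move=> k /andP [_ kb]; rewrite (negPf kb) subr0 mulr0.
by rewrite (e i j ij) e 1?eq_sym // -pair_stiffnessN opprB.
Qed.

Lemma const_hessian t : V_domain t ->
  (const_mx 1 : 'rV[R]_N) *m hessian (@V R N) t = 0.
Proof.
move=> td; rewrite -[hessian _ _]hessian_sym //; apply/rowP => i.
rewrite !mxE; transitivity (\sum_j hessian (@V R N) t i j * (const_mx 1 : 'rV[R]_N) 0 j).
  by apply: eq_bigr => j _; rewrite !mxE mulrC.
by rewrite hessian_mul // big1 // => k _; rewrite !mxE subrr mulr0.
Qed.

End Potential.

(** * Configurations with zero vector sum *)

Section Descent.
Variables (R : realType) (N : nat).
Implicit Types (t u v : 'rV[R]_N).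

(** [cos_sum] and [sin_sum] are the coordinates of the vector sum of the N points on
    the unit circle. *)
Definition cos_sum t : R := \sum_i cos (t 0 i).
Definition sin_sum t : R := \sum_i sin (t 0 i).

Lemma sum_neq_ltn (F : 'I_N -> 'I_N -> R) : (forall i j, F j i = F i j) ->
  2 * (\sum_(i < N) \sum_(j < N | (i < j)%N) F i j)
  = \sum_i \sum_j F i j - \sum_i F i i.
Proof.
move=> sF; rewrite -sum_ltn_sym // -sumrB; apply: eq_bigr => i _.
by rewrite [in RHS](bigD1 i) //= addrAC subrr add0r.
Qed.

Lemma sum_ord_cst (c : R) : \sum_(i < N) c = N%:R * c.
Proof. by rewrite sumr_const card_ord mulr_natl. Qed.

Lemma sum_sum_mul (a b : 'I_N -> R) :
  \sum_i \sum_j a i * b j = (\sum_i a i) * (\sum_j b j).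
Proof. by rewrite mulr_suml; apply: eq_bigr => i _; rewrite mulr_sumr. Qed.

Lemma sinB_mul (a b : R) :
  sin (a - b) * (sin a - sin b) = (cos a + cos b) * (1 - cos (a - b)).
Proof.
rewrite sinB cosB; have ea := sin2cos2 a; have eb := sin2cos2 b.
transitivity (sin a ^+ 2 * cos b + cos a * sin b ^+ 2 - sin a * sin b * (cos a + cos b)).
  by ring.
by rewrite ea eb; ring.
Qed.

Lemma sinB_mul2 (a b : R) :
  sin (a - b) * (sin a * cos a - sin b * cos b)
  = (cos a * cos b - sin a * sin b + (1 - sin a ^+ 2 - sin b ^+ 2)) * (1 - cos (a - b)).
Proof.
rewrite sinB cosB.
transitivity (sin a ^+ 2 * (cos a * cos b) + cos a * cos b * sin b ^+ 2
   - sin a * sin b * cos b ^+ 2 - sin a * sin b * cos a ^+ 2); first by ring.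
have -> : cos a ^+ 2 = 1 - sin a ^+ 2 by rewrite cos2sin2.
have -> : cos b ^+ 2 = 1 - sin b ^+ 2 by rewrite cos2sin2.
transitivity ((1 - cos a * cos b - sin a * sin b) * (cos a * cos b - sin a * sin b + (1 - sin a ^+ 2 - sin b ^+ 2)) + ((cos a ^+ 2 * cos b ^+ 2 - (1 - sin a ^+ 2) * (1 - sin b ^+ 2)))); first by ring.
by rewrite -!cos2sin2; ring.
Qed.

Lemma sinB_sqr (a b : R) : cos (a - b) != 1 ->
  (sin a - sin b) ^+ 2 / (2 - 2 * cos (a - b)) = (1 + (cos a * cos b - sin a * sin b)) / 2.
Proof.
move=> c1; apply: (mulIf (chord_neq0 c1)); rewrite divfK ?chord_neq0 // cosB.
have ea := cos2sin2 a; have eb := cos2sin2 b.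
transitivity (sin a ^+ 2 + sin b ^+ 2 - 2 * sin a * sin b); first by ring.
transitivity (1 - 2 * sin a * sin b + sin a ^+ 2 * sin b ^+ 2 - cos a ^+ 2 * cos b ^+ 2).
  by rewrite ea eb; ring.
by field.
Qed.

(** The force splits into its bounded part, which sees the points only through
    their vector sum, and the singular part of the logarithm. *)
Lemma sum_force t (a : 'I_N -> R) :
  \sum_i a i * angle_force t i
  = cos_sum t * (\sum_i a i * sin (t 0 i)) - sin_sum t * (\sum_i a i * cos (t 0 i))
    - \sum_(i < N) \sum_(j < N | (i < j)%N)
        sin (t 0 i - t 0 j) / (2 - 2 * cos (t 0 i - t 0 j)) * (a i - a j).
Proof.
pose w (i j : 'I_N) := sin (t 0 i - t 0 j) / (2 - 2 * cos (t 0 i - t 0 j)).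
have aw i j : w j i = - w i j.
  by rewrite /w -(opprB (t 0 i)) sinN cosN mulNr.
rewrite -(sum_antisym a aw).
rewrite !mulr_sumr -!sumrB; apply: eq_bigr => i _.
have -> : angle_force t i = \sum_j sin (t 0 i - t 0 j) - \sum_(j < N | j != i) w i j.
  rewrite (bigD1 i) //= subrr sin0 add0r -sumrB; apply: eq_bigr => j _.
  by [].
rewrite mulrBr; congr (_ - _).
have -> : \sum_j sin (t 0 i - t 0 j) = sin (t 0 i) * cos_sum t - cos (t 0 i) * sin_sum t.
  rewrite !mulr_sumr -sumrB; apply: eq_bigr => j _.
  by rewrite sinB.
by ring.
Qed.

(** The infinitesimal Moebius map fixing the points 1 and - 1 of the circle moves
    the angle theta by a multiple of sin theta. Along it the logarithmic energy
    changes by a multiple of the vector sum, as [sinB_mul] cancels the chord. So a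
    configuration with zero vector sum is stationary in this direction. *)
Lemma sin_force t : V_domain t -> \sum_i sin (t 0 i) * angle_force t i
  = cos_sum t * (\sum_i sin (t 0 i) ^+ 2 - (N%:R - 1) / 2)
    - sin_sum t * (\sum_i sin (t 0 i) * cos (t 0 i)).
Proof.
move=> /V_domainP td; rewrite sum_force.
have -> : \sum_(i < N) \sum_(j < N | (i < j)%N)
    sin (t 0 i - t 0 j) / (2 - 2 * cos (t 0 i - t 0 j)) * (sin (t 0 i) - sin (t 0 j))
  = \sum_(i < N) \sum_(j < N | (i < j)%N) (cos (t 0 i) + cos (t 0 j)) / 2.
  apply: eq_bigr => i _; apply: eq_bigr => j ij.
  have n0 : 2 - 2 * cos (t 0 i - t 0 j) != 0.
    by apply: chord_neq0; apply: td; rewrite -val_eqE /= ltn_eqF.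
  by apply: (mulIf n0); rewrite mulrAC divfK // sinB_mul; field.
have h : 2 * (\sum_(i < N) \sum_(j < N | (i < j)%N) (cos (t 0 i) + cos (t 0 j)) / 2)
    = (N%:R - 1) * cos_sum t.
  rewrite sum_neq_ltn; last by move=> i j; rewrite addrC.
  have -> : \sum_i \sum_j (cos (t 0 i) + cos (t 0 j)) / 2 = N%:R * cos_sum t.
    transitivity (\sum_i (N%:R * (cos (t 0 i) / 2) + cos_sum t / 2)).
      apply: eq_bigr => i _; rewrite /cos_sum mulr_suml -sum_ord_cst -big_split.
      by apply: eq_bigr => j _; rewrite mulrDl.
    by rewrite big_split /= -mulr_sumr -mulr_suml sum_ord_cst -/(cos_sum t); field.
  have -> : \sum_i (cos (t 0 i) + cos (t 0 i)) / 2 = cos_sum t.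
    by apply: eq_bigr => i _; field.
  by rewrite mulrBl mul1r.
have -> : \sum_i sin (t 0 i) * sin (t 0 i) = \sum_i sin (t 0 i) ^+ 2.
  by apply: eq_bigr => i _; rewrite expr2.
lra.
Qed.

(** For N >= 3 a configuration with zero vector sum that is stationary in the
    direction sin (2 theta) satisfies the second order balance
    sum sin^2 = N / 2. *)
Lemma sin2_force t : V_domain t -> cos_sum t = 0 -> sin_sum t = 0 ->
  2 * \sum_i (sin (t 0 i) * cos (t 0 i)) * angle_force t i
  = (N%:R - 2) * (\sum_i sin (t 0 i) ^+ 2 - N%:R / 2).
Proof.
move=> /V_domainP td zx zy; rewrite sum_force zx zy !mul0r subrr sub0r.
have -> : \sum_(i < N) \sum_(j < N | (i < j)%N)
    sin (t 0 i - t 0 j) / (2 - 2 * cos (t 0 i - t 0 j))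
      * (sin (t 0 i) * cos (t 0 i) - sin (t 0 j) * cos (t 0 j))
  = \sum_(i < N) \sum_(j < N | (i < j)%N)
     (cos (t 0 i) * cos (t 0 j) - sin (t 0 i) * sin (t 0 j)
      + (1 - sin (t 0 i) ^+ 2 - sin (t 0 j) ^+ 2)) / 2.
  apply: eq_bigr => i _; apply: eq_bigr => j ij.
  have n0 : 2 - 2 * cos (t 0 i - t 0 j) != 0.
    by apply: chord_neq0; apply: td; rewrite -val_eqE /= ltn_eqF.
  by apply: (mulIf n0); rewrite mulrAC divfK // sinB_mul2; field.
rewrite mulrN sum_neq_ltn; last by move=> i j; congr (_ / _); ring.
set q := \sum_i sin (t 0 i) ^+ 2.
have -> : \sum_i \sum_j (cos (t 0 i) * cos (t 0 j) - sin (t 0 i) * sin (t 0 j)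
      + (1 - sin (t 0 i) ^+ 2 - sin (t 0 j) ^+ 2)) / 2
    = (N%:R * N%:R - 2 * N%:R * q) / 2.
  transitivity ((\sum_i \sum_j cos (t 0 i) * cos (t 0 j)
      - \sum_i \sum_j sin (t 0 i) * sin (t 0 j)
      + \sum_(i < N) (N%:R * (1 - sin (t 0 i) ^+ 2) - q)) / 2).
    rewrite -sumrB -big_split mulr_suml; apply: eq_bigr => i _ /=.
    rewrite -sumrB -sum_ord_cst /q -sumrB -big_split mulr_suml /=.
    by apply: eq_bigr => j _.
  rewrite !sum_sum_mul -/(cos_sum t) -/(sin_sum t) zx zy !mul0r subrr add0r.
  by rewrite sumrB -mulr_sumr sumrB !sum_ord_cst -/q; field.
have -> : \sum_i (cos (t 0 i) * cos (t 0 i) - sin (t 0 i) * sin (t 0 i)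
      + (1 - sin (t 0 i) ^+ 2 - sin (t 0 i) ^+ 2)) / 2 = N%:R - 2 * q.
  rewrite -[N%:R]mulr1 -sum_ord_cst /q mulr_sumr -sumrB; apply: eq_bigr => i _.
  by rewrite -!expr2 cos2sin2; field.
by field.
Qed.

(** The second derivative of V in the Moebius direction. The chord cancels again,
    by [sinB_sqr], and what remains is negative. *)
Lemma mobius_second t : V_domain t -> cos_sum t = 0 -> sin_sum t = 0 ->
  \sum_i sin (t 0 i) ^+ 2 = N%:R / 2 ->
  \sum_i - sin (t 0 i) * (\sum_(j < N | j != i)
     pair_stiffness (t 0 i - t 0 j) * (- sin (t 0 i) - - sin (t 0 j)))
  = - (\sum_i sin (t 0 i) * cos (t 0 i)) ^+ 2 - N%:R / 4.
Proof.
move=> /V_domainP td zx zy sq.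
have aw i j : pair_stiffness (t 0 j - t 0 i) * (- sin (t 0 j) - - sin (t 0 i))
    = - (pair_stiffness (t 0 i - t 0 j) * (- sin (t 0 i) - - sin (t 0 j))).
  by rewrite -(opprB (t 0 i)) pair_stiffnessN; ring.
rewrite (sum_antisym (fun i => - sin (t 0 i)) aw).
have -> : \sum_(i < N) \sum_(j < N | (i < j)%N)
    pair_stiffness (t 0 i - t 0 j) * (- sin (t 0 i) - - sin (t 0 j))
      * (- sin (t 0 i) - - sin (t 0 j))
  = \sum_(i < N) \sum_(j < N | (i < j)%N)
     ((sin (t 0 i) - sin (t 0 j)) ^+ 2 * (cos (t 0 i) * cos (t 0 j) + sin (t 0 i) * sin (t 0 j))
      + (1 + (cos (t 0 i) * cos (t 0 j) - sin (t 0 i) * sin (t 0 j))) / 2).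
  apply: eq_bigr => i _; apply: eq_bigr => j ij.
  rewrite -sinB_sqr; last by apply: td; rewrite -val_eqE /= ltn_eqF.
  by rewrite /pair_stiffness -cosB; ring.
have two : 2 != 0 :> R by rewrite pnatr_eq0.
apply: (mulfI two); rewrite sum_neq_ltn; last first.
  by move=> i j; rewrite -(opprB (sin (t 0 i))) sqrrN; congr (_ * _ + _ / _); ring.
set k := \sum_i sin (t 0 i) * cos (t 0 i).
set q := \sum_i sin (t 0 i) ^+ 2 in sq.
pose s i := sin (t 0 i); pose c i := cos (t 0 i).
have -> : \sum_i \sum_j ((sin (t 0 i) - sin (t 0 j)) ^+ 2 * (cos (t 0 i) * cos (t 0 j) + sin (t 0 i) * sin (t 0 j))
      + (1 + (cos (t 0 i) * cos (t 0 j) - sin (t 0 i) * sin (t 0 j))) / 2)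
  = - 2 * k ^+ 2 - 2 * q ^+ 2 + N%:R * N%:R / 2.
  transitivity (\sum_i \sum_j (s i ^+ 2 * c i) * c j + \sum_i \sum_j (s i ^+ 2 * s i) * s j
    + \sum_i \sum_j c i * (s j ^+ 2 * c j) + \sum_i \sum_j s i * (s j ^+ 2 * s j)
    - 2 * (\sum_i \sum_j (s i * c i) * (s j * c j)) - 2 * (\sum_i \sum_j s i ^+ 2 * s j ^+ 2)
    + (\sum_i \sum_j (c i * c j)) / 2 - (\sum_i \sum_j s i * s j) / 2 + \sum_(i < N) \sum_(j < N) 1 / 2).
    rewrite !mulr_sumr !mulr_suml -!big_split -!sumrB -!big_split -!sumrB -!big_split /=.
    apply: eq_bigr => i _; rewrite !mulr_sumr !mulr_suml -!big_split -!sumrB -!big_split -!sumrB -!big_split /=.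
    by apply: eq_bigr => j _; rewrite /s /c; ring.
  rewrite !sum_sum_mul -/(cos_sum t) -/(sin_sum t) zx zy !(mul0r, mulr0) !sum_ord_cst.
  by rewrite -/k -/q; field.
have -> : \sum_i ((sin (t 0 i) - sin (t 0 i)) ^+ 2 * (cos (t 0 i) * cos (t 0 i) + sin (t 0 i) * sin (t 0 i))
      + (1 + (cos (t 0 i) * cos (t 0 i) - sin (t 0 i) * sin (t 0 i))) / 2) = N%:R - q.
  rewrite -[N%:R]mulr1 -sum_ord_cst /q -sumrB; apply: eq_bigr => i _.
  by rewrite -!expr2 cos2sin2; field.
by rewrite sq; field.
Qed.
End Descent.

(** * The minimum of the potential and the regular polygon *)

Section Minima.
Variables (R : realType) (N : nat).
Implicit Types (t u v : 'rV[R]_N).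

Definition mobius_field t : 'rV[R]_N := \row_i - sin (t 0 i).

Lemma V_domain_line t v : V_domain t ->
  \forall s \near (0 : R), V_domain (s *: v + t).
Proof.
move=> /V_domain_near.
have c : (fun s : R => s *: v + t) s @[s --> (0 : R)] --> 0 *: v + t.
  by apply: cvgD; [apply: cvgZr_tmp; exact: cvg_id|exact: cvg_cst].
by rewrite -{1}[t]add0r -(scale0r v) => h; exact: c.
Qed.

Lemma der_V_line t v : V_domain t -> \forall s \near (0 : R),
  is_derive s (1 : R) (fun s : R => V (s *: v + t))
    (\sum_i v 0 i * angle_force (s *: v + t) i).
Proof.
move=> td; have h := V_domain_line v td; near=> s.
apply: is_derive_line; apply: der_V; near: s; exact: h.
Unshelve. all: by end_near. Qed.

Lemma V_line_min t v : V_domain t ->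
  (\forall s \near (0 : R)^'+, V t <= V (s *: v + t)) ->
  0 <= \sum_i v 0 i * angle_force t i.
Proof.
move=> td tmin; rewrite leNgt; apply/negP => neg.
have t0 : 0 *: v + t = t by rewrite scale0r add0r.
have d0 := nbhs_singleton (der_V_line v td); rewrite t0 in d0.
have dec := decr_near_right d0 neg.
have : \forall s \near (0 : R)^'+, False.
  by near=> s; have : V (s *: v + t) < V (0 *: v + t); [near: s|
    rewrite t0 ltNge (_ : V t <= _)//; near: s].
by move=> /filter_ex [].
Unshelve. all: by end_near. Qed.

(** Under the stated stationarity [sin2_force] gives the balance needed in
    [mobius_second]; the first derivative along the Moebius field vanishes by
    [sin_force]. *)
Lemma V_descent t : (3 <= N)%N -> V_domain t -> cos_sum t = 0 -> sin_sum t = 0 ->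
  \sum_i (sin (t 0 i) * cos (t 0 i)) * angle_force t i = 0 ->
  \forall s \near (0 : R)^'+, V (s *: mobius_field t + t) < V t.
Proof.
move=> N3 td zx zy s2; set v := mobius_field t.
have N3R : 3 <= N%:R :> R by rewrite (ler_nat _ 3).
(* N - 2 is not 0 *)
have sq : \sum_i sin (t 0 i) ^+ 2 = N%:R / 2.
  have := sin2_force td zx zy; rewrite s2 mulr0 => /esym/eqP; rewrite mulf_eq0 => /orP [] /eqP; lra.
have t0 : 0 *: v + t = t by rewrite scale0r add0r.
have h := @second_derivative_decr R (fun s : R => V (s *: v + t))
  (fun s : R => \sum_i v 0 i * angle_force (s *: v + t) i)
  (- (\sum_i sin (t 0 i) * cos (t 0 i)) ^+ 2 - N%:R / 4) (der_V_line v td).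
rewrite t0 in h; apply: h.
- have := sin_force td; rewrite zx zy !mul0r subrr => e.
  by apply/eqP; rewrite -oppr_eq0 -sumrN -[eqbRHS]e; apply/eqP; apply: eq_bigr => i _;
    rewrite mxE mulNr opprK.
- rewrite -(mobius_second td zx zy sq).
  apply: (@is_derive_line R _ (fun u => \sum_i v 0 i * angle_force u i)).
  rewrite t0; have hs := @der_sum R _ 'I_N (index_enum _) predT
    (fun i u => v 0 i * angle_force u i)
    (fun i => v 0 i * (\sum_(j < N | j != i) pair_stiffness (t 0 i - t 0 j) * (v 0 i - v 0 j))) t v
    (fun i _ => derZ (v 0 i) (der_angle_force v i td)).
  apply: (is_derive_eq hs); apply: eq_bigr => i _; rewrite !mxE; congr (_ * _).
  by apply: eq_bigr => j _; rewrite !mxE.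
- have := sqr_ge0 (\sum_i sin (t 0 i) * cos (t 0 i)); lra.
Qed.

Definition pair_weight (d : R) : R := expR (2 * cos d) * (2 - 2 * cos d).

(** This is exp (- 2 V), written so that it is continuous on the whole torus and
    zero exactly at the collisions. Maximising it minimises V. *)
Definition weight t : R := \prod_(i < N) \prod_(j < N | (i < j)%N) pair_weight (t 0 i - t 0 j).

Lemma weightE t : V_domain t -> weight t = expR (- 2 * V t).
Proof.
move=> /V_domainP td.
have h : weight t = \prod_(i < N) \prod_(j < N | (i < j)%N)
   expR (2 * (cos (t 0 i - t 0 j) + 2^-1 * ln (2 - 2 * cos (t 0 i - t 0 j)))).
  apply: eq_bigr => i _; apply: eq_bigr => j ij.
  rewrite mulrDr expRD mulrA mulfV ?mul1r ?pnatr_eq0 // lnK //.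
  by rewrite posrE chord_gt0 // td // -val_eqE /= ltn_eqF.
rewrite h; have e (I : Type) (r : seq I) (P : pred I) (F : I -> R) :
    \prod_(i <- r | P i) expR (F i) = expR (\sum_(i <- r | P i) F i).
  by rewrite (big_morph _ (@expRD R) (expR0 R)).
under eq_bigr do rewrite e.
rewrite e; congr expR; rewrite /V mulrN mulNr opprK mulr_sumr.
by apply: eq_bigr => i _; rewrite mulr_sumr.
Qed.

Lemma weight_gt0 t : V_domain t -> 0 < weight t.
Proof. by move=> td; rewrite weightE // expR_gt0. Qed.

Lemma weight_domain t : 0 < weight t -> V_domain t.
Proof.
move=> tw; apply/V_domainP.
have h (i j : 'I_N) : (i < j)%N -> cos (t 0 i - t 0 j) != 1.
  move=> ij; apply/eqP => c1; move: tw.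
  rewrite /weight (bigD1 i) //= (bigD1 j) //= /pair_weight c1 mulr1 subrr mulr0.
  by rewrite !mul0r ltxx.
move=> i j ij; have [ltij|ltji|eij] := ltngtP i j; first exact: h.
  by rewrite -cosN opprB h.
by case/eqP: ij; apply: val_inj.
Qed.

Lemma le_weight t u : V_domain t -> V_domain u -> weight u <= weight t -> V t <= V u.
Proof. by move=> td ud; rewrite !weightE // ler_expR; lra. Qed.

Lemma weight_continuous : continuous weight.
Proof.
have cp (I : Type) (r : seq I) (P : pred I) (F : I -> 'rV[R]_N -> R) :
    (forall i, continuous (F i)) -> continuous (fun t => \prod_(i <- r | P i) F i t).
  move=> cF; elim: r => [|i r IH] t.
    have -> : (fun t => \prod_(i <- [::] | P i) F i t) = fun=> 1.
      by apply/funext => u; rewrite big_nil.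
    exact: cst_continuous.
  have -> : (fun t => \prod_(i <- i :: r | P i) F i t) =
      (fun t => (if P i then F i t else 1) * \prod_(i <- r | P i) F i t).
    by apply/funext => u; rewrite big_cons; case: (P i) => //; rewrite mul1r.
  have h : {for t, continuous (fun t => if P i then F i t else 1)}.
    by case: (P i); [exact: cF|exact: cst_continuous].
  exact: (cvgM h (IH t)).
apply: (cp) => i; apply: (cp) => j t.
have cd : (u 0 i - u 0 j) @[u --> t] --> t 0 i - t 0 j.
  have cc k : (u : 'rV[R]_N) 0 k @[u --> t] --> t 0 k := @coord_continuous R 1 N 0 k t.
  exact: (cvgB (cc i) (cc j)).
have cw : {for t 0 i - t 0 j, continuous pair_weight}.
  apply: differentiable_continuous; apply/derivable1_diffP.
  have h : is_derive (t 0 i - t 0 j) (1 : R) (fun d : R => expR (2 * cos d) * (2 - 2 * cos d)) _ :=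
   derM (der_comp (is_derive_expR _) (derZ 2 (is_derive_cos (t 0 i - t 0 j)))) (derB (der_cst 2 _ _) (derZ 2 (is_derive_cos (t 0 i - t 0 j)))).
  exact: ex_derive.
exact: (cvg_comp _ _ cd cw).
Qed.

Lemma cube_compact : compact [set t : 'rV[R]_N | forall i, 0 <= t 0 i <= 2 * pi].
Proof.
have h := @rV_compact R N (fun=> `[0, (2 * pi : R)]%classic)
  (fun _ => @segment_compact R 0 (2 * pi)).
have -> // : [set t : 'rV[R]_N | forall i, 0 <= t 0 i <= 2 * pi]
  = [set v : 'rV[R]_N | forall i, `[0, (2 * pi : R)]%classic (v ord0 i)].
by apply/seteqP; split => t /= ht i; have := ht i; rewrite /= in_itv.
Qed.

Definition shift_2pi t (k : 'I_N -> int) : 'rV[R]_N := \row_i (t 0 i + 2 * pi * (k i)%:~R).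

Lemma weight_shift_2pi t k : weight (shift_2pi t k) = weight t.
Proof.
apply: eq_bigr => i _; apply: eq_bigr => j _; rewrite !mxE.
rewrite (_ : _ - _ = t 0 i - t 0 j + 2 * pi * (k i - k j)%:~R).
  by rewrite /pair_weight cos_2pi_int.
by rewrite rmorphB /= mulrBr; ring.
Qed.

Definition ngon (a : R) : 'rV[R]_N := \row_i (2 * pi * i%:R / N%:R + a).

Lemma ngon_domain a : V_domain (ngon a).
Proof.
move=> i j ij k; rewrite !mxE; apply/eqP => e.
have N0 : N%:R != 0 :> R by rewrite pnatr_eq0 -lt0n (leq_ltn_trans _ (ltn_ord i)).
have p0 : 2 * pi != 0 :> R by rewrite mulf_neq0 ?pnatr_eq0 // gt_eqF // pi_gt0.
have e2 : (i%:Z - j%:Z)%:~R = (k * N%:Z)%:~R :> R.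
  rewrite rmorphB rmorphM /= -!pmulrn; apply: (mulfI p0); apply: (mulIf (invr_neq0 N0)).
  transitivity (2 * pi * k%:~R : R); last by field.
  by rewrite -e; field.
have {}e2 : i%:Z - j%:Z = k * N%:Z by apply: (intr_inj e2).
have iN := ltn_ord i; have jN := ltn_ord j.
move/eqP: ij; apply; apply: val_inj => /=.
have k0 : k = 0 by nia.
by rewrite k0 mul0r in e2; lia.
Qed.

(** Turning the polygon by one step permutes its vertices, so the vector sum is
    fixed by a nontrivial rotation. *)
Lemma ngon_sums a : (2 <= N)%N -> cos_sum (ngon a) = 0 /\ sin_sum (ngon a) = 0.
Proof.
move=> N2; set al : R := 2 * pi / N%:R.
have N0 : N%:R != 0 :> R by rewrite pnatr_eq0 -lt0n (leq_trans _ N2).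
have stp (i : 'I_N) : exists k : int,
    ngon a 0 (ordS i) = ngon a 0 i + al + 2 * pi * k%:~R.
  rewrite !mxE /= /al; have [iN|iN] := ltnP i.+1 N.
    by exists 0; rewrite modn_small // -natr1; field.
  have iE : i.+1 = N by apply/eqP; rewrite eqn_leq iN ltn_ord.
  exists (-1); rewrite iE modnn.
  have -> : i%:R = N%:R - 1 :> R.
    by have := congr1 (fun n : nat => n%:R : R) iE; rewrite -natr1 => <-; rewrite addrK.
  by rewrite rmorphN1; field.
have bS : bijective (@ordS N) by apply: injF_bij; exact: ordS_inj.
have eC : cos_sum (ngon a) = cos al * cos_sum (ngon a) - sin al * sin_sum (ngon a).
  rewrite {1}/cos_sum (reindex _ (onW_bij _ bS)) /= !mulr_sumr -sumrB.
  apply: eq_bigr => i _; have [k ->] := stp i.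
  by rewrite cos_2pi_int cosD; ring.
have eS : sin_sum (ngon a) = cos al * sin_sum (ngon a) + sin al * cos_sum (ngon a).
  rewrite {1}/sin_sum (reindex _ (onW_bij _ bS)) /= !mulr_sumr -big_split.
  apply: eq_bigr => i _ /=; have [k ->] := stp i.
  by rewrite sin_2pi_int sinD; ring.
have al1 : cos al != 1.
  apply/eqP => c1; have : al = 0.
    apply: cos_eq1 c1; rewrite /al; have p0 := pi_gt0 R.
    have Np : 1 < N%:R :> R by rewrite (ltr_nat _ 1).
    rewrite divr_ge0 ?mulr_ge0 ?ltW //=; last by lra.
    rewrite ltr_pdivrMr; last by lra.
    by rewrite ltr_pMr // mulr_gt0.
  by move/eqP; rewrite /al !mulf_eq0 invr_eq0 (negPf N0) pnatr_eq0 /= gt_eqF // pi_gt0.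
have cl := cos_le1 al; have c0 : 0 < 1 - cos al by rewrite subr_gt0 lt_neqAle al1.
have cs := cos2Dsin2 al.
set C := cos_sum _ in eC eS *; set S := sin_sum _ in eC eS *.
have dC : (1 - cos al) * C = - (sin al * S) by lra.
have dS : (1 - cos al) * S = sin al * C by lra.
have k0 : (2 - 2 * cos al) * C = 0.
  have -> : 2 - 2 * cos al = (1 - cos al) ^+ 2 + sin al ^+ 2.
    by rewrite -{1}[2](_ : 1 + 1 = 2) // -{1}cs; ring.
  by rewrite mulrDl !expr2 -!mulrA dC -dS; ring.
have k1 : (2 - 2 * cos al) * S = 0.
  have -> : 2 - 2 * cos al = (1 - cos al) ^+ 2 + sin al ^+ 2.
    by rewrite -{1}[2](_ : 1 + 1 = 2) // -{1}cs; ring.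
  by rewrite mulrDl !expr2 -!mulrA dS mulrCA dC; ring.
have n0 : 2 - 2 * cos al != 0 by rewrite gt_eqF //; lra.
by split; apply: (mulfI n0); rewrite mulr0.
Qed.

(** A permutation of the indices that reverses all angles modulo 2 pi reverses all
    forces. The shifts [c] account for the choice of representatives of the
    angles. *)
Lemma angle_force_reflect t (s : 'I_N -> 'I_N) (c : 'I_N -> R) i :
  involutive s -> (forall j, cos (c j) = 1) ->
  (forall j, t 0 (s j) = c j - t 0 j) ->
  angle_force t (s i) = - angle_force t i.
Proof.
move=> sK c1 ts; have c0 j : sin (c j) = 0 by apply: cos1sin0; rewrite c1 normr1.
have bs : bijective s by exists s.
rewrite /angle_force (reindex _ (onW_bij _ bs)) /= -sumrN.
apply: eq_big => [j|j _]; first by rewrite (can_eq sK).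
rewrite !ts -pair_forceN /pair_force.
have -> : c i - t 0 i - (c j - t 0 j) = (c i - c j) + (t 0 j - t 0 i) by ring.
have es x : sin (c i - c j + x) = sin x by rewrite sinD sinB cosB !c1 !c0; ring.
have ec x : cos (c i - c j + x) = cos x by rewrite cosD sinB cosB !c1 !c0; ring.
by rewrite es ec opprB.
Qed.

(** The reflection in the axis through vertex i permutes the vertices and fixes i,
    so it reverses the force on i. *)
Lemma ngon_critical a : (2 <= N)%N -> V_critical (ngon a).
Proof.
move=> N2; apply/V_criticalE; split; first exact: ngon_domain.
move=> i.
have N0 : (0 < N)%N by exact: leq_trans N2.
pose f (j : 'I_N) : 'I_N := Ordinal (ltn_pmod (2 * i + (N - j)) N0).
have N0R : N%:R != 0 :> R by rewrite pnatr_eq0 -lt0n.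
have hf (j : 'I_N) : exists k : int,
    ngon a 0 (f j) = 2 * ngon a 0 i - ngon a 0 j + 2 * pi * k%:~R.
  exists (1 - (((2 * i + (N - j)) %/ N)%N)%:Z).
  rewrite !mxE /=.
  have : (((2 * i + (N - j)) %% N)%N)%:R = 2 * i%:R + (N%:R - j%:R)
      - ((2 * i + (N - j)) %/ N)%:R * N%:R :> R.
    have := divn_eq (2 * i + (N - j)) N => /(congr1 (fun n => n%:R : R)).
    rewrite natrD natrM natrB; last exact: ltnW.
    by rewrite [in RHS]natrD natrM; lra.
  by move=> ->; rewrite rmorphB /= -pmulrn; field.
have finj : injective f.
  move=> j k /(congr1 val) /= /eqP.
  rewrite eqn_modDl => /eqP h; apply: val_inj => /=.
  have jN := ltn_ord j; have kN := ltn_ord k.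
  by have := h; case: (posnP j) => [j0|j0]; case: (posnP k) => [k0|k0]; 
    rewrite ?j0 ?k0 ?subn0 ?modnn ?modn_small; lia.
have fi : f i = i.
  apply: val_inj => /=; rewrite mul2n -addnn -addnA subnKC; last exact: ltnW.
  by rewrite modnDr modn_small.
have bf : bijective f by exact: injF_bij.
have : angle_force (ngon a) i = - angle_force (ngon a) i; last by lra.
rewrite {1}/angle_force (reindex _ (onW_bij _ bf)) /= -sumrN.
apply: eq_big => [j|j _]; first by rewrite -(inj_eq finj j i) fi.
have [k ->] := hf j.
rewrite -pair_forceN opprB -(pair_force_2pi _ k); congr pair_force.
by ring.
Qed.

Lemma V_min_force t : V_domain t -> (forall u, V_domain u -> V t <= V u) ->
  forall i, angle_force t i = 0.
Proof.
move=> td tmin i.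
have h (v : 'rV[R]_N) : 0 <= \sum_j v 0 j * angle_force t j.
  apply: V_line_min => //; have [e /= e0 he] := V_domain_line v td.
  by exists e => //= s se _; apply: tmin; apply: he.
have e : \sum_j (delta_mx 0 i : 'rV[R]_N) 0 j * angle_force t j = angle_force t i.
  rewrite (bigD1 i) //= mxE !eqxx mul1r big1 ?addr0 // => j ji.
  by rewrite mxE eqxx (negPf ji) mul0r.
have h1 := h (delta_mx 0 i); have h2 := h (- delta_mx 0 i).
have : \sum_j (- (delta_mx 0 i : 'rV[R]_N)) 0 j * angle_force t j = - angle_force t i.
  by rewrite -e -sumrN; apply: eq_bigr => j _; rewrite mxE mulNr.
by move=> e2; rewrite e2 in h2; rewrite e in h1; lra.
Qed.

(** The maximum of [weight] over a period cell is positive, because the polygon has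
    no collision, and it is a global maximum by periodicity. *)
Lemma V_has_min : exists2 t : 'rV[R]_N, V_domain t & forall u : 'rV[R]_N, V_domain u -> V t <= V u.
Proof.
have ne : [set t : 'rV[R]_N | forall i, 0 <= t 0 i <= 2 * pi] !=set0.
  by exists 0 => i; rewrite mxE lexx mulr_ge0 ?pi_ge0.
have [|t _ tmax] := compact_EVT_max ne cube_compact (f := weight).
  by apply: continuous_subspaceT; exact: weight_continuous.
have wmax u : weight u <= weight t.
  have [k hk] := choice (fun i : 'I_N => reduce_2pi (u 0 i)).
  rewrite -(weight_shift_2pi u k); apply: tmax; rewrite inE /= => i.
  by rewrite mxE; have /andP [-> /ltW ->] := hk i.
have td : V_domain t.
  apply: weight_domain; apply: lt_le_trans (wmax (ngon 0)).
  by apply: weight_gt0; exact: ngon_domain.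
by exists t => // u ud; apply: le_weight.
Qed.

(** A minimum has no force, so [V_descent] would apply. *)
Lemma V_min_sum t : (3 <= N)%N -> V_domain t -> (forall u, V_domain u -> V t <= V u) ->
  ~ (cos_sum t = 0 /\ sin_sum t = 0).
Proof.
move=> N3 td tmin [zx zy]; have p0 := V_min_force td tmin.
have dec : \forall s \near (0 : R)^'+, V (s *: mobius_field t + t) < V t.
  by apply: V_descent => //; rewrite big1 // => i _; rewrite p0 mulr0.
have dom : \forall s \near (0 : R)^'+, V_domain (s *: mobius_field t + t).
  by have [e /= e0 he] := V_domain_line (mobius_field t) td; exists e => //= s se _; apply: he.
have : \forall s \near (0 : R)^'+, False.
  near=> s; have ds : V_domain (s *: mobius_field t + t) by near: s.
  have : V (s *: mobius_field t + t) < V t by near: s.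
  by rewrite ltNge tmin.
by move=> /filter_ex [].
Unshelve. all: by end_near. Qed.

End Minima.

(** * Critical points symmetric about an axis *)

Section Symmetric.
Variables (R : realType) (N : nat).
Implicit Types (t u v : 'rV[R]_N).
Variables (s : 'I_N -> 'I_N) (c : 'I_N -> R).
Hypotheses (sK : involutive s) (c1 : forall j, cos (c j) = 1).

(** Configurations invariant under reflection in the first axis, the vortices i and
    s i being mirror images. The shifts [c] (multiples of 2 pi) make it possible
    for an angle and its mirror image to lie both in [0, 2 pi]. The last condition
    orients the axis; it is not active at the minimiser of V. *)
Definition symmetric_cube : set 'rV[R]_N :=
  [set t : 'rV[R]_N | (forall i, 0 <= t 0 i <= 2 * pi) /\ (forall i, t 0 (s i) = c i - t 0 i) /\
     0 <= cos_sum t].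

Lemma cos_sum_continuous : continuous (@cos_sum R N).
Proof.
move=> t; apply: differentiable_continuous.
have -> : @cos_sum R N = \sum_(i < N) (fun t : 'rV[R]_N => cos (t 0 i)).
  by apply/funext => u; rewrite fct_sumE.
apply: differentiable_sum => i.
apply: (@differentiable_comp _ _ _ _ (fun t : 'rV[R]_N => t 0 i) cos).
  exact: differentiable_coord.
by apply/derivable1_diffP; exact: derivable_cos.
Qed.

Lemma der_cos_sum t v : is_derive t v (@cos_sum R N) (\sum_i - sin (t 0 i) * v 0 i).
Proof. by apply: der_sum => i _; apply: der_cos; exact: der_coord. Qed.

Lemma symmetric_cube_compact : compact symmetric_cube.
Proof.
suff cl : closed symmetric_cube.
  by apply: (subclosed_compact cl (@cube_compact R N)) => t [].
have cc (k : 'I_N) : continuous (fun t : 'rV[R]_N => t 0 k).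
  exact: coord_continuous.
have -> : symmetric_cube = [set t : 'rV[R]_N | forall i, 0 <= t 0 i <= 2 * pi] `&`
    (\bigcap_i [set t : 'rV[R]_N | t 0 (s i) + t 0 i = c i] `&` [set t | 0 <= cos_sum t]).
  apply/seteqP; split => t.
    by move=> [h1 [h2 h3]]; split=> //; split=> // i _ /=; rewrite h2 subrK.
  move=> [h1 [h2 h3]]; split=> //; split=> // i.
  by have /= <- := h2 i I; rewrite addrK.
apply: closedI; first by apply: compact_closed; [exact: norm_hausdorff|exact: cube_compact].
apply: closedI.
  apply: closed_bigI => i _.
  apply: (@preimage_closed _ _ (fun t : 'rV[R]_N => t 0 (s i) + t 0 i) [set c i]).
    by move=> t _; exact: (cvgD (cc (s i) t) (cc i t)).
  exact: closed_eq.
apply: (@preimage_closed _ _ (@cos_sum R N) [set x | 0 <= x]).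
  by move=> t _; exact: cos_sum_continuous.
exact: closed_ge.
Qed.

Lemma sym_sin_cos t : (forall i, t 0 (s i) = c i - t 0 i) ->
  forall i, sin (t 0 (s i)) = - sin (t 0 i) /\ cos (t 0 (s i)) = cos (t 0 i).
Proof.
move=> ts i; have c0 : sin (c i) = 0 by apply: cos1sin0; rewrite c1 normr1.
by rewrite ts sinB cosB c0 c1; split; ring.
Qed.

Lemma sym_sin_sum t : (forall i, t 0 (s i) = c i - t 0 i) -> sin_sum t = 0.
Proof.
move=> ts; have bs : bijective s by exists s.
have : sin_sum t = - sin_sum t; last by lra.
rewrite {1}/sin_sum (reindex _ (onW_bij _ bs)) /= -sumrN; apply: eq_bigr => i _.
by have [-> _] := sym_sin_cos ts i.
Qed.

(** An angle on the boundary of the cube would make the vortex collide with its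
    mirror image, unless the vortex is its own mirror image, and then v does not
    move it. *)
Lemma symmetric_cube_interior t v : V_domain t -> symmetric_cube t ->
  (forall i, v 0 (s i) = - v 0 i) ->
  \forall z \near (0 : R), forall i, 0 <= (z *: v + t) 0 i <= 2 * pi.
Proof.
move=> /V_domainP td [tc [ts _]] vs; apply: near_forall => i.
have [si|si] := eqVneq (s i) i.
  have vi : v 0 i = 0 by have := vs i; rewrite si => ?; lra.
  by near=> z; rewrite !mxE vi mulr0 add0r; exact: tc.
have ndup : cos (2 * t 0 i) != 1.
  have := td i (s i); rewrite eq_sym si ts => /(_ isT).
  have c0 : sin (c i) = 0 by apply: cos1sin0; rewrite c1 normr1.
  have -> : t 0 i - (c i - t 0 i) = 2 * t 0 i - c i by ring.
  by rewrite cosB c0 c1 mulr1 mulr0 addr0.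
have t0 : t 0 i != 0 by apply: contra_neq ndup => ->; rewrite mulr0 cos0.
have t2 : t 0 i != 2 * pi.
  apply: contra_neq ndup => ->.
  have -> : 2 * (2 * pi) = 0 + 2 * pi * (2 : int)%:~R :> R by rewrite add0r mulrC.
  by rewrite cos_2pi_int cos0.
have /andP [h1 h2] := tc i.
have cz : (fun z : R => (z *: v + t) 0 i) z @[z --> (0 : R)] --> t 0 i.
  have -> : (fun z : R => (z *: v + t) 0 i) = (fun z => z * v 0 i + t 0 i).
    by apply/funext => z; rewrite !mxE.
  have h : z * v 0 i + t 0 i @[z --> (0 : R)] --> 0 * v 0 i + t 0 i.
    by apply: cvgD; [apply: cvgM; [exact: cvg_id|exact: cvg_cst]|exact: cvg_cst].
  by rewrite mul0r add0r in h.
have lo : 0 < t 0 i by rewrite lt_def t0.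
have hi : t 0 i < 2 * pi by rewrite lt_neqAle t2.
have n1 : \forall z \near (0 : R), 0 < (z *: v + t) 0 i by exact: (cvgr_gt _ cz).
have n2 : \forall z \near (0 : R), (z *: v + t) 0 i < 2 * pi by exact: (cvgr_lt _ cz).
near=> z; apply/andP; split; apply/ltW; near: z; [exact: n1|exact: n2].
Unshelve. all: by end_near. Qed.

Lemma symmetric_cube_line t v : V_domain t -> symmetric_cube t ->
  (forall i, v 0 (s i) = - v 0 i) ->
  (\forall z \near (0 : R)^'+, 0 <= cos_sum (z *: v + t)) ->
  \forall z \near (0 : R)^'+, symmetric_cube (z *: v + t).
Proof.
move=> td tsym vs h; have [e /= e0 he] := symmetric_cube_interior td tsym vs.
have n : \forall z \near (0 : R)^'+, forall i, 0 <= (z *: v + t) 0 i <= 2 * pi.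
  by exists e => //= z ze _; apply: he.
case: tsym => _ [ts _].
near=> z; split; [near: z; exact: n|split; last by near: z; exact: h].
by move=> i; rewrite !mxE vs ts; ring.
Unshelve. all: by end_near. Qed.

Lemma cos_sum_incr t v : 0 <= cos_sum t -> 0 < \sum_i - sin (t 0 i) * v 0 i ->
  \forall z \near (0 : R)^'+, 0 < cos_sum (z *: v + t).
Proof.
move=> zx vp; have t0 : 0 *: v + t = t by rewrite scale0r add0r.
have d : is_derive (0 : R) (1 : R) (fun z : R => - cos_sum (z *: v + t))
    (- \sum_i - sin (t 0 i) * v 0 i).
  by apply: derN; apply: is_derive_line; rewrite t0; exact: der_cos_sum.
have := decr_near_right d; rewrite oppr_lt0 => /(_ vp); rewrite t0.
by apply: filterS => z; rewrite ltrN2; exact: le_lt_trans.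
Qed.

(** The axis meets the circle in two points only, so one of three vortices is off
    the axis. *)
Lemma sum_sin_sqr_gt0 t : (3 <= N)%N -> V_domain t -> (forall i, t 0 (s i) = c i - t 0 i) ->
  0 < \sum_i sin (t 0 i) ^+ 2.
Proof.
move=> N3 /V_domainP td ts; rewrite lt_def sumr_ge0 ?andbT; last by move=> i _; exact: sqr_ge0.
apply/eqP => /eqP; rewrite psumr_eq0; last by move=> i _; exact: sqr_ge0.
move=> /allP h; have s0 i : sin (t 0 i) = 0.
  by have := h i (mem_index_enum i); rewrite /= sqrf_eq0 => /eqP.
have pm i : cos (t 0 i) = 1 \/ cos (t 0 i) = -1.
  have := cos2Dsin2 (t 0 i); rewrite s0 expr0n addr0 => /eqP.
  by rewrite sqrf_eq1 => /orP [] /eqP; [left|right].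
have dif i j : i != j -> cos (t 0 i) != cos (t 0 j).
  move=> /td; apply: contra_neq => e; rewrite cosB e !s0 mulr0 addr0 -expr2.
  by have := cos2Dsin2 (t 0 j); rewrite s0 expr0n addr0.
pose i0 := Ordinal (leq_trans (isT : (0 < 3)%N) N3).
pose i1 := Ordinal (leq_trans (isT : (1 < 3)%N) N3).
pose i2 := Ordinal (leq_trans (isT : (2 < 3)%N) N3).
have d01 := dif i0 i1 isT; have d02 := dif i0 i2 isT; have d12 := dif i1 i2 isT.
by case: (pm i0) (pm i1) (pm i2) => e0 [] e1 [] e2; move: d01 d02 d12;
  rewrite ?e0 ?e1 ?e2 ?eqxx.
Qed.

(** Minimise V over [symmetric_cube]. Suppose cos_sum = 0 at the minimiser. A large
    multiple of the Moebius field increases cos_sum and costs nothing to first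
    order, by [sin_force]. Added to the directions sin (2 theta) and
    - sin (2 theta), it makes them admissible, so the minimiser is stationary in
    these directions. Then [V_descent] lowers V along the Moebius field itself,
    which is admissible too: a contradiction. So cos_sum > 0, all symmetric
    directions are admissible, and the force vanishes since it is symmetric by
    [angle_force_reflect]. *)
Lemma symmetric_critical : (3 <= N)%N ->
  (exists2 t, symmetric_cube t & V_domain t) ->
  exists t, [/\ V_critical t, forall i, t 0 (s i) = c i - t 0 i,
     sin_sum t = 0 & 0 < cos_sum t].
Proof.
move=> N3 [t1 t1c t1d].
have ne : symmetric_cube !=set0 by exists t1.
have [|t] := compact_EVT_max ne symmetric_cube_compact (f := @weight R N).
  by apply: continuous_subspaceT; exact: weight_continuous.
rewrite inE => tsym tmax0.
have tmax u : symmetric_cube u -> weight u <= weight t by move=> h; apply: tmax0; rewrite inE.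
have td : V_domain t.
  by apply: weight_domain; apply: lt_le_trans (tmax _ t1c); exact: weight_gt0.
have [tc [ts zx]] := tsym.
have zy := sym_sin_sum ts.
have sc := sym_sin_cos ts.
have Vmin (v : 'rV[R]_N) : (forall i, v 0 (s i) = - v 0 i) ->
    (\forall z \near (0 : R)^'+, 0 <= cos_sum (z *: v + t)) ->
    \forall z \near (0 : R)^'+, V t <= V (z *: v + t).
  move=> vs vz; have h := symmetric_cube_line td tsym vs vz.
  have [e /= e0 he] := V_domain_line v td.
  have n : \forall z \near (0 : R)^'+, V_domain (z *: v + t) by exists e => //= z ze _; apply: he.
  near=> z; have zd : V_domain (z *: v + t) by near: z; exact: n.
  apply: le_weight => //; apply: tmax; near: z; exact: h.
have force_ge0 (v : 'rV[R]_N) : (forall i, v 0 (s i) = - v 0 i) ->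
    (\forall z \near (0 : R)^'+, 0 <= cos_sum (z *: v + t)) ->
    0 <= \sum_i v 0 i * angle_force t i.
  by move=> vs vz; apply: V_line_min => //; exact: Vmin.
have mob_s i : mobius_field t 0 (s i) = - mobius_field t 0 i.
  by rewrite !mxE; have [-> _] := sc i.
have Q := sum_sin_sqr_gt0 N3 td ts; set q := \sum_i _ in Q.
have {}zx : 0 < cos_sum t.
  rewrite lt_def zx andbT; apply/eqP => zx0.
  pose k := \sum_i sin (t 0 i) * (sin (t 0 i) * cos (t 0 i)).
  have mf : \sum_i sin (t 0 i) * angle_force t i = 0.
    by rewrite sin_force // zx0 zy !mul0r subrr.
  (* the sign sg covers a direction and its opposite; C is large enough for the Moebius part to dominate the change of cos_sum *)
  have half (sg : R) : 0 <= sg * \sum_i (sin (t 0 i) * cos (t 0 i)) * angle_force t i.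
    pose C := (`|sg * k| + 1) / q.
    pose v : 'rV[R]_N := \row_i (sg * (sin (t 0 i) * cos (t 0 i)) - C * sin (t 0 i)).
    have vE : \sum_i v 0 i * angle_force t i
        = sg * \sum_i (sin (t 0 i) * cos (t 0 i)) * angle_force t i.
      transitivity (sg * (\sum_i (sin (t 0 i) * cos (t 0 i)) * angle_force t i)
          - C * \sum_i sin (t 0 i) * angle_force t i); last by rewrite mf mulr0 subr0.
      rewrite !mulr_sumr -sumrB.
      by apply: eq_bigr => i _; rewrite mxE; ring.
    rewrite -vE; apply: force_ge0.
      by move=> i; rewrite !mxE; have [-> ->] := sc i; ring.
    have := @cos_sum_incr t v; rewrite zx0 lexx => /(_ isT) h.
    have vp : 0 < \sum_i - sin (t 0 i) * v 0 i.
      have -> : \sum_i - sin (t 0 i) * v 0 i = C * q - sg * k.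
        rewrite /q /k !mulr_sumr -sumrB; apply: eq_bigr => i _.
        by rewrite mxE; ring.
      rewrite /C divfK ?gt_eqF //; have := ler_norm (sg * k); lra.
    by apply: filterS (h vp) => z; exact: ltW.
  have s2 : \sum_i (sin (t 0 i) * cos (t 0 i)) * angle_force t i = 0.
    by have := half 1; have := half (-1); rewrite mulN1r mul1r; lra.
  have dec := V_descent N3 td zx0 zy s2.
  have inc : \forall z \near (0 : R)^'+, V t <= V (z *: mobius_field t + t).
    apply: Vmin => //; have := @cos_sum_incr t (mobius_field t); rewrite zx0 lexx => /(_ isT) h.
    have vp : 0 < \sum_i - sin (t 0 i) * mobius_field t 0 i.
      rewrite (_ : \sum_i _ = q) //; apply: eq_bigr => i _.
      by rewrite mxE mulrNN expr2.
    by apply: filterS (h vp) => z; exact: ltW.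
  have : \forall z \near (0 : R)^'+, False.
    near=> z; have h1 : V (z *: mobius_field t + t) < V t by near: z; exact: dec.
    have : V t <= V (z *: mobius_field t + t) by near: z; exact: inc.
    by rewrite leNgt h1.
  by move=> /filter_ex [].
exists t; split => //; apply/V_criticalE; split=> // i.
have pos_near (v : 'rV[R]_N) : \forall z \near (0 : R)^'+, 0 <= cos_sum (z *: v + t).
  have c0 : cos_sum (z *: v + t) @[z --> (0 : R)] --> cos_sum t.
    have cl : (fun z : R => z *: v + t) z @[z --> (0 : R)] --> 0 *: v + t.
      by apply: cvgD; [apply: cvgZr_tmp; exact: cvg_id|exact: cvg_cst].
    rewrite scale0r add0r in cl.
    exact: (cvg_comp _ _ cl (@cos_sum_continuous t)).
  have n : \forall z \near (0 : R), 0 < cos_sum (z *: v + t) by exact: (cvgr_gt _ c0).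
  by case: n => e /= e0 he; exists e => //= z ze _; apply/ltW; exact: he.
(* moves vortex i and its mirror image symmetrically *)
pose v : 'rV[R]_N := delta_mx 0 i - delta_mx 0 (s i).
have vE (j : 'I_N) : v 0 j = (j == i)%:R - (j == s i)%:R by rewrite !mxE !eqxx.
have vs j : v 0 (s j) = - v 0 j.
  by rewrite !vE (can_eq sK) (can2_eq sK sK) opprB.
have e : \sum_j v 0 j * angle_force t j = angle_force t i - angle_force t (s i).
  have ed (k : 'I_N) : \sum_j (j == k)%:R * angle_force t j = angle_force t k.
    rewrite (bigD1 k) //= eqxx mul1r big1 ?addr0 // => j jk.
    by rewrite (negPf jk) mul0r.
  by rewrite -(ed i) -(ed (s i)) -sumrB; apply: eq_bigr => j _; rewrite vE mulrBl.
have h1 := force_ge0 v vs (pos_near v).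
have vN j : (- v) 0 j = - v 0 j by rewrite [LHS]mxE.
have h2 : 0 <= \sum_j (- v) 0 j * angle_force t j.
  by apply: force_ge0 (pos_near _) => j; rewrite !vN vs.
have e2 : \sum_j (- v) 0 j * angle_force t j = - \sum_j v 0 j * angle_force t j.
  by rewrite -sumrN; apply: eq_bigr => j _; rewrite vN mulNr.
rewrite e2 in h2; have := angle_force_reflect i sK c1 ts; rewrite e in h1 h2.
lra.
Unshelve. all: by end_near. Qed.

End Symmetric.

Section ThreeCritical.
Variables (R : realType) (N : nat).
Hypothesis N3 : (3 <= N)%N.

Lemma cos_2pi : cos (2 * pi) = 1 :> R.
Proof. by rewrite mulr_natl cos2pi. Qed.

(** Pair i with N - 1 - i and take all shifts equal to 2 pi: a vortex which is its
    own mirror image has angle pi, never 0. The polygon turned by half a step is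
    in this class. *)
Lemma critical_without_axis : exists t : 'rV[R]_N,
  [/\ V_critical t, sin_sum t = 0, 0 < cos_sum t & forall i, cos (t 0 i) != 1].
Proof.
have N0 : (0 < N)%N by exact: leq_trans N3.
have N2 : (2 <= N)%N by exact: leq_trans N3.
have N0R : N%:R != 0 :> R by rewrite pnatr_eq0 -lt0n.
have NpR : 0 < N%:R :> R by rewrite ltr0n.
have c1 (j : 'I_N) : cos ((fun=> 2 * pi) j) = 1 :> R by exact: cos_2pi.
have p0 : 0 < pi :> R := pi_gt0 R.
have [|t [tc ts zy zx]] := symmetric_critical (@rev_ordK N) c1 N3.
  exists (ngon N (pi / N%:R)); last exact: ngon_domain.
  split; last split.
  - move=> i; rewrite !mxE -mulrDl divr_ge0 /=; last 2 first.
    + by rewrite addr_ge0 ?mulr_ge0 ?pi_ge0.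
    + exact: ltW.
    rewrite ler_pdivrMr //; have : (i%:R + 1 <= N%:R :> R) by rewrite natr1 ler_nat.
    by clear c1; nra.
  - move=> i; rewrite !mxE /= natrB; last exact: ltn_ord.
    by rewrite -natr1; field.
  - by have [-> _] := @ngon_sums R N (pi / N%:R) N2.
exists t; split => // i; apply/eqP => ci; clear c1.
have si : sin (t 0 i) = 0 by apply: cos1sin0; rewrite ci normr1.
have [ri|ri] := eqVneq (rev_ord i) i.
  have ti : t 0 i = pi by have := ts i; rewrite ri => ?; lra.
  by move: ci; rewrite ti cospi => ?; lra.
have [/V_domainP td _] := tc; have := td i (rev_ord i); rewrite eq_sym ri => /(_ isT).
by rewrite ts opprB addrA cosB cos_2pi cosD ci si !(mulr1, mulr0, mul0r, subr0) sinD si !(mul0r, mulr0, mul1r, addr0) eqxx.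
Qed.

(** Pair i with N - i modulo N and take the shift of the index 0 to be 0: this
    vortex is its own mirror image and is held at angle 0. *)
Lemma critical_with_axis : exists t : 'rV[R]_N,
  [/\ V_critical t, sin_sum t = 0, 0 < cos_sum t & exists i, cos (t 0 i) = 1].
Proof.
have N0 : (0 < N)%N by exact: leq_trans N3.
have N2 : (2 <= N)%N by exact: leq_trans N3.
have N0R : N%:R != 0 :> R by rewrite pnatr_eq0 -lt0n.
have NpR : 0 < N%:R :> R by rewrite ltr0n.
have p0 : 0 < pi :> R := pi_gt0 R.
pose s (i : 'I_N) : 'I_N := Ordinal (ltn_pmod (N - i) N0).
pose c (i : 'I_N) : R := if i == Ordinal N0 then 0 else 2 * pi.
have sE (i : 'I_N) : i != Ordinal N0 -> s i = (N - i)%N :> nat.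
  by move=> i0; rewrite /= modn_small //; move: i0; rewrite -val_eqE /=; lia.
have s0 : s (Ordinal N0) = Ordinal N0 by apply: val_inj; rewrite /= subn0 modnn.
have sK : involutive s.
  move=> i; have [->|i0] := eqVneq i (Ordinal N0); first by rewrite !s0.
  have iN := ltn_ord i.
  have siE : s i = (N - i)%N :> nat := sE i i0.
  have ip : (0 < i)%N by move: i0; rewrite -val_eqE /= lt0n.
  have si0 : s i != Ordinal N0.
    by apply/eqP => /(congr1 val); rewrite [LHS]siE /=; lia.
  by apply: val_inj; rewrite [LHS](sE _ si0) siE /=; lia.
have c1 j : cos (c j) = 1 by rewrite /c; case: ifP => _; rewrite ?cos0 ?cos_2pi.
have [|t [tc ts zy zx]] := symmetric_critical sK c1 N3.
  exists (ngon N 0); last exact: ngon_domain.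
  split; last split.
  - move=> i; rewrite !mxE addr0 divr_ge0 /=; last 2 first.
    + by rewrite !mulr_ge0 ?pi_ge0.
    + exact: ltW.
    rewrite ler_pdivrMr //; have : (i%:R <= N%:R :> R) by rewrite ler_nat ltnW.
    by nra.
  - move=> i; rewrite /c; have [->|i0] := eqVneq i (Ordinal N0).
      by rewrite s0 !mxE /= mulr0 mul0r; ring.
    rewrite !mxE (sE _ i0) natrB; last exact: ltnW.
    by field.
  - by have [-> _] := @ngon_sums R N 0 N2.
exists t; split => //; exists (Ordinal N0).
have := ts (Ordinal N0); rewrite s0 /c eqxx => e.
by rewrite (_ : t 0 _ = 0) ?cos0 //; lra.
Qed.

End ThreeCritical.

(** * The equilibrium equations in gradient form *)

Section Gradient.
Variables (R : realType) (N : nat).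
Implicit Types (e : R) (x y h l : 'I_N -> R).

(** The first coordinate of p / |p|^2 for p = (a, b). *)
Definition inversion (a b : R) : R := a / (a ^+ 2 + b ^+ 2).

(** A coordinate of q_k - q_0, when the center of vorticity is at the origin. *)
Definition rel_pos e x k : R := x k + e * \sum_i x i.

(** The derivative with respect to x_k of the amended potential

      Phi_e = (sum |q_k|^2 + e |sum q_k|^2) / 2
              - sum log |q_k - q_0| - e sum_(i < k) log |q_k - q_i|.

    The derivative with respect to y_k is [grad_x e y x k]. *)
Definition grad_x e x y k : R :=
  x k - inversion (rel_pos e x k) (rel_pos e y k)
  - e * (\sum_(i < N | i != k) inversion (x k - x i) (y k - y i)
         + \sum_j inversion (rel_pos e x j) (rel_pos e y j) - \sum_i x i).

(** The derivative of Phi_e with respect to the angle of q_k, divided by e. The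
    division is carried out in the formula: at e = 0 only the radii enter Phi_e,
    and the terms of order 0 cancel. *)
Definition grad_angle e x y k : R :=
  y k * ((\sum_i x i) / (rel_pos e x k ^+ 2 + rel_pos e y k ^+ 2)
         + \sum_(i < N | i != k) inversion (x k - x i) (y k - y i)
         + \sum_j inversion (rel_pos e x j) (rel_pos e y j) - \sum_i x i)
  - x k * ((\sum_i y i) / (rel_pos e y k ^+ 2 + rel_pos e x k ^+ 2)
         + \sum_(i < N | i != k) inversion (y k - y i) (x k - x i)
         + \sum_j inversion (rel_pos e y j) (rel_pos e x j) - \sum_i y i).

Lemma grad_angleE e x y k :
  - y k * grad_x e x y k + x k * grad_x e y x k = e * grad_angle e x y k.
Proof.
rewrite /grad_x /grad_angle /inversion [rel_pos e y k ^+ 2 + rel_pos e x k ^+ 2]addrC.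
set n := rel_pos e x k ^+ 2 + rel_pos e y k ^+ 2; rewrite [X in X / n]/rel_pos.
by rewrite [X in _ + _ * (_ - X / n - _)]/rel_pos; ring.
Qed.

Lemma sum_antisym0 (w : 'I_N -> 'I_N -> R) : (forall i j, w j i = - w i j) ->
  \sum_(i < N) \sum_(j < N | j != i) w i j = 0.
Proof.
move=> aw; have := sum_antisym (fun=> 1) aw.
under eq_bigr do rewrite mul1r.
move=> ->; rewrite big1 // => i _; rewrite big1 // => j _.
by rewrite subrr mulr0.
Qed.

(** Phi_e is invariant under rotations. *)
Lemma grad_rotation e x y :
  \sum_k (- y k * grad_x e x y k + x k * grad_x e y x k) = 0.
Proof.
pose w (k i : 'I_N) := y k * inversion (x k - x i) (y k - y i) - x k * inversion (y k - y i) (x k - x i).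
have aw k i : w i k = - w k i.
  rewrite /w /inversion -!(opprB (x k)) -!(opprB (y k)) !sqrrN.
  by rewrite [(y k - y i) ^+ 2 + _]addrC; ring.
have w0 := sum_antisym0 aw.
set SX := \sum_i x i; set SY := \sum_i y i.
set AX := \sum_j inversion (rel_pos e x j) (rel_pos e y j).
set AY := \sum_j inversion (rel_pos e y j) (rel_pos e x j).
transitivity (\sum_k (e * (\sum_(i < N | i != k) w k i)
   + e * (SX * inversion (rel_pos e y k) (rel_pos e x k) - SY * inversion (rel_pos e x k) (rel_pos e y k))
   + (e * (AX - SX) * y k - e * (AY - SY) * x k))).
  apply: eq_bigr => k _; rewrite /grad_x -/SX -/SY -/AX -/AY.
  have -> : \sum_(i < N | i != k) w k i
     = y k * (\sum_(i < N | i != k) inversion (x k - x i) (y k - y i))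
      - x k * (\sum_(i < N | i != k) inversion (y k - y i) (x k - x i)).
    by rewrite !mulr_sumr -sumrB.
  have key : y k * inversion (rel_pos e x k) (rel_pos e y k) - x k * inversion (rel_pos e y k) (rel_pos e x k)
     = e * (SX * inversion (rel_pos e y k) (rel_pos e x k) - SY * inversion (rel_pos e x k) (rel_pos e y k)).
    rewrite /inversion [rel_pos e y k ^+ 2 + rel_pos e x k ^+ 2]addrC.
    set n := rel_pos e x k ^+ 2 + rel_pos e y k ^+ 2.
    by rewrite /rel_pos -/SX -/SY; ring.
  by rewrite -key; ring.
rewrite !big_split /= -!mulr_sumr !big_split /= !sumrN -!mulr_sumr w0.
by rewrite -/AX -/AY -/SX -/SY; ring.
Qed.

(** The derivative of [inversion] in the direction (h, l); in physical terms a
    component of the tidal tensor. *)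
Definition dinversion (a b h l : R) : R :=
  h / (a ^+ 2 + b ^+ 2) - 2 * a * (a * h + b * l) / (a ^+ 2 + b ^+ 2) ^+ 2.

Definition dgrad_x e x y h l k : R :=
  h k - dinversion (rel_pos e x k) (rel_pos e y k) (rel_pos e h k) (rel_pos e l k)
  - e * (\sum_(i < N | i != k) dinversion (x k - x i) (y k - y i) (h k - h i) (l k - l i)
         + \sum_j dinversion (rel_pos e x j) (rel_pos e y j) (rel_pos e h j) (rel_pos e l j) - \sum_i h i).

Section Smooth.
Variables (E : normedModType R).
Implicit Types (z v : E).

Lemma C1_inv (f : E -> R) z : C1 f z -> f z != 0 -> C1 (fun z => (f z)^-1) z.
Proof.
move=> f1 n0.
have d (t : R) : t != 0 -> is_derive t (1 : R) (fun t : R => t^-1) (- 1 / t ^+ 2).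
  by move=> t0; exact: (@derV R R id t 1 1 t0 (is_derive_id t 1)).
have nz : \forall t \near f z, t != 0.
  by apply: open_nbhs_nbhs; split => //.
apply: (@C1_comp R E (fun t => t^-1) (fun t => - 1 / t ^+ 2)) f1.
  by near=> t; apply: d; near: t; exact: nz.
apply: cvgM; first exact: cvg_cst.
apply: cvgV; first by rewrite expf_neq0.
exact: (cvgM cvg_id cvg_id).
Unshelve. all: by end_near. Qed.

Lemma C1_inversion (f g : E -> R) z : C1 f z -> C1 g z -> f z ^+ 2 + g z ^+ 2 != 0 ->
  C1 (fun z => inversion (f z) (g z)) z.
Proof.
move=> f1 g1 n0; apply: C1M; first exact: f1.
have ns : C1 (fun z => f z ^+ 2 + g z ^+ 2) z.
  by apply: C1D; [exact: (C1M f1 f1)|exact: (C1M g1 g1)].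
exact: C1_inv ns n0.
Qed.

Lemma der_inversion (f g : E -> R) z v (h l : R) : f z ^+ 2 + g z ^+ 2 != 0 ->
  is_derive z v f h -> is_derive z v g l ->
  is_derive z v (fun z => inversion (f z) (g z)) (dinversion (f z) (g z) h l).
Proof.
move=> n0 hf hg.
have hn := derD (derM hf hf) (derM hg hg).
have hi := @derV R E (fun z => f z * f z + g z * g z) z v _ n0 hn.
apply: (is_derive_eq (derM hf hi)); rewrite /dinversion -!expr2; field.
by [].
Qed.

Variables (e : E -> R) (x y : 'I_N -> E -> R).

Definition regular z := (forall k, rel_pos (e z) (x^~ z) k ^+ 2 + rel_pos (e z) (y^~ z) k ^+ 2 != 0) /\
  (forall k i, i != k -> (x k z - x i z) ^+ 2 + (y k z - y i z) ^+ 2 != 0).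

Lemma C1_rel (a : 'I_N -> E -> R) z k : C1 e z -> (forall i, C1 (a i) z) ->
  C1 (fun z => rel_pos (e z) (a^~ z) k) z.
Proof. by move=> e1 a1; apply: C1D; [exact: a1|apply: C1M; [exact: e1|apply: C1_sum => i _; exact: a1]]. Qed.

Lemma C1_grad_x z k : C1 e z -> (forall i, C1 (x i) z) -> (forall i, C1 (y i) z) ->
  regular z -> C1 (fun z => grad_x (e z) (x^~ z) (y^~ z) k) z.
Proof.
move=> e1 x1 y1 [n0 d0]; apply: C1B.
  apply: C1B; first exact: x1.
  by apply: C1_inversion; [exact: C1_rel|exact: C1_rel|exact: n0].
apply: C1M; first exact: e1.
apply: C1B; last by apply: C1_sum => i _; exact: x1.
apply: C1D.
  apply: C1_sum => i ik; apply: C1_inversion; [exact: (C1B (x1 k) (x1 i))|exact: (C1B (y1 k) (y1 i))|exact: d0].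
by apply: C1_sum => j _; apply: C1_inversion; [exact: C1_rel|exact: C1_rel|exact: n0].
Qed.

Lemma der_rel (a : 'I_N -> E -> R) z v (h : 'I_N -> R) k :
  is_derive z v e 0 -> (forall i, is_derive z v (a i) (h i)) ->
  is_derive z v (fun z => rel_pos (e z) (a^~ z) k) (rel_pos (e z) h k).
Proof.
move=> he ha.
have hs := @der_sum R E _ (index_enum _) predT a h z v (fun i _ => ha i).
have hh := derD (ha k) (derM he hs).
by apply: (is_derive_eq hh); rewrite mul0r add0r.
Qed.

Lemma der_grad_x z v (h l : 'I_N -> R) k : regular z ->
  is_derive z v e 0 -> (forall i, is_derive z v (x i) (h i)) ->
  (forall i, is_derive z v (y i) (l i)) ->
  is_derive z v (fun z => grad_x (e z) (x^~ z) (y^~ z) k)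
    (dgrad_x (e z) (x^~ z) (y^~ z) h l k).
Proof.
move=> [n0 d0] he hx hy.
have hr j := der_inversion (n0 j) (der_rel j he hx) (der_rel j he hy).
have hb : is_derive z v (fun z => \sum_(i < N | i != k) inversion (x k z - x i z) (y k z - y i z))
    (\sum_(i < N | i != k) dinversion (x k z - x i z) (y k z - y i z) (h k - h i) (l k - l i)).
  apply: der_sum => i ik.
  exact: (der_inversion (d0 k i ik) (derB (hx k) (hx i)) (derB (hy k) (hy i))).
have hs := @der_sum R E _ (index_enum _) predT x h z v (fun i _ => hx i).
have ha := @der_sum R E _ (index_enum _) predT
  (fun j z => inversion (rel_pos (e z) (x^~ z) j) (rel_pos (e z) (y^~ z) j)) _ z v (fun j _ => hr j).
have hh := derB (derB (hx k) (hr k)) (derM he (derB (derD hb ha) hs)).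
by apply: (is_derive_eq hh); rewrite /dgrad_x mul0r add0r.
Qed.

Lemma C1_grad_angle z k : C1 e z -> (forall i, C1 (x i) z) -> (forall i, C1 (y i) z) ->
  regular z -> C1 (fun z => grad_angle (e z) (x^~ z) (y^~ z) k) z.
Proof.
move=> e1 x1 y1 [n0 d0].
have half (a b : 'I_N -> E -> R) : (forall i, C1 (a i) z) -> (forall i, C1 (b i) z) ->
   (forall k, rel_pos (e z) (a^~ z) k ^+ 2 + rel_pos (e z) (b^~ z) k ^+ 2 != 0) ->
   (forall k i, i != k -> (a k z - a i z) ^+ 2 + (b k z - b i z) ^+ 2 != 0) ->
   C1 (fun z => b k z * ((\sum_i a i z) / (rel_pos (e z) (a^~ z) k ^+ 2 + rel_pos (e z) (b^~ z) k ^+ 2)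
         + \sum_(i < N | i != k) inversion (a k z - a i z) (b k z - b i z)
         + \sum_j inversion (rel_pos (e z) (a^~ z) j) (rel_pos (e z) (b^~ z) j) - \sum_i a i z)) z.
  move=> a1 b1 na da.
  have s1 : C1 (fun z => \sum_i a i z) z by apply: C1_sum => i _; exact: a1.
  apply: C1M; first exact: b1.
  apply: C1B; last exact: s1.
  apply: C1D; first apply: C1D.
  - apply: C1M; first exact: s1.
    apply: C1_inv (na k).
    by apply: C1D; [exact: (C1M (C1_rel k e1 a1) (C1_rel k e1 a1))|exact: (C1M (C1_rel k e1 b1) (C1_rel k e1 b1))].
  - apply: C1_sum => i ik.
    by apply: C1_inversion; [exact: (C1B (a1 k) (a1 i))|exact: (C1B (b1 k) (b1 i))|exact: da].
  - by apply: C1_sum => j _; apply: C1_inversion; [exact: C1_rel|exact: C1_rel|exact: na].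
apply: C1B; first exact: half.
apply: half => // [i|i j ij]; rewrite addrC; [exact: n0|exact: d0].
Qed.

End Smooth.
End Gradient.

(** * Radial and angular equations *)

Section CosSin.
Variables (R : realType) (V : normedModType R).

Lemma C1_cos (f : V -> R) z : C1 f z -> C1 (fun z => cos (f z)) z.
Proof.
move=> f1; apply: (@C1_comp R V cos (fun t => - sin t) f z _ _ f1).
  by near=> s; exact: is_derive_cos.
by apply: cvgN; exact: continuous_sin.
Unshelve. all: by end_near. Qed.

Lemma C1_sin (f : V -> R) z : C1 f z -> C1 (fun z => sin (f z)) z.
Proof.
move=> f1; apply: (@C1_comp R V sin cos f z _ _ f1).
  by near=> s; exact: is_derive_sin.
exact: continuous_cos.
Unshelve. all: by end_near. Qed.
End CosSin.

Section Polar.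
Variables (R : realType) (N : nat).
Notation PS := 'rV[R]_(N + N).
Notation E := (R * PS)%type.
Implicit Types (x : PS) (t : 'rV[R]_N) (k i : 'I_N).

Definition pos_x x i : R := lsubmx x ord0 i * cos (rsubmx x ord0 i).
Definition pos_y x i : R := lsubmx x ord0 i * sin (rsubmx x ord0 i).

(** Here and in [grad_t] the gradient of Phi_e is taken in polar coordinates: the
    derivative in the radius, and 1 / e times the derivative in the angle. *)
Definition grad_r (e : R) x k : R :=
  cos (rsubmx x ord0 k) * grad_x e (pos_x x) (pos_y x) k
  + sin (rsubmx x ord0 k) * grad_x e (pos_y x) (pos_x x) k.

Definition grad_t (e : R) x k : R := grad_angle e (pos_x x) (pos_y x) k.

Definition regular_at (e : R) x : Prop :=
  (forall k, rel_pos e (pos_x x) k ^+ 2 + rel_pos e (pos_y x) k ^+ 2 != 0) /\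
  (forall k i, i != k -> (pos_x x k - pos_x x i) ^+ 2 + (pos_y x k - pos_y x i) ^+ 2 != 0).

Definition circle_state t : PS := row_mx (const_mx 1) t.

Section Functions.
Variables (V : normedModType R) (e : V -> R) (x : V -> PS).

Lemma C1_pos_x z i : (forall j, C1 (fun z => x z 0 j) z) -> C1 (fun z => pos_x (x z) i) z.
Proof.
move=> x1; have -> : (fun z => pos_x (x z) i)
    = (fun z => x z 0 (lshift N i) * cos (x z 0 (rshift N i))).
  by apply/funext => u; rewrite /pos_x !mxE.
apply: C1M; first exact: x1.
by apply: C1_cos; exact: x1.
Qed.

Lemma C1_pos_y z i : (forall j, C1 (fun z => x z 0 j) z) -> C1 (fun z => pos_y (x z) i) z.
Proof.
move=> x1; have -> : (fun z => pos_y (x z) i)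
    = (fun z => x z 0 (lshift N i) * sin (x z 0 (rshift N i))).
  by apply/funext => u; rewrite /pos_y !mxE.
apply: C1M; first exact: x1.
by apply: C1_sin; exact: x1.
Qed.

Lemma C1_grad_r z k : C1 e z -> (forall j, C1 (fun z => x z 0 j) z) ->
  regular_at (e z) (x z) -> C1 (fun z => grad_r (e z) (x z) k) z.
Proof.
move=> e1 x1 [n0 d0].
have px i := C1_pos_x i x1; have py i := C1_pos_y i x1.
have c1 : C1 (fun z => cos (rsubmx (x z) ord0 k)) z.
  have -> : (fun z => cos (rsubmx (x z) ord0 k)) = (fun z => cos (x z 0 (rshift N k))).
    by apply/funext => u; rewrite mxE.
  by apply: C1_cos; exact: x1.
have s1 : C1 (fun z => sin (rsubmx (x z) ord0 k)) z.
  have -> : (fun z => sin (rsubmx (x z) ord0 k)) = (fun z => sin (x z 0 (rshift N k))).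
    by apply/funext => u; rewrite mxE.
  by apply: C1_sin; exact: x1.
apply: C1D; apply: C1M.
- exact: c1.
- exact: (@C1_grad_x R N V e (fun i z => pos_x (x z) i) (fun i z => pos_y (x z) i) z k).
- exact: s1.
- apply: (@C1_grad_x R N V e (fun i z => pos_y (x z) i) (fun i z => pos_x (x z) i) z k) => //.
  by split => [i|i j ij]; rewrite addrC; [exact: n0|exact: d0].
Qed.

Lemma C1_grad_t z k : C1 e z -> (forall j, C1 (fun z => x z 0 j) z) ->
  regular_at (e z) (x z) -> C1 (fun z => grad_t (e z) (x z) k) z.
Proof.
move=> e1 x1 reg.
have px i := C1_pos_x i x1; have py i := C1_pos_y i x1.
exact: (@C1_grad_angle R N V e (fun i z => pos_x (x z) i) (fun i z => pos_y (x z) i) z k).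
Qed.

Lemma regular_near z : C1 e z -> (forall j, C1 (fun z => x z 0 j) z) ->
  regular_at (e z) (x z) -> \forall w \near z, regular_at (e w) (x w).
Proof.
move=> e1 x1 [n0 d0].
have px i := C1_pos_x i x1; have py i := C1_pos_y i x1.
have nz (f : V -> R) : C1 f z -> f z != 0 -> \forall w \near z, f w != 0.
  move=> /C1_continuous f1 f0.
  have o : \forall s \near f z, s != 0 by apply: open_nbhs_nbhs; split => //.
  exact: f1 o.
have rx i := @C1_rel R N V e (fun i z => pos_x (x z) i) z i e1 px.
have ry i := @C1_rel R N V e (fun i z => pos_y (x z) i) z i e1 py.
have h1 : \forall w \near z, forall k,
    rel_pos (e w) (pos_x (x w)) k ^+ 2 + rel_pos (e w) (pos_y (x w)) k ^+ 2 != 0.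
  apply: near_forall => k; apply: (nz (fun w => rel_pos (e w) (pos_x (x w)) k ^+ 2 + rel_pos (e w) (pos_y (x w)) k ^+ 2)); last exact: n0.
  by apply: C1D; [exact: (C1M (rx k) (rx k))|exact: (C1M (ry k) (ry k))].
have h2 : \forall w \near z, forall ki : 'I_N * 'I_N, ki.2 != ki.1 ->
    (pos_x (x w) ki.1 - pos_x (x w) ki.2) ^+ 2 + (pos_y (x w) ki.1 - pos_y (x w) ki.2) ^+ 2 != 0.
  apply: near_forall => -[k i] /=.
  have [_|ik] := eqVneq i k; first by near=> w.
  have dx := C1B (px k) (px i); have dy := C1B (py k) (py i).
  have c : C1 (fun w => (pos_x (x w) k - pos_x (x w) i) ^+ 2 + (pos_y (x w) k - pos_y (x w) i) ^+ 2) z.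
    by apply: C1D; [exact: (C1M dx dx)|exact: (C1M dy dy)].
  by apply: filterS (nz _ c (d0 k i ik)) => w hw _.
near=> w; split; first by near: w; exact: h1.
move=> k i; have hw : forall ki : 'I_N * 'I_N, ki.2 != ki.1 ->
    (pos_x (x w) ki.1 - pos_x (x w) ki.2) ^+ 2 + (pos_y (x w) ki.1 - pos_y (x w) ki.2) ^+ 2 != 0.
  by near: w; exact: h2.
exact: (hw (k, i)).
Unshelve. all: by end_near. Qed.

End Functions.

Lemma C1_of_der (V : normedModType R) (f : V -> R) (L : V -> R) z :
  (forall w, differentiable f w) -> (forall w v, is_derive w v f (L v)) -> C1 f z.
Proof.
move=> df dL; split; first by near=> w; exact: df.
move=> v; have -> : (fun y => 'D_v f y) = fun _ => L v.
  by apply/funext => w; have [_ ->] := dL w v.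
exact: cst_continuous.
Unshelve. all: by end_near. Qed.

Lemma C1_row_coord (n : nat) (u : 'rV[R]_n) j : C1 (fun u : 'rV[R]_n => u 0 j) u.
Proof.
apply: (@C1_of_der _ _ (fun v : 'rV[R]_n => v 0 j)) => w; first exact: differentiable_coord.
by move=> v; exact: der_coord.
Qed.

Lemma differentiable_fst (w : E) : differentiable (fst : E -> R) w.
Proof.
apply: linear_differentiable => z.
by have h := @cvg_fst _ _ (nbhs z.1) (nbhs z.2) _; exact: h.
Qed.

Lemma differentiable_snd (w : E) : differentiable (snd : E -> PS) w.
Proof.
apply: linear_differentiable => z.
by have h := @cvg_snd _ _ (nbhs z.1) (nbhs z.2) _; exact: h.
Qed.

Lemma C1_eps (z : E) : C1 (fun z : E => z.1) z.
Proof.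
apply: (@C1_of_der _ _ (fun v : E => v.1)) => [w|w v].
  exact: differentiable_fst.
apply: is_derive_from_line.
have -> : (fun s : R => (s *: v + w).1) = (fun s : R => v.1 * s + w.1).
  by apply/funext => s; rewrite mulrC.
have h := derD (derZ v.1 (is_derive_id (0 : R) (1 : R))) (der_cst w.1 (0 : R) (1 : R)).
by apply: (is_derive_eq h); rewrite addr0 mulr1.
Qed.

Lemma der_eps (z : E) u : is_derive z ((0, u) : E) (fun z : E => z.1) 0.
Proof.
apply: is_derive_from_line.
have -> : (fun s : R => (s *: ((0, u) : E) + z).1) = (fun s : R => z.1).
  by apply/funext => s /=; rewrite scaler0 add0r.
exact: der_cst.
Qed.

Lemma C1_state (z : E) j : C1 (fun z : E => z.2 0 j) z.
Proof.
apply: (@C1_of_der _ _ (fun v : E => v.2 0 j)) => [w|w v].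
  apply: (@differentiable_comp _ _ _ _ (snd : E -> PS) (fun u : PS => u 0 j)).
    exact: differentiable_snd.
  exact: differentiable_coord.
apply: is_derive_from_line.
have -> : (fun s : R => (s *: v + w).2 0 j) = (fun s : R => v.2 0 j * s + w.2 0 j).
  by apply/funext => s; rewrite !mxE mulrC.
have h := derD (derZ (v.2 0 j) (is_derive_id (0 : R) (1 : R))) (der_cst (w.2 0 j) (0 : R) (1 : R)).
by apply: (is_derive_eq h); rewrite addr0 mulr1.
Qed.

End Polar.

(** * Continuation of nondegenerate critical points *)

Section Continuation.
Variables (R : realType) (N : nat).
Notation PS := 'rV[R]_(N + N).
Notation E := (R * PS)%type.
Implicit Types (x u : PS) (t : 'rV[R]_N) (k i : 'I_N).

Lemma line_slice (s e : R) (u x : PS) : s *: ((0, u) : E) + ((e, x) : E) = (e, s *: u + x).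
Proof. by rewrite [LHS]surjective_pairing /= scaler0 add0r. Qed.

Lemma circle_rad t i : lsubmx (circle_state t) ord0 i = 1.
Proof. by rewrite row_mxKl mxE. Qed.

Lemma circle_ang t : rsubmx (circle_state t) = t.
Proof. by rewrite row_mxKr. Qed.

Lemma rel_pos0 (a : 'I_N -> R) k : rel_pos 0 a k = a k.
Proof. by rewrite /rel_pos mul0r addr0. Qed.

Lemma pos_sqr x k : pos_x x k ^+ 2 + pos_y x k ^+ 2 = lsubmx x ord0 k ^+ 2.
Proof. by rewrite /pos_x /pos_y !exprMn -mulrDr cos2Dsin2 mulr1. Qed.

Lemma circle_dist t k i : (pos_x (circle_state t) k - pos_x (circle_state t) i) ^+ 2
  + (pos_y (circle_state t) k - pos_y (circle_state t) i) ^+ 2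
  = 2 - 2 * cos (t 0 k - t 0 i).
Proof.
rewrite /pos_x /pos_y !circle_rad !circle_ang !mul1r cosB.
have ek := cos2Dsin2 (t 0 k); have ei := cos2Dsin2 (t 0 i).
transitivity ((cos (t 0 k) ^+ 2 + sin (t 0 k) ^+ 2) + (cos (t 0 i) ^+ 2 + sin (t 0 i) ^+ 2)
  - 2 * (cos (t 0 k) * cos (t 0 i) + sin (t 0 k) * sin (t 0 i))); first by ring.
by rewrite ek ei.
Qed.

Lemma regular_circle t : V_domain t -> regular_at 0 (circle_state t).
Proof.
move=> /V_domainP td; split.
  by move=> k; rewrite !rel_pos0 pos_sqr circle_rad expr1n oner_eq0.
by move=> k i ik; rewrite circle_dist chord_neq0 // td // eq_sym.
Qed.

Lemma grad_x0 (a b : 'I_N -> R) k : grad_x 0 a b k = a k - inversion (a k) (b k).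
Proof. by rewrite /grad_x !rel_pos0 mul0r subr0. Qed.

Lemma grad_r0 x k : lsubmx x ord0 k != 0 ->
  grad_r 0 x k = lsubmx x ord0 k - (lsubmx x ord0 k)^-1.
Proof.
move=> r0; rewrite /grad_r !grad_x0 /inversion [pos_y x k ^+ 2 + _]addrC pos_sqr /pos_x /pos_y.
set r := lsubmx x ord0 k in r0 *; set th := rsubmx x ord0 k.
transitivity ((cos th ^+ 2 + sin th ^+ 2) * (r - r / r ^+ 2)); first by ring.
by rewrite cos2Dsin2; field.
Qed.

(** The first order term of Phi_e at the unit circle is V. *)
Lemma grad_t_circle t k : grad_t 0 (circle_state t) k = angle_force t k.
Proof.
rewrite /grad_t /grad_angle !rel_pos0 [pos_y _ k ^+ 2 + _]addrC pos_sqr circle_rad expr1n !divr1.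
set x := circle_state t.
have ex i : pos_x x i = cos (t 0 i) by rewrite /pos_x circle_rad circle_ang mul1r.
have ey i : pos_y x i = sin (t 0 i) by rewrite /pos_y circle_rad circle_ang mul1r.
have kk (a b : 'I_N -> R) : (forall j, a j ^+ 2 + b j ^+ 2 = 1) ->
    \sum_j inversion (rel_pos 0 a j) (rel_pos 0 b j) = \sum_j a j.
  by move=> h; apply: eq_bigr => j _; rewrite !rel_pos0 /inversion h divr1.
rewrite !kk; last 2 first.
- by move=> j; rewrite addrC pos_sqr circle_rad expr1n.
- by move=> j; rewrite pos_sqr circle_rad expr1n.
rewrite !addrK !mulrDr opprD addrACA [angle_force t k]/angle_force.
have -> : pos_y x k * (\sum_i pos_x x i) - pos_x x k * (\sum_i pos_y x i)
    = \sum_(j < N | j != k) sin (t 0 k - t 0 j).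
  rewrite !mulr_sumr -sumrB (bigD1 k) //= mulrC subrr add0r; apply: eq_bigr => j _.
  by rewrite !ex !ey sinB.
rewrite !mulr_sumr -!sumrB -big_split; apply: eq_bigr => j _ /=.
rewrite /inversion [(pos_y x k - _) ^+ 2 + _]addrC circle_dist /pair_force !ex !ey sinB.
by set D := 2 - _; ring.
Qed.

(** At e = 0 the radial equation of each vortex reads r - 1 / r = 0. *)
Lemma der_grad_r_circle t u k :
  is_derive ((0, circle_state t) : E) ((0, u) : E) (fun z : E => grad_r z.1 z.2 k)
    (2 * u 0 (lshift N k)).
Proof.
apply: is_derive_from_line.
have -> : (fun s : R => grad_r (s *: ((0, u) : E) + ((0, circle_state t) : E)).1
    (s *: ((0, u) : E) + ((0, circle_state t) : E)).2 k)
    = (fun s : R => grad_r 0 (s *: u + circle_state t) k).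
  by apply/funext => s; rewrite line_slice.
pose r (s : R) := u 0 (lshift N k) * s + 1.
have rE (s : R) : lsubmx (s *: u + circle_state t) ord0 k = r s.
  have h := circle_rad t k; rewrite mxE in h.
  by rewrite [LHS]mxE [LHS]mxE [X in X + _]mxE h /r mulrC.
have dr : is_derive (0 : R) (1 : R) r (u 0 (lshift N k)).
  have h := derD (derZ (u 0 (lshift N k)) (is_derive_id (0 : R) (1 : R))) (der_cst 1 (0 : R) (1 : R)).
  by apply: (is_derive_eq h); rewrite addr0 mulr1.
have r0 : r 0 = 1 by rewrite /r mulr0 add0r.
apply: (@der_near _ _ (fun s => r s - (r s)^-1)).
  have c : {for 0, continuous r}.
    by apply: differentiable_continuous; apply/derivable1_diffP; exact: ex_derive.
  have n : \forall s \near (0 : R), r s > 0 by apply: (cvgr_gt _ c); rewrite r0.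
  by apply: filterS n => s rs; rewrite grad_r0 rE // gt_eqF.
have rn : r 0 != 0 by rewrite r0 oner_eq0.
have h := derB dr (derV rn dr); apply: (is_derive_eq h).
by rewrite r0 expr1n divr1; ring.
Qed.

Lemma der_grad_t_circle t (v : 'rV[R]_N) k : V_domain t ->
  is_derive ((0, circle_state t) : E) ((0, row_mx 0 v) : E) (fun z : E => grad_t z.1 z.2 k)
    (\sum_j hessian (@V R N) t k j * v 0 j).
Proof.
move=> td; rewrite hessian_mul //; apply: is_derive_from_line.
have -> : (fun s : R => grad_t (s *: ((0, row_mx 0 v) : E) + ((0, circle_state t) : E)).1
    (s *: ((0, row_mx 0 v) : E) + ((0, circle_state t) : E)).2 k)
    = (fun s : R => angle_force (s *: v + t) k).
  apply/funext => s; rewrite line_slice /= -grad_t_circle; congr grad_t.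
  by rewrite /circle_state scale_row_mx add_row_mx scaler0 add0r.
have t0 : 0 *: v + t = t by rewrite scale0r add0r.
apply: (@is_derive_line _ _ (fun u : 'rV[R]_N => angle_force u k)).
by rewrite t0; exact: der_angle_force.
Qed.

(** By rotation invariance the angular equations have a degenerate derivative. The
    sum of the angular displacements is added to each of them, which fixes the
    mean angle and makes the derivative invertible. *)
Definition ift_component t (j : 'I_(N + N)) (z : E) : R :=
  match fintype.split j with
  | inl k => grad_r z.1 z.2 k
  | inr k => grad_t z.1 z.2 k + (\sum_i (rsubmx z.2 ord0 i - t 0 i))
  end.

Lemma C1_sum_angles t z : C1 (fun z : E => \sum_i (rsubmx z.2 ord0 i - t 0 i)) z.
Proof.
apply: C1_sum => i _; apply: C1B; last exact: C1_cst.
have -> : (fun z : E => rsubmx z.2 ord0 i) = (fun z : E => z.2 0 (rshift N i)).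
  by apply/funext => w; rewrite mxE.
exact: C1_state.
Qed.

Lemma der_sum_angles t (z : E) u : is_derive z ((0, u) : E)
  (fun z : E => \sum_i (rsubmx z.2 ord0 i - t 0 i)) (\sum_i u 0 (rshift N i)).
Proof.
apply: der_sum => i _; apply: is_derive_from_line.
have -> : (fun s : R => rsubmx (s *: ((0, u) : E) + z).2 ord0 i - t 0 i)
    = (fun s : R => u 0 (rshift N i) * s + (rsubmx z.2 ord0 i - t 0 i)).
  by apply/funext => s /=; rewrite !mxE mulrC addrA.
have h := derD (derZ (u 0 (rshift N i)) (is_derive_id (0 : R) (1 : R)))
  (der_cst (rsubmx z.2 ord0 i - t 0 i) (0 : R) (1 : R)).
by apply: (is_derive_eq h); rewrite addr0 mulr1.
Qed.

(** The derivative of the system at e = 0 is block triangular. The radial block is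
    2 I. The angular block is the Hessian of V plus the matrix with all entries 1;
    pairing its null vectors with (1, ..., 1) shows that their entries add up to
    0, so they lie in the kernel of the Hessian, which contains nothing else than
    constants. *)
Lemma continuation t : (0 < N)%N -> V_critical t -> V_nondegenerate t ->
  exists X : R -> PS, X e @[e --> (0 : R)] --> circle_state t /\
    \forall e \near (0 : R), forall k, grad_r e (X e) k = 0 /\
      grad_t e (X e) k + \sum_i (rsubmx (X e) ord0 i - t 0 i) = 0.
Proof.
move=> N0 tc nd; have [td p0] := (V_criticalE t).1 tc.
have reg := regular_circle td.
pose z0 : E := (0, circle_state t).
have Cr k : C1 (fun z : E => grad_r z.1 z.2 k) z0.
  apply: (@C1_grad_r R N E fst snd) => //; first exact: C1_eps.
  by move=> j; exact: C1_state.
have Ct k : C1 (fun z : E => grad_t z.1 z.2 k) z0.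
  apply: (@C1_grad_t R N E fst snd) => //; first exact: C1_eps.
  by move=> j; exact: C1_state.
have F1 j : C1 (ift_component t j) (0, circle_state t).
  rewrite /ift_component; case: (fintype.split j) => k; first exact: Cr.
  by apply: C1D; [exact: Ct|exact: C1_sum_angles].
have sum0 : \sum_i (rsubmx (circle_state t) ord0 i - t 0 i) = 0.
  by rewrite big1 // => i _; rewrite circle_ang subrr.
have F0 j : ift_component t j (0, circle_state t) = 0.
  rewrite /ift_component; case: (fintype.split j) => k /=.
    by rewrite grad_r0 circle_rad ?oner_eq0 // invr1 subrr.
  by rewrite grad_t_circle p0 sum0 addr0.
have uM : \matrix_(j, i) 'D_((0, delta_mx 0 j) : E) (ift_component t i) (0, circle_state t) \in unitmx.
  set M := \matrix_(_, _) _.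
  have inj (u : PS) : u *m M = 0 -> u = 0.
    move=> uM0.
    have D0 (i : 'I_(N + N)) : 'D_((0, u) : E) (ift_component t i) (0, circle_state t) = 0.
      rewrite derive_row; last exact: C1_differentiable.
      have := congr1 (fun A : 'rV[R]_(N + N) => A 0 i) uM0; rewrite mxE [RHS]mxE => h; rewrite -[RHS]h.
      by apply: eq_bigr => j _; rewrite mxE.
    have rho0 k : u 0 (lshift N k) = 0.
      have := D0 (lshift N k).
      have -> : ift_component t (lshift N k) = (fun z : E => grad_r z.1 z.2 k).
        by rewrite /ift_component (unsplitK (inl k)).
      have [_ ->] := der_grad_r_circle t u k.
      by move/eqP; rewrite mulf_eq0 pnatr_eq0 /= => /eqP.
    pose v := rsubmx u.
    have uE : u = row_mx 0 v.
      rewrite -[LHS]hsubmxK; congr row_mx; apply/rowP => k.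
      by rewrite [LHS]mxE rho0 mxE.
    have tau0 k : \sum_j hessian (@V R N) t k j * v 0 j + \sum_i v 0 i = 0.
      have := D0 (rshift N k).
      have -> : ift_component t (rshift N k) = (fun z : E => grad_t z.1 z.2 k + \sum_i (rsubmx z.2 ord0 i - t 0 i)).
        by rewrite /ift_component (unsplitK (inr k)).
      rewrite {1}uE; have h := derD (der_grad_t_circle v k td) (der_sum_angles t z0 (row_mx 0 v)).
      have [_ ->] := h; move=> h0; rewrite -[RHS]h0; congr (_ + _).
      by apply: eq_bigr => i _; rewrite row_mxEr.
    (* sum the angular equations: the Hessian part cancels and N times the sum of the angles remains *)
    have sv : \sum_i v 0 i = 0.
      have : \sum_k (\sum_j hessian (@V R N) t k j * v 0 j + \sum_i v 0 i) = 0.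
        by rewrite big1 // => k _; exact: tau0.
      rewrite big_split /= exchange_big /= [X in X + _]big1; last first.
        move=> j _; rewrite -mulr_suml.
        have := congr1 (fun A : 'rV[R]_N => A 0 j) (const_hessian td).
        rewrite mxE [RHS]mxE => h.
        have -> : \sum_i hessian (@V R N) t i j = 0.
          by rewrite -[RHS]h; apply: eq_bigr => i _; rewrite [X in X * _]mxE mul1r.
        by rewrite mul0r.
      rewrite add0r sum_ord_cst => /eqP; rewrite mulf_eq0 pnatr_eq0.
      by rewrite -[N == 0%N]negbK -lt0n N0 /= => /eqP.
    have vH : v *m hessian (@V R N) t = 0.
      rewrite -(hessian_sym td); apply/rowP => k; rewrite mxE [RHS]mxE.
      rewrite -[RHS](tau0 k) sv addr0; apply: eq_bigr => j _.
      by rewrite [X in _ * X]mxE mulrC.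
    have c10 : const_mx 1 != 0 :> 'rV[R]_N.
      apply/eqP => /rowP /(_ (Ordinal N0)) /eqP.
      by rewrite !mxE oner_eq0.
    have [c vc] := mup1_kernel nd c10 (const_hessian td) vH.
    have : c = 0.
      move/eqP: sv; rewrite vc; under eq_bigr do rewrite !mxE mulr1.
      by rewrite sum_ord_cst mulf_eq0 pnatr_eq0 -[N == 0%N]negbK -lt0n N0 /= => /eqP.
    by move=> c0; rewrite uE vc c0 scale0r row_mx0.
  rewrite -row_free_unit -kermx_eq0; apply/eqP/row_matrixP => i; rewrite row0.
  by apply: inj; rewrite -row_mul mulmx_ker row0.
have [X [cX zX]] := implicit_zeros F1 F0 uM.
exists X; split=> //; apply: filterS zX => e h k; split.
  by have := h (lshift N k); rewrite /ift_component (unsplitK (inl k)).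
by have := h (rshift N k); rewrite /ift_component (unsplitK (inr k)).
Qed.

End Continuation.

(** * Relative equilibria from zeros of the gradient *)

Section RelativeEquilibria.
Variables (R : realType) (N : nat).
Notation PS := 'rV[R]_(N + N).
Implicit Types (e : R) (x : PS) (a b : 'I_N -> R) (k i : 'I_N) (q : config R N).

(** Velocities are these vectors turned by a right angle, see [velocity_lift]. *)
Definition field_x e a b k : R :=
  inversion (rel_pos e a k) (rel_pos e b k)
  + e * \sum_(i < N | i != k) inversion (a k - a i) (b k - b i).

Lemma sum_field_x e a b :
  \sum_k field_x e a b k = \sum_k inversion (rel_pos e a k) (rel_pos e b k).
Proof.
rewrite big_split /= -mulr_sumr (@sum_antisym0 R N (fun k i => inversion (a k - a i) (b k - b i))).
  by rewrite mulr0 addr0.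
by move=> i j; rewrite /inversion -!(opprB (a j)) -(opprB (b j)) !sqrrN; ring.
Qed.

(** The gradient of Phi_e is the matrix I + e 1 1^T applied to the failure of the
    relative equilibrium equations. *)
Lemma grad_xE e a b k :
  grad_x e a b k = - (field_x e a b k - a k + e * \sum_i (field_x e a b i - a i)).
Proof. by rewrite sumrB sum_field_x /grad_x /field_x; ring. Qed.

Lemma field_x_eq e a b : 1 + e * N%:R != 0 -> (forall k, grad_x e a b k = 0) ->
  forall k, field_x e a b k = a k.
Proof.
move=> n0 g0; set w := fun k => field_x e a b k - a k.
have hk k : w k + e * \sum_i w i = 0 by apply/eqP; rewrite -oppr_eq0 -grad_xE g0.
have s0 : \sum_i w i = 0.
  have : \sum_k (w k + e * \sum_i w i) = 0 by rewrite big1.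
  rewrite big_split /= sum_ord_cst => h.
  have : (1 + e * N%:R) * (\sum_i w i) = 0 by rewrite -[RHS]h; ring.
  by move/eqP; rewrite mulf_eq0 (negbTE n0) /= => /eqP.
by move=> k; apply/eqP; rewrite -subr_eq0 -/(w k); have := hk k; rewrite s0 mulr0 addr0 => ->.
Qed.

Lemma enorm_sqr (p : R * R) : enorm p ^+ 2 = p.1 ^+ 2 + p.2 ^+ 2.
Proof. by rewrite sqr_sqrtr /dot -?expr2 // addr_ge0 ?sqr_ge0. Qed.

Lemma fst_sum (I : finType) (P : pred I) (f : I -> R * R) :
  (\sum_(i | P i) f i).1 = \sum_(i | P i) (f i).1.
Proof. by rewrite (big_morph fst (id1 := 0) (op1 := +%R)). Qed.

Lemma snd_sum (I : finType) (P : pred I) (f : I -> R * R) :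
  (\sum_(i | P i) f i).2 = \sum_(i | P i) (f i).2.
Proof. by rewrite (big_morph snd (id1 := 0) (op1 := +%R)). Qed.

Lemma velocity_comp e q j : velocity e q j =
  (- \sum_(i < N.+1 | i != j) circulation e i * inversion ((q j).2 - (q i).2) ((q j).1 - (q i).1),
   \sum_(i < N.+1 | i != j) circulation e i * inversion ((q j).1 - (q i).1) ((q j).2 - (q i).2)).
Proof.
rewrite [LHS]surjective_pairing fst_sum snd_sum -sumrN; congr (_, _); apply: eq_bigr => i _.
  change (circulation e i / enorm (q j - q i) ^+ 2 * - ((q j).2 - (q i).2)
    = - (circulation e i * inversion ((q j).2 - (q i).2) ((q j).1 - (q i).1))).
  by rewrite enorm_sqr /inversion /= [(_ - (q i).2) ^+ 2 + _]addrC; ring.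
change (circulation e i / enorm (q j - q i) ^+ 2 * ((q j).1 - (q i).1)
  = circulation e i * inversion ((q j).1 - (q i).1) ((q j).2 - (q i).2)).
by rewrite enorm_sqr /inversion /=; ring.
Qed.

Lemma sum_but_lift (f : 'I_N.+1 -> R) k :
  \sum_(i < N.+1 | i != lift ord0 k) f i = f ord0 + \sum_(i < N | i != k) f (lift ord0 i).
Proof.
rewrite big_mkcond big_ord_recl /=; congr (_ + _); rewrite [RHS]big_mkcond.
by apply: eq_bigr => i _; rewrite (inj_eq lift_inj).
Qed.

Lemma sum_but_ord0 (f : 'I_N.+1 -> R) :
  \sum_(i < N.+1 | i != ord0) f i = \sum_(i < N) f (lift ord0 i).
Proof.
by rewrite big_mkcond big_ord_recl /= add0r.
Qed.

Lemma complete_lift e (p : 'I_N -> R * R) i : complete_config e p (lift ord0 i) = p i.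
Proof. by rewrite /complete_config liftK. Qed.

Lemma complete_ord0 e (p : 'I_N -> R * R) : complete_config e p ord0 = - e *: \sum_(i < N) p i.
Proof. by rewrite /complete_config unlift_none. Qed.

Lemma polar_fst x i : (polar x i).1 = pos_x x i. Proof. by []. Qed.
Lemma polar_snd x i : (polar x i).2 = pos_y x i. Proof. by []. Qed.

Lemma complete_ord0_fst e x : (complete_config e (polar x) ord0).1 = - (e * \sum_i pos_x x i).
Proof. by rewrite complete_ord0 /= fst_sum /=; rewrite -mulNr. Qed.

Lemma complete_ord0_snd e x : (complete_config e (polar x) ord0).2 = - (e * \sum_i pos_y x i).
Proof. by rewrite complete_ord0 /= snd_sum /=; rewrite -mulNr. Qed.

Lemma velocity_lift e x k : velocity e (complete_config e (polar x)) (lift ord0 k) =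
  (- field_x e (pos_y x) (pos_x x) k, field_x e (pos_x x) (pos_y x) k).
Proof.
rewrite velocity_comp !sum_but_lift !complete_ord0_fst !complete_ord0_snd !complete_lift.
rewrite !opprK /field_x ![e * \sum_(i < N | _ != k) _]mulr_sumr /circulation eqxx !mul1r.
by congr (- (_ + _), _ + _); apply: eq_bigr => i _; rewrite complete_lift eq_sym (negbTE (neq_lift _ _)).
Qed.

Lemma velocity_ord0 e x : velocity e (complete_config e (polar x)) ord0 =
  (e * \sum_k field_x e (pos_y x) (pos_x x) k, - (e * \sum_k field_x e (pos_x x) (pos_y x) k)).
Proof.
have inN (s u : R) : inversion (- s) (- u) = - inversion s u by rewrite /inversion !sqrrN mulNr.
rewrite velocity_comp !sum_but_ord0 !complete_ord0_fst !complete_ord0_snd !sum_field_x.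
rewrite /rel_pos; move: (\sum_i pos_x x i) (\sum_i pos_y x i) => SX SY.
rewrite !mulr_sumr -!sumrN.
congr (_, _); apply: eq_bigr => i _; rewrite complete_lift /circulation;
  rewrite -!opprD inN polar_fst polar_snd.
  by rewrite mulrN opprK ![e * _ + _]addrC.
by rewrite mulrN ![e * _ + _]addrC.
Qed.

Lemma complete_injective e x : regular_at e x -> injective (complete_config e (polar x)).
Proof.
move=> [n0 d0].
have c0 i : complete_config e (polar x) (lift ord0 i) = complete_config e (polar x) ord0 -> False.
  rewrite complete_lift => h; move: (n0 i); rewrite /rel_pos.
  have -> : pos_x x i = - (e * \sum_i pos_x x i) by rewrite -complete_ord0_fst -h.
  have -> : pos_y x i = - (e * \sum_i pos_y x i) by rewrite -complete_ord0_snd -h.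
  by rewrite !addNr expr0n addr0 eqxx.
move=> j j'; case: (unliftP ord0 j) => [i ->|->]; case: (unliftP ord0 j') => [i' ->|->] //.
- rewrite !complete_lift => h; congr (lift _ _); apply/eqP; apply/negPn/negP => ii.
  have := d0 i' i ii; rewrite -!polar_fst -!polar_snd h !subrr expr0n addr0 eqxx //.
- by move/c0.
- by move/esym/c0.
Qed.

(** The matrix I + e 1 1^T is invertible, so the equations of the small vortices
    hold. Summing them gives the equation of the strong vortex, because the mutual
    terms cancel in [sum_field_x]. *)
Lemma relative_equilibrium_polar e x : regular_at e x -> 1 + e * N%:R != 0 ->
  (forall k, grad_x e (pos_x x) (pos_y x) k = 0 /\ grad_x e (pos_y x) (pos_x x) k = 0) ->
  relative_equilibrium e (complete_config e (polar x)).
Proof.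
move=> reg n0 g0.
have fx := field_x_eq n0 (fun k => (g0 k).1).
have fy := field_x_eq n0 (fun k => (g0 k).2).
split; first exact: complete_injective.
  by rewrite complete_ord0; congr (_ *: _); apply: eq_bigr => i _; rewrite complete_lift.
move=> j; case: (unliftP ord0 j) => [i ->|->].
  by rewrite velocity_lift fx fy complete_lift.
rewrite velocity_ord0 /perp complete_ord0_fst complete_ord0_snd opprK.
by congr (e * _, - (e * _)); apply: eq_bigr => i _; rewrite ?fx ?fy.
Qed.

(** The torques add up to 0 by rotation invariance, hence so do N copies of c. *)
Lemma constraint_removed e x (c : R) : (0 < N)%N -> e != 0 ->
  (forall k, lsubmx x ord0 k != 0) ->
  (forall k, grad_r e x k = 0 /\ grad_t e x k + c = 0) ->
  forall k, [/\ grad_x e (pos_x x) (pos_y x) k = 0, grad_x e (pos_y x) (pos_x x) k = 0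
    & grad_t e x k = 0].
Proof.
move=> N0 e0 r0 h.
have ht k : grad_t e x k = - c by apply/eqP; rewrite -addr_eq0 (h k).2.
have c0 : c = 0.
  have := grad_rotation e (pos_x x) (pos_y x).
  under eq_bigr do rewrite grad_angleE -/(grad_t e x _) ht.
  rewrite sum_ord_cst => /eqP; rewrite !mulf_eq0 (negbTE e0) pnatr_eq0 oppr_eq0.
  by rewrite -[N == 0%N]negbK -lt0n N0 /= => /eqP.
have t0 k : grad_t e x k = 0 by rewrite ht c0 oppr0.
move=> k; set gx := grad_x e (pos_x x) (pos_y x) k; set gy := grad_x e (pos_y x) (pos_x x) k.
have h1 : cos (rsubmx x ord0 k) * gx + sin (rsubmx x ord0 k) * gy = 0 := (h k).1.
have h2 : - sin (rsubmx x ord0 k) * gx + cos (rsubmx x ord0 k) * gy = 0.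
  have := grad_angleE e (pos_x x) (pos_y x) k; rewrite -/(grad_t e x k) t0 mulr0 -/gx -/gy.
  rewrite {1}/pos_x {1}/pos_y => h2; apply: (mulfI (r0 k)); rewrite mulr0 -[RHS]h2; ring.
have cs := cos2Dsin2 (rsubmx x ord0 k).
set cc := cos _ in h1 h2 cs; set ss := sin _ in h1 h2 cs.
split=> //.
  have : (cc ^+ 2 + ss ^+ 2) * gx = cc * (cc * gx + ss * gy) - ss * (- ss * gx + cc * gy) by ring.
  by rewrite cs h1 h2 !mulr0 subr0 mul1r.
have : (cc ^+ 2 + ss ^+ 2) * gy = ss * (cc * gx + ss * gy) + cc * (- ss * gx + cc * gy) by ring.
by rewrite cs h1 h2 !mulr0 addr0 mul1r.
Qed.

End RelativeEquilibria.

(** * Limits of relative equilibria *)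

Section Families.
Variables (R : realType) (N : nat).
Notation PS := 'rV[R]_(N + N).
Notation E := (R * PS)%type.
Implicit Types (e : R) (x : PS) (t : 'rV[R]_N) (k i : 'I_N) (q : config R N).

Lemma enorm_cvg (T : Type) (F : set_system T) {FF : Filter F} (f : T -> R * R) (p : R * R) :
  f s @[s --> F] --> p -> enorm (f s) @[s --> F] --> enorm p.
Proof.
move=> fp; have [f1 f2] : (f s).1 @[s --> F] --> p.1 /\ (f s).2 @[s --> F] --> p.2.
  by split; apply: (cvg_comp _ _ fp); [exact: cvg_fst|exact: cvg_snd].
apply: (cvg_comp (fun s => dot (f s) (f s)) Num.sqrt); last exact: sqrt_continuous.
by apply: cvgD; exact: cvgM.
Qed.

Lemma enorm_ge0 (p : R * R) : 0 <= enorm p.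
Proof. exact: sqrtr_ge0. Qed.

Lemma enorm_gt0 (p : R * R) : p != 0 -> 0 < enorm p.
Proof.
move=> p0; rewrite lt_neqAle enorm_ge0 andbT eq_sym; apply: contra p0 => /eqP h.
have := enorm_sqr p; rewrite h expr0n => /esym/eqP.
rewrite paddr_eq0 ?sqr_ge0 // !sqrf_eq0 => /andP[/eqP h1 /eqP h2].
by rewrite [p]surjective_pairing h1 h2.
Qed.

Lemma common_lower_bound (I : finType) (P : pred I) (f : I -> R) : (forall i : I, P i -> 0 < f i) ->
  exists2 m : R, 0 < m & forall i : I, P i -> m <= f i.
Proof.
move=> f0; exists (1 + \sum_(i | P i) (f i)^-1)^-1 => [|i Pi].
  by rewrite invr_gt0 ltr_wpDr ?ltr01 // sumr_ge0 // => i /f0/ltW; rewrite invr_ge0.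
rewrite -[leRHS]invrK lef_pV2 ?posrE ?invr_gt0 ?f0 //; last first.
  by rewrite ltr_wpDr ?ltr01 // sumr_ge0 // => j /f0/ltW; rewrite invr_ge0.
rewrite (bigD1 i) //= addrCA lerDl addr_ge0 // sumr_ge0 // => j /andP[/f0/ltW].
by rewrite invr_ge0.
Qed.

(** The bounds m and M are read off from the limit, whose vortices are distinct. *)
Lemma limit_of_family (Qe : R -> config R N) q : injective q ->
  (forall j, Qe e j @[e --> (0 : R)] --> q j) ->
  (\forall e \near (0 : R), e != 0 -> relative_equilibrium e (Qe e)) ->
  limit_relative_equilibrium q.
Proof.
move=> qi qc re.
have d0 (p : 'I_N.+1 * 'I_N.+1) : p.1 != p.2 -> 0 < enorm (q p.1 - q p.2) / 2.
  by move=> ne; rewrite divr_gt0 // enorm_gt0 // subr_eq0 (inj_eq qi).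
have [m m0 mle] := common_lower_bound d0.
pose M := 1 + \sum_j enorm (q j).
have Mle j : enorm (q j) < M.
  by rewrite /M (bigD1 j) //= addrCA ltrDl ltr_wpDr ?ltr01 // sumr_ge0 // => i _; exact: enorm_ge0.
have far : \forall e \near (0 : R), forall p : 'I_N.+1 * 'I_N.+1,
    p.1 != p.2 -> m <= enorm (Qe e p.1 - Qe e p.2).
  apply: near_forall => p; have [_|ne] := eqVneq p.1 p.2; first by near=> e.
  have c : enorm (Qe e p.1 - Qe e p.2) @[e --> (0 : R)] --> enorm (q p.1 - q p.2).
    by apply: enorm_cvg; apply: cvgB; exact: qc.
  have l : m < enorm (q p.1 - q p.2).
    apply: (le_lt_trans (mle _ ne)); rewrite ltr_pdivrMr // ltr_pMr ?ltr1n //.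
    by rewrite enorm_gt0 // subr_eq0 (inj_eq qi).
  by apply: filterS (cvgr_gt _ c _ l) => e /ltW le _.
have close : \forall e \near (0 : R), forall j, enorm (Qe e j) <= M.
  apply: near_forall => j.
  by apply: filterS (cvgr_lt _ (enorm_cvg (qc j)) _ (Mle j)) => e /ltW.
have : \forall e \near (0 : R), (e != 0 -> relative_equilibrium e (Qe e)) /\
    ((forall p : 'I_N.+1 * 'I_N.+1, p.1 != p.2 -> m <= enorm (Qe e p.1 - Qe e p.2)) /\
     (forall j, enorm (Qe e j) <= M)).
  by apply: filterI; [exact: re|apply: filterI].
move=> /nbhs_ballP [d /= dpos dP].
(* a sequence of nonzero parameters inside the neighbourhood where everything holds *)
pose eps (k : nat) : R := d / 2 * harmonic k.
have epos (k : nat) : 0 < eps k by rewrite mulr_gt0 ?divr_gt0 ?harmonic_gt0.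
have ed (k : nat) : ball (0 : R) d (eps k).
  rewrite -ball_normE /ball_ /= sub0r normrN gtr0_norm // /eps.
  apply: (@le_lt_trans _ _ (d / 2)); last by rewrite ltr_pdivrMr // ltr_pMr ?ltr1n.
  by rewrite ler_piMr ?divr_ge0 ?(ltW dpos) // /harmonic invf_le1 ?ltr0n // ler1n.
have e0 : eps k @[k --> \oo] --> (0 : R).
  rewrite -[X in _ --> X](mulr0 (d / 2)); apply: cvgM; first exact: cvg_cst.
  exact: cvg_harmonic.
exists eps, (fun k : nat => Qe (eps k)); split.
- by split; [move=> k; rewrite gt_eqF|exact: e0].
- by move=> k; have [h _] := dP _ (ed k); apply: h; rewrite gt_eqF.
- by move=> j; exact: (cvg_comp _ _ e0 (qc j)).
- exists m, M; split => //; first by rewrite ltr_wpDr ?ltr01 // sumr_ge0 // => i _; exact: enorm_ge0.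
    by move=> k i j ij; have [_ [h _]] := dP _ (ed k); exact: (h (i, j)).
  by move=> k j; have [_ [_ h]] := dP _ (ed k).
Unshelve. all: by end_near. Qed.

(** With e = 0 the strong vortex sits at the origin. *)
Definition circle_config t : config R N := complete_config 0 (polar (circle_state t)).

(** The last two conditions put the configuration in the range of the polar
    chart, at a critical point of Phi_e. *)
Definition equilibrium_at e x : Prop := [/\ regular_at e x, 1 + e * N%:R != 0,
   forall k, 0 < lsubmx x ord0 k
 & forall k, [/\ grad_x e (pos_x x) (pos_y x) k = 0,
          grad_x e (pos_y x) (pos_x x) k = 0 & grad_t e x k = 0]].

Lemma equilibrium_branch t : (0 < N)%N -> V_critical t -> V_nondegenerate t ->
  exists X : R -> PS, X e @[e --> (0 : R)] --> circle_state t /\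
    \forall e \near (0 : R), e != 0 -> equilibrium_at e (X e).
Proof.
move=> N0 tc nd; have [X [cX zX]] := continuation N0 tc nd.
exists X; split=> //.
have cz : (e, X e) @[e --> (0 : R)] --> ((0, circle_state t) : E).
  by apply: cvg_to_pair; [exact: cvg_id|exact: cX].
have reg : \forall e \near (0 : R), regular_at e (X e).
  have := @regular_near R N E fst snd (0, circle_state t) (C1_eps _)
    (fun j => C1_state _ j) (regular_circle tc.1).
  by move/(cz _).
have rpos : \forall e \near (0 : R), forall k, 0 < lsubmx (X e) ord0 k.
  apply: near_forall => k.
  have c : lsubmx (X e) ord0 k @[e --> (0 : R)] --> (1 : R).
    rewrite -[X in _ --> X](circle_rad t k) mxE.
    have -> : (fun e => lsubmx (X e) ord0 k) = (fun e => X e 0 (lshift N k)).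
      by apply/funext => e; rewrite mxE.
    apply: (cvg_comp X (fun x : PS => x 0 (lshift N k)) cX).
    exact: coord_continuous.
  exact: (cvgr_gt _ c _ ltr01).
have n0 : \forall e \near (0 : R), 1 + e * N%:R > 0.
  have c : 1 + e * N%:R @[e --> (0 : R)] --> 1 + 0 * (N%:R : R).
    by apply: cvgD; [exact: cvg_cst|apply: cvgM; [exact: cvg_id|exact: cvg_cst]].
  by apply: (cvgr_gt _ c); rewrite mul0r addr0 ltr01.
near=> e; move=> e0; have he : forall k, 0 < lsubmx (X e) ord0 k by near: e.
split=> //; first by near: e.
  by rewrite gt_eqF //; near: e.
apply: (@constraint_removed R N e (X e) (\sum_i (rsubmx (X e) ord0 i - t 0 i))) => //.
  by move=> k; rewrite gt_eqF.
by near: e.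
Unshelve. all: by end_near. Qed.

Lemma branch_cvg t (X : R -> PS) : X e @[e --> (0 : R)] --> circle_state t ->
  forall j, complete_config e (polar (X e)) j @[e --> (0 : R)] --> circle_config t j.
Proof.
move=> cX; have xc (l : 'I_(N + N)) : X e 0 l @[e --> (0 : R)] --> circle_state t 0 l.
  apply: (cvg_comp X (fun x : PS => x 0 l) cX).
  exact: coord_continuous.
have px i : pos_x (X e) i @[e --> (0 : R)] --> pos_x (circle_state t) i.
  have pE x : pos_x x i = x 0 (lshift N i) * cos (x 0 (rshift N i)) by rewrite /pos_x !mxE.
  rewrite pE; under eq_fun do rewrite pE.
  apply: cvgM; first exact: xc.
  by apply: (cvg_comp _ _ (xc _)); exact: continuous_cos.
have py i : pos_y (X e) i @[e --> (0 : R)] --> pos_y (circle_state t) i.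
  have pE x : pos_y x i = x 0 (lshift N i) * sin (x 0 (rshift N i)) by rewrite /pos_y !mxE.
  rewrite pE; under eq_fun do rewrite pE.
  apply: cvgM; first exact: xc.
  by apply: (cvg_comp _ _ (xc _)); exact: continuous_sin.
have sc (f : 'I_N -> R -> R) (l : 'I_N -> R) : (forall i, f i e @[e --> (0 : R)] --> l i) ->
    - (e * \sum_i f i e) @[e --> (0 : R)] --> - (0 * \sum_i l i).
  move=> fl; apply: cvgN; apply: cvgM; first exact: cvg_id.
  by apply: cvg_big => [|i _]; [exact: add_continuous|exact: fl].
move=> j; rewrite [circle_config t j]surjective_pairing.
have -> : (fun e => complete_config e (polar (X e)) j)
  = (fun e => ((complete_config e (polar (X e)) j).1, (complete_config e (polar (X e)) j).2)).
  by apply/funext => e; rewrite -surjective_pairing.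
rewrite /circle_config; case: (unliftP ord0 j) => [i ->|->]; apply: cvg_to_pair.
- rewrite complete_lift; under eq_fun do rewrite complete_lift; exact: px.
- rewrite complete_lift; under eq_fun do rewrite complete_lift; exact: py.
- rewrite complete_ord0_fst; under eq_fun do rewrite complete_ord0_fst; exact: sc.
- rewrite complete_ord0_snd; under eq_fun do rewrite complete_ord0_snd; exact: sc.
Qed.

Lemma critical_limit_equilibrium t : (0 < N)%N -> V_critical t -> V_nondegenerate t ->
  limit_relative_equilibrium (circle_config t).
Proof.
move=> N0 tc nd; have [X [cX hX]] := equilibrium_branch N0 tc nd.
apply: (@limit_of_family (fun e => complete_config e (polar (X e)))).
- by apply: complete_injective; exact: regular_circle tc.1.
- exact: branch_cvg.
- apply: filterS hX => e he e0; have [reg n0 _ g0] := he e0.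
  by apply: relative_equilibrium_polar => // k; have [-> ->] := g0 k.
Qed.

End Families.

(** * The second derivative of the gradient equations *)

Section TidalForm.
Variables (R : realType) (N : nat).
Implicit Types (e : R) (x y h l : 'I_N -> R) (k i : 'I_N).

(** The Hessian of Phi_e, evaluated on two displacements. *)
Definition grad_form e x y h l h' l' : R :=
  \sum_k (dgrad_x e x y h l k * h' k + dgrad_x e y x l h k * l' k).

Definition tidal (a b h l h' l' : R) : R := dinversion a b h l * h' + dinversion b a l h * l'.

(** The tidal tensor is a second derivative of the logarithm. *)
Lemma tidal_sym (a b h l h' l' : R) : tidal a b h l h' l' = tidal a b h' l' h l.
Proof. by rewrite /tidal /dinversion [b ^+ 2 + _]addrC; ring. Qed.

Lemma dinversionN (a b h l : R) : dinversion (- a) (- b) (- h) (- l) = - dinversion a b h l.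
Proof. by rewrite /dinversion !sqrrN; ring. Qed.

(** Written over pairs, each term involves only the coordinates relative to the
    strong vortex or to one another, so that symmetry can be checked term by
    term. *)
Lemma sum_dgrad e x y h l h' : \sum_k dgrad_x e x y h l k * h' k =
  \sum_k h k * h' k + e * (\sum_k h k) * (\sum_k h' k)
  - \sum_k dinversion (rel_pos e x k) (rel_pos e y k) (rel_pos e h k) (rel_pos e l k) * rel_pos e h' k
  - e * \sum_(k < N) \sum_(i < N | (k < i)%N)
      dinversion (x k - x i) (y k - y i) (h k - h i) (l k - l i) * (h' k - h' i).
Proof.
have h1 := @sum_antisym R N (fun k i => dinversion (x k - x i) (y k - y i) (h k - h i) (l k - l i)) h'.
rewrite -h1; last by move=> i j; rewrite -dinversionN !opprB.
have key (d w : 'I_N -> R) : \sum_k (h k * h' k + e * (\sum_k h k) * h' k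
      - (d k * h' k + e * (\sum_j d j) * h' k) - e * (h' k * w k))
    = \sum_k h k * h' k + e * (\sum_k h k) * (\sum_k h' k)
      - \sum_k d k * rel_pos e h' k - e * \sum_k h' k * w k.
  rewrite !big_split /= !sumrN big_split /= -!mulr_sumr; congr (_ + _ - _ - _).
  rewrite [RHS](eq_bigr (fun k => d k * h' k + d k * (e * \sum_k h' k))).
    by rewrite big_split /= -mulr_suml; congr (_ + _); ring.
  by move=> k _; rewrite /rel_pos mulrDr.
rewrite -(key (fun k => dinversion (rel_pos e x k) (rel_pos e y k) (rel_pos e h k) (rel_pos e l k))
  (fun k => \sum_(i < N | i != k) dinversion (x k - x i) (y k - y i) (h k - h i) (l k - l i))).
by apply: eq_bigr => k _; rewrite /dgrad_x; ring.
Qed.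

Lemma grad_form_sym e x y h l h' l' :
  grad_form e x y h l h' l' = grad_form e x y h' l' h l.
Proof.
have E (a b a' b' : 'I_N -> R) : grad_form e x y a b a' b'
   = (\sum_k a k * a' k + \sum_k b k * b' k) + (e * (\sum_k a k) * (\sum_k a' k) + e * (\sum_k b k) * (\sum_k b' k))
   - \sum_k tidal (rel_pos e x k) (rel_pos e y k) (rel_pos e a k) (rel_pos e b k) (rel_pos e a' k) (rel_pos e b' k)
   - e * \sum_(k < N) \sum_(i < N | (k < i)%N)
      tidal (x k - x i) (y k - y i) (a k - a i) (b k - b i) (a' k - a' i) (b' k - b' i).
  rewrite /grad_form big_split /= !sum_dgrad /tidal [in RHS]big_split /=.
  have split2 (u v : 'I_N -> 'I_N -> R) : \sum_(k < N) \sum_(i < N | (k < i)%N) (u k i + v k i)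
      = \sum_(k < N) \sum_(i < N | (k < i)%N) u k i + \sum_(k < N) \sum_(i < N | (k < i)%N) v k i.
    by rewrite -big_split; apply: eq_bigr => k _; rewrite big_split.
  rewrite [in RHS](split2 (fun k i => dinversion (x k - x i) (y k - y i) (a k - a i) (b k - b i) * (a' k - a' i))
    (fun k i => dinversion (y k - y i) (x k - x i) (b k - b i) (a k - a i) * (b' k - b' i))).
  by ring.
rewrite !E; congr (_ + _ - _ - _ * _).
- by congr (_ + _); apply: eq_bigr => k _; rewrite mulrC.
- by ring.
- by apply: eq_bigr => k _; rewrite tidal_sym.
- by apply: eq_bigr => k _; apply: eq_bigr => i _; rewrite tidal_sym.
Qed.

Lemma rel_posN e x k : rel_pos e (fun i => - x i) k = - rel_pos e x k.
Proof. by rewrite /rel_pos sumrN mulrN opprD. Qed.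

Lemma dinversion_rotl (a b : R) : dinversion a b (- b) a = - inversion b a.
Proof. by rewrite /dinversion /inversion [b ^+ 2 + _]addrC; ring. Qed.

Lemma dinversion_rotr (a b : R) : dinversion a b b (- a) = inversion b a.
Proof. by rewrite /dinversion /inversion [b ^+ 2 + _]addrC; ring. Qed.

(** The derivative of an equivariant vector field along the rotations is the
    rotated field. In particular it vanishes at a critical point. *)
Lemma dgrad_rotl e x y k : dgrad_x e x y (fun i => - y i) x k = - grad_x e y x k.
Proof.
rewrite /dgrad_x /grad_x rel_posN dinversion_rotl.
have -> : \sum_(i < N | i != k) dinversion (x k - x i) (y k - y i) (- y k - - y i) (x k - x i)
   = - \sum_(i < N | i != k) inversion (y k - y i) (x k - x i).
  by rewrite -sumrN; apply: eq_bigr => i _; rewrite -opprD dinversion_rotl.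
have -> : \sum_j dinversion (rel_pos e x j) (rel_pos e y j) (rel_pos e (fun i => - y i) j) (rel_pos e x j)
   = - \sum_j inversion (rel_pos e y j) (rel_pos e x j).
  by rewrite -sumrN; apply: eq_bigr => i _; rewrite rel_posN dinversion_rotl.
by rewrite sumrN; ring.
Qed.

Lemma dgrad_rotr e x y k : dgrad_x e x y y (fun i => - x i) k = grad_x e y x k.
Proof.
rewrite /dgrad_x /grad_x rel_posN dinversion_rotr.
congr (_ - _ - _ * (_ + _ - _)); apply: eq_bigr => i _.
  by rewrite -opprD dinversion_rotr.
by rewrite rel_posN dinversion_rotr.
Qed.

End TidalForm.

Section Linearization.
Variables (R : realType) (N : nat).
Notation PS := 'rV[R]_(N + N).
Notation E := (R * PS)%type.
Implicit Types (x y u : PS) (k i : 'I_N).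

(** [disp_x] and [disp_y] are the Cartesian displacement of vortex k that
    corresponds to the displacement y in polar coordinates at x. *)
Definition disp_x x y k : R := y 0 (lshift N k) * cos (rsubmx x ord0 k)
  - lsubmx x ord0 k * sin (rsubmx x ord0 k) * y 0 (rshift N k).
Definition disp_y x y k : R := y 0 (lshift N k) * sin (rsubmx x ord0 k)
  + lsubmx x ord0 k * cos (rsubmx x ord0 k) * y 0 (rshift N k).

Section Directional.
Variables (V : normedModType R) (e : V -> R) (x : V -> PS) (z v : V) (y : PS).
Hypothesis de : is_derive z v e 0.
Hypothesis dx : forall j, is_derive z v (fun z => x z 0 j) (y 0 j).

Lemma rad_coord (w : PS) k : lsubmx w ord0 k = w 0 (lshift N k).
Proof. by rewrite mxE. Qed.
Lemma ang_coord (w : PS) k : rsubmx w ord0 k = w 0 (rshift N k).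
Proof. by rewrite mxE. Qed.

Lemma der_pos_x k : is_derive z v (fun z => pos_x (x z) k) (disp_x (x z) y k).
Proof.
have -> : (fun z => pos_x (x z) k) = (fun z => x z 0 (lshift N k) * cos (x z 0 (rshift N k))).
  by apply/funext => w; rewrite /pos_x rad_coord ang_coord.
have h := derM (dx (lshift N k)) (der_cos (dx (rshift N k))).
by apply: (is_derive_eq h); rewrite /disp_x rad_coord ang_coord; ring.
Qed.

Lemma der_pos_y k : is_derive z v (fun z => pos_y (x z) k) (disp_y (x z) y k).
Proof.
have -> : (fun z => pos_y (x z) k) = (fun z => x z 0 (lshift N k) * sin (x z 0 (rshift N k))).
  by apply/funext => w; rewrite /pos_y rad_coord ang_coord.
have h := derM (dx (lshift N k)) (der_sin (dx (rshift N k))).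
by apply: (is_derive_eq h); rewrite /disp_y rad_coord ang_coord; ring.
Qed.

Lemma der_grad_x_state k : regular_at (e z) (x z) ->
  is_derive z v (fun z => grad_x (e z) (pos_x (x z)) (pos_y (x z)) k)
    (dgrad_x (e z) (pos_x (x z)) (pos_y (x z)) (disp_x (x z) y) (disp_y (x z) y) k).
Proof.
move=> reg.
exact: (@der_grad_x R N V e (fun i z => pos_x (x z) i) (fun i z => pos_y (x z) i) z v _ _ k reg
  de der_pos_x der_pos_y).
Qed.

Lemma der_grad_y_state k : regular_at (e z) (x z) ->
  is_derive z v (fun z => grad_x (e z) (pos_y (x z)) (pos_x (x z)) k)
    (dgrad_x (e z) (pos_y (x z)) (pos_x (x z)) (disp_y (x z) y) (disp_x (x z) y) k).
Proof.
move=> [n0 d0].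
apply: (@der_grad_x R N V e (fun i z => pos_y (x z) i) (fun i z => pos_x (x z) i) z v _ _ k _
  de der_pos_y der_pos_x).
by split => [i|i j ij]; rewrite addrC; [exact: n0|exact: d0].
Qed.

Lemma C1_field_x k : C1 e z -> (forall j, C1 (fun z => x z 0 j) z) -> regular_at (e z) (x z) ->
  C1 (fun z => field_x (e z) (pos_x (x z)) (pos_y (x z)) k) z /\
  C1 (fun z => field_x (e z) (pos_y (x z)) (pos_x (x z)) k) z.
Proof.
move=> e1 x1 [n0 d0].
have px i := C1_pos_x i x1; have py i := C1_pos_y i x1.
have half (a b : 'I_N -> V -> R) : (forall i, C1 (a i) z) -> (forall i, C1 (b i) z) ->
   (forall k, rel_pos (e z) (a^~ z) k ^+ 2 + rel_pos (e z) (b^~ z) k ^+ 2 != 0) ->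
   (forall k i, i != k -> (a k z - a i z) ^+ 2 + (b k z - b i z) ^+ 2 != 0) ->
   C1 (fun z => field_x (e z) (a^~ z) (b^~ z) k) z.
  move=> a1 b1 na da; apply: C1D.
    by apply: C1_inversion; [exact: C1_rel|exact: C1_rel|exact: na].
  apply: C1M; first exact: e1.
  apply: C1_sum => i ik.
  by apply: C1_inversion; [exact: (C1B (a1 k) (a1 i))|exact: (C1B (b1 k) (b1 i))|exact: da].
split.
  exact: (half (fun i z => pos_x (x z) i) (fun i z => pos_y (x z) i)).
apply: (half (fun i z => pos_y (x z) i) (fun i z => pos_x (x z) i)) => // [i|i j ij].
  by rewrite addrC; exact: n0.
by rewrite addrC; exact: d0.
Qed.

End Directional.

(** At a critical point this is the Hessian of Phi_e in polar coordinates. *)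
Definition state_form e x y y' : R := grad_form e (pos_x x) (pos_y x)
  (disp_x x y) (disp_y x y) (disp_x x y') (disp_y x y').

Lemma state_form_sym e x y y' : state_form e x y y' = state_form e x y' y.
Proof. exact: grad_form_sym. Qed.

Definition rotation_mode : PS := row_mx 0 (const_mx 1).

Lemma disp_rotation x : disp_x x rotation_mode = (fun k => - pos_y x k) /\
  disp_y x rotation_mode = pos_x x.
Proof.
split; apply/funext => k; rewrite /disp_x /disp_y /rotation_mode row_mxEl row_mxEr !mxE.
  by rewrite /pos_y mul0r mulr1 sub0r !mxE.
by rewrite /pos_x mul0r mulr1 add0r !mxE.
Qed.

Lemma state_form_rotation e x y : equilibrium_at e x -> state_form e x rotation_mode y = 0.
Proof.
move=> [_ _ _ g0]; rewrite /state_form; have [-> ->] := disp_rotation x.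
rewrite /grad_form big1 // => k _; rewrite dgrad_rotl dgrad_rotr.
by have [-> -> _] := g0 k; rewrite oppr0 !mul0r addr0.
Qed.

(** At a critical point derivatives of the chart do not contribute, so the Hessian
    may be computed from the polar components of the gradient. The angular ones
    carry a factor e by [grad_angleE]. *)
Lemma state_formE e x y y' : e != 0 -> equilibrium_at e x ->
  state_form e x y y' = \sum_k (y' 0 (lshift N k) *
      'D_((0, y) : E) (fun z : E => grad_r z.1 z.2 k) (e, x)
    + y' 0 (rshift N k) * (e * 'D_((0, y) : E) (fun z : E => grad_t z.1 z.2 k) (e, x))).
Proof.
move=> e0 [reg _ _ g0].
have dE : is_derive ((e, x) : E) ((0, y) : E) (fun z : E => z.1) 0 by exact: der_eps.
have dX j : is_derive ((e, x) : E) ((0, y) : E) (fun z : E => z.2 0 j) (y 0 j).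
  apply: is_derive_from_line.
  have -> : (fun s : R => (s *: ((0, y) : E) + ((e, x) : E)).2 0 j) = (fun s : R => y 0 j * s + x 0 j).
    by apply/funext => s; rewrite line_slice !mxE mulrC.
  have h := derD (derZ (y 0 j) (is_derive_id (0 : R) (1 : R))) (der_cst (x 0 j) (0 : R) (1 : R)).
  by apply: (is_derive_eq h); rewrite addr0 mulr1.
have Px := @der_pos_x E snd _ _ _ dX; have Py := @der_pos_y E snd _ _ _ dX.
have Gx k := @der_grad_x_state E fst snd _ _ _ dE dX k reg.
have Gy k := @der_grad_y_state E fst snd _ _ _ dE dX k reg.
rewrite /state_form /grad_form; apply: eq_bigr => k _.
have [gx gy gt] := g0 k.
set DX := dgrad_x e (pos_x x) _ _ _ k; set DY := dgrad_x e (pos_y x) _ _ _ k.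
have -> : 'D_((0, y) : E) (fun z : E => grad_r z.1 z.2 k) (e, x)
    = cos (rsubmx x ord0 k) * DX + sin (rsubmx x ord0 k) * DY.
  have hc := der_cos (dX (rshift N k)); have hs := der_sin (dX (rshift N k)).
  have h := derD (derM hc (Gx k)) (derM hs (Gy k)).
  have -> : (fun z : E => grad_r z.1 z.2 k) = (fun z : E =>
     cos (z.2 0 (rshift N k)) * grad_x z.1 (pos_x z.2) (pos_y z.2) k
     + sin (z.2 0 (rshift N k)) * grad_x z.1 (pos_y z.2) (pos_x z.2) k).
    by apply/funext => w; rewrite /grad_r !mxE.
  have [_ ->] := h; rewrite /= gx gy !mulr0 !add0r /DX /DY.
  by rewrite !mxE.
have -> : e * 'D_((0, y) : E) (fun z : E => grad_t z.1 z.2 k) (e, x)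
    = - pos_y x k * DX + pos_x x k * DY.
  have C : C1 (fun z : E => grad_t z.1 z.2 k) (e, x).
    apply: (@C1_grad_t R N E fst snd) => //; first exact: C1_eps.
    by move=> j; exact: C1_state.
  have D : is_derive ((e, x) : E) ((0, y) : E) (fun z : E => grad_t z.1 z.2 k)
     ('D_((0, y) : E) (fun z : E => grad_t z.1 z.2 k) (e, x)).
    by apply: derivableP; apply: diff_derivable; exact: C1_differentiable.
  have h1 := derM dE D.
  have h2 := derD (derM (derN (Py k)) (Gx k)) (derM (Px k) (Gy k)).
  have eq : (fun z : E => z.1 * grad_t z.1 z.2 k) = (fun z : E =>
     - pos_y z.2 k * grad_x z.1 (pos_x z.2) (pos_y z.2) k
     + pos_x z.2 k * grad_x z.1 (pos_y z.2) (pos_x z.2) k).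
    by apply/funext => w; rewrite grad_angleE.
  have [_ v1] := h1; have [_ v2] := h2.
  move: v1; rewrite eq v2 /= gx gy !mulr0 mul0r !add0r => <-.
  by [].
rewrite /disp_x /disp_y /pos_x /pos_y; ring.
Qed.

End Linearization.

(** * The linearized flow *)

Section BilinearForms.
Variables (R : realType).

(** Linearity is given as an equation for a bare function, which suits forms defined
    by sums. *)
Lemma additive_combination (n : nat) (f : 'rV[R]_n -> R) (u : 'rV[R]_n) :
  (forall (a : R) v w, f (a *: v + w) = a * f v + f w) ->
  f u = \sum_i u 0 i * f (delta_mx 0 i).
Proof.
move=> fl; have f0 : f 0 = 0.
  by have := fl (-1) 0 0; rewrite scaler0 addr0 mulN1r addNr.
rewrite {1}[u]row_sum_delta; elim/big_rec2: _ => [//|i a b _ <-].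
exact: fl.
Qed.

Lemma qform_bilinear (n : nat) (B : 'rV[R]_n -> 'rV[R]_n -> R) (u w : 'rV[R]_n) :
  (forall (a : R) v v' w, B (a *: v + v') w = a * B v w + B v' w) ->
  (forall (a : R) w v v', B w (a *: v + v') = a * B w v + B w v') ->
  B u w = qform (\matrix_(i, j) B (delta_mx 0 i) (delta_mx 0 j)) u w.
Proof.
move=> Bl Br; rewrite qformE (@additive_combination n (B^~ w)) //.
apply: eq_bigr => i _; rewrite (@additive_combination n (B _)) // mulr_sumr.
by apply: eq_bigr => j _; rewrite mxE; ring.
Qed.

Lemma qform_delta (n : nat) (S : 'M[R]_n) i j : qform S (delta_mx 0 i) (delta_mx 0 j) = S i j.
Proof. by rewrite /qform -rowE trmx_delta -colE !mxE. Qed.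

Lemma qform_symP (n : nat) (S : 'M[R]_n) : (forall u v, qform S u v = qform S v u) -> S^T = S.
Proof. by move=> h; apply/matrixP => i j; rewrite mxE -!qform_delta h. Qed.

End BilinearForms.

Section Jacobian.
Variables (R : realType) (N : nat).
Notation PS := 'rV[R]_(N + N).
Implicit Types (e : R) (x y u : PS) (k i : 'I_N).

(** The sum of the areas spanned by the displacements of the small vortices, plus e
    times the area spanned by the total displacements. Up to a common factor this
    is the symplectic form of the vortex problem, restricted to the center of
    vorticity at the origin. *)
Definition symplectic e x u y : R := \sum_k
  ((disp_x x u k + e * \sum_i disp_x x u i) * disp_y x y k
   - (disp_y x u k + e * \sum_i disp_y x u i) * disp_x x y k).

Lemma disp_x_lin x (a : R) u y k : disp_x x (a *: u + y) k = a * disp_x x u k + disp_x x y k.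
Proof. by rewrite /disp_x; set r := lsubmx _ _ _; set th := rsubmx _ _ _; rewrite !mxE; ring. Qed.

Lemma disp_y_lin x (a : R) u y k : disp_y x (a *: u + y) k = a * disp_y x u k + disp_y x y k.
Proof. by rewrite /disp_y; set r := lsubmx _ _ _; set th := rsubmx _ _ _; rewrite !mxE; ring. Qed.

Lemma symplectic_anti e x u y : symplectic e x u y = - symplectic e x y u.
Proof.
have E (a b : PS) : symplectic e x a b = (\sum_k disp_x x a k * disp_y x b k - \sum_k disp_y x a k * disp_x x b k)
   + e * ((\sum_k disp_x x a k) * (\sum_k disp_y x b k) - (\sum_k disp_y x a k) * (\sum_k disp_x x b k)).
  rewrite mulrBr addrACA -opprD !mulrA !mulr_sumr -!big_split /= -sumrB.
  by apply: eq_bigr => k _; rewrite -!mulr_sumr; ring.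
rewrite !E.
have -> : \sum_k disp_x x u k * disp_y x y k = \sum_k disp_y x y k * disp_x x u k.
  by apply: eq_bigr => k _; rewrite mulrC.
have -> : \sum_k disp_y x u k * disp_x x y k = \sum_k disp_x x y k * disp_y x u k.
  by apply: eq_bigr => k _; rewrite mulrC.
by ring.
Qed.

Lemma symplectic_linr e x (a : R) u y y' :
  symplectic e x u (a *: y + y') = a * symplectic e x u y + symplectic e x u y'.
Proof.
rewrite /symplectic mulr_sumr -big_split; apply: eq_bigr => k _ /=.
by rewrite disp_x_lin disp_y_lin; ring.
Qed.

Lemma symplectic_linl e x (a : R) u y y' :
  symplectic e x (a *: y + y') u = a * symplectic e x y u + symplectic e x y' u.
Proof. by rewrite symplectic_anti symplectic_linr !(symplectic_anti _ _ u) mulrN -!opprD opprK. Qed.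

Lemma disp_surj x (a b : 'I_N -> R) : (forall k, 0 < lsubmx x ord0 k) ->
  exists y, forall k, disp_x x y k = a k /\ disp_y x y k = b k.
Proof.
pose y : PS := row_mx (\row_k (a k * cos (rsubmx x ord0 k) + b k * sin (rsubmx x ord0 k)))
  (\row_k ((b k * cos (rsubmx x ord0 k) - a k * sin (rsubmx x ord0 k)) / lsubmx x ord0 k)).
move=> r0; exists y => k.
have yl : y 0 (lshift N k) = a k * cos (rsubmx x ord0 k) + b k * sin (rsubmx x ord0 k).
  by rewrite row_mxEl [LHS]mxE.
have yr : y 0 (rshift N k) = (b k * cos (rsubmx x ord0 k) - a k * sin (rsubmx x ord0 k)) / lsubmx x ord0 k.
  by rewrite row_mxEr [LHS]mxE.
have rn : lsubmx x ord0 k != 0 by rewrite gt_eqF.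
rewrite /disp_x /disp_y yl yr; have cs := cos2Dsin2 (rsubmx x ord0 k).
move: (rsubmx x ord0 k) (lsubmx x ord0 k) rn cs => th r rn cs.
have X : a k = (cos th ^+ 2 + sin th ^+ 2) * a k by rewrite cs mul1r.
have Y : b k = (cos th ^+ 2 + sin th ^+ 2) * b k by rewrite cs mul1r.
by split; [rewrite [RHS]X|rewrite [RHS]Y]; field.
Qed.

Lemma disp_inj x y : (forall k, 0 < lsubmx x ord0 k) ->
  (forall k, disp_x x y k = 0 /\ disp_y x y k = 0) -> y = 0.
Proof.
move=> r0 h; have cs k := cos2Dsin2 (rsubmx x ord0 k).
have rad k : y 0 (lshift N k) = 0.
  have [hx hy] := h k; rewrite -[LHS]mul1r -(cs k).
  transitivity (cos (rsubmx x ord0 k) * disp_x x y k + sin (rsubmx x ord0 k) * disp_y x y k).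
    by rewrite /disp_x /disp_y; ring.
  by rewrite hx hy !mulr0 addr0.
have ang k : y 0 (rshift N k) = 0.
  have [hx hy] := h k; have rn : lsubmx x ord0 k != 0 by rewrite gt_eqF.
  apply: (mulfI rn); rewrite mulr0 -[LHS]mul1r -(cs k).
  transitivity (cos (rsubmx x ord0 k) * disp_y x y k - sin (rsubmx x ord0 k) * disp_x x y k).
    by rewrite /disp_x /disp_y; ring.
  by rewrite hx hy !mulr0 subr0.
rewrite -[y]hsubmxK -[RHS](@row_mx0 R 1 N N); congr row_mx; apply/rowP => k.
  by rewrite [LHS]mxE rad mxE.
by rewrite [LHS]mxE ang mxE.
Qed.

(** Test with the displacement turned by a right angle. *)
Lemma symplectic_nondeg e x u : 1 + e * N%:R != 0 -> (forall k, 0 < lsubmx x ord0 k) ->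
  (forall y, symplectic e x u y = 0) -> u = 0.
Proof.
move=> n0 r0 h.
have [y hy] := disp_surj (fun k => - (disp_y x u k + e * \sum_i disp_y x u i))
  (fun k => disp_x x u k + e * \sum_i disp_x x u i) r0.
have s0 : \sum_k ((disp_x x u k + e * \sum_i disp_x x u i) ^+ 2
    + (disp_y x u k + e * \sum_i disp_y x u i) ^+ 2) = 0.
  rewrite -[RHS](h y); apply: eq_bigr => k _; have [-> ->] := hy k; ring.
have z k : disp_x x u k + e * \sum_i disp_x x u i = 0 /\ disp_y x u k + e * \sum_i disp_y x u i = 0.
  have : (disp_x x u k + e * \sum_i disp_x x u i) ^+ 2 + (disp_y x u k + e * \sum_i disp_y x u i) ^+ 2 = 0.
    by apply: (psumr_eq0P _ s0) => // i _; rewrite addr_ge0 ?sqr_ge0.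
  by move=> /eqP; rewrite paddr_eq0 ?sqr_ge0 // !sqrf_eq0 => /andP[/eqP -> /eqP ->].
have solve (a : 'I_N -> R) : (forall k, a k + e * \sum_i a i = 0) -> forall k, a k = 0.
  move=> ha; have : \sum_k (a k + e * \sum_i a i) = 0 by rewrite big1.
  rewrite big_split /= sum_ord_cst => h1.
  have /eqP : (1 + e * N%:R) * (\sum_i a i) = 0 by rewrite -[RHS]h1; ring.
  rewrite mulf_eq0 (negbTE n0) /= => /eqP h2 k.
  by have := ha k; rewrite h2 mulr0 addr0.
apply: (disp_inj r0) => k; split.
  by apply: (solve (disp_x x u)) => i; have [] := z i.
by apply: (solve (disp_y x u)) => i; have [] := z i.
Qed.

Lemma polar_fieldl e x k : polar_field e x 0 (lshift N k) =
  - field_x e (pos_y x) (pos_x x) k * cos (x 0 (rshift N k))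
  + field_x e (pos_x x) (pos_y x) k * sin (x 0 (rshift N k)).
Proof. by rewrite /polar_field row_mxEl mxE velocity_lift /dot /radial /= ang_coord. Qed.

Lemma polar_fieldr e x k : polar_field e x 0 (rshift N k) =
  (field_x e (pos_y x) (pos_x x) k * sin (x 0 (rshift N k))
  + field_x e (pos_x x) (pos_y x) k * cos (x 0 (rshift N k))) / x 0 (lshift N k) - 1.
Proof.
by rewrite /polar_field row_mxEr mxE velocity_lift /dot /radial /perp /= ang_coord rad_coord mulrNN.
Qed.

Lemma differentiable_polar_field e x : equilibrium_at e x -> differentiable (polar_field e) x.
Proof.
move=> [reg _ r0 _].
have coords (f : PS -> PS) : (forall j, differentiable (fun x : PS => f x 0 j) x) -> differentiable f x.
  move=> df; have -> : f = \sum_j (fun z => f z 0 j *: delta_mx 0 j).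
    by apply/funext => z; rewrite fct_sumE [LHS]row_sum_delta.
  by apply: differentiable_sum => j; exact: differentiableZl.
apply: coords => j; apply: C1_differentiable.
have F k := @C1_field_x R N _ (fun=> e) id x k (C1_cst e x) (fun j => C1_row_coord x j) reg.
have C l : C1 (fun x : PS => x 0 l) x := C1_row_coord x l.
rewrite -(splitK j); case: (fintype.split j) => k /=.
  have -> : (fun x => polar_field e x 0 (lshift N k)) = (fun x =>
    - field_x e (pos_y x) (pos_x x) k * cos (x 0 (rshift N k))
    + field_x e (pos_x x) (pos_y x) k * sin (x 0 (rshift N k))).
    by apply/funext => z; rewrite polar_fieldl.
  have [F1 F2] := F k.
  exact: (C1D (C1M (C1N F2) (C1_cos (C (rshift N k)))) (C1M F1 (C1_sin (C (rshift N k))))).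
have -> : (fun x => polar_field e x 0 (rshift N k)) = (fun x =>
  (field_x e (pos_y x) (pos_x x) k * sin (x 0 (rshift N k))
  + field_x e (pos_x x) (pos_y x) k * cos (x 0 (rshift N k))) / x 0 (lshift N k) - 1).
  by apply/funext => z; rewrite polar_fieldr.
have [F1 F2] := F k.
apply: C1B; last exact: C1_cst.
apply: C1M; last by apply: C1_inv; [exact: C|rewrite -rad_coord gt_eqF].
exact: (C1D (C1M F2 (C1_sin (C (rshift N k)))) (C1M F1 (C1_cos (C (rshift N k))))).
Qed.

(** The Cartesian displacement of the vector field is the failure w of the
    equilibrium equations turned by a right angle, and the gradient of Phi_e is
    - (I + e 1 1^T) w. Differentiate both at an equilibrium, where w = 0, so that
    the dependence of the chart on the point drops out. *)
Lemma symplectic_jacobian e x y y' : equilibrium_at e x ->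
  symplectic e x (y *m jacobian (polar_field e) x) y' = state_form e x y y'.
Proof.
move=> eqx; have [reg n0 r0 g0] := eqx.
have dpf := differentiable_polar_field eqx.
set u := y *m _.
have fx := field_x_eq n0 (fun k => let: And3 h _ _ := g0 k in h).
have fy := field_x_eq n0 (fun k => let: And3 _ h _ := g0 k in h).
have dX (j : 'I_(N + N)) : is_derive x y (fun z : PS => z 0 j) (y 0 j) by exact: der_coord.
have dE : is_derive x y (fun _ : PS => e) 0 by exact: der_cst.
have dP j : is_derive x y (fun z => polar_field e z 0 j) (u 0 j).
  have dv : derivable (polar_field e) x y by exact: diff_derivable.
  have := (derivable_mxP _ _ _).1 dv 0 j => /derivableP h.
  apply: (is_derive_eq h); rewrite /u -deriveEjacobian // derive_mx // mxE.
  by [].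
have Gx k := @der_grad_x_state R N _ (fun=> e) id x y y dE dX k reg.
have Gy k := @der_grad_y_state R N _ (fun=> e) id x y y dE dX k reg.
have p0l k : polar_field e x 0 (lshift N k) = 0.
  by rewrite polar_fieldl fx fy /pos_x /pos_y rad_coord ang_coord; ring.
have rn k : x 0 (lshift N k) != 0 by rewrite -rad_coord gt_eqF.
have p0r k : polar_field e x 0 (rshift N k) = 0.
  rewrite polar_fieldr fx fy /pos_x /pos_y rad_coord ang_coord.
  have c1 := cos2Dsin2 (x 0 (rshift N k)).
  apply/eqP; rewrite subr_eq0; apply/eqP/(mulIf (rn k)); rewrite mulfVK // mul1r.
  transitivity (x 0 (lshift N k) * (cos (x 0 (rshift N k)) ^+ 2 + sin (x 0 (rshift N k)) ^+ 2)); first by ring.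
  by rewrite c1 mulr1.
have near_rad k : \forall z \near x, (z : PS) 0 (lshift N k) != 0.
  have c : {for x, continuous (fun z : PS => z 0 (lshift N k))} by exact: coord_continuous.
  have o : \forall s \near x 0 (lshift N k), s != 0.
    by apply: open_nbhs_nbhs; split => //.
  exact: c o.
pose wx (z : PS) k := field_x e (pos_x z) (pos_y z) k - pos_x z k.
pose wy (z : PS) k := field_x e (pos_y z) (pos_x z) k - pos_y z k.
(* the polar field is recombined into the Cartesian failure of the equations *)
have Wy k : is_derive x y (fun z => wy z k) (- disp_x x u k).
  apply: (@der_near _ _ (fun z => - (polar_field e z 0 (lshift N k) * cos (z 0 (rshift N k))
      - z 0 (lshift N k) * sin (z 0 (rshift N k)) * polar_field e z 0 (rshift N k)))).
    apply: filterS (near_rad k) => z z0; rewrite polar_fieldl polar_fieldr /wy (_ : pos_y z k = z 0 (lshift N k) * sin (z 0 (rshift N k))).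
      have c1 := cos2Dsin2 (z 0 (rshift N k)).
      rewrite -[in RHS](mul1r (field_x e (pos_y z) (pos_x z) k)) -[in RHS]c1.
      by field.
    by rewrite /pos_y rad_coord ang_coord.
  have hc := der_cos (dX (rshift N k)); have hs := der_sin (dX (rshift N k)).
  have h := derN (derB (derM (dP (lshift N k)) hc) (derM (derM (dX (lshift N k)) hs) (dP (rshift N k)))).
  apply: (is_derive_eq h); rewrite p0l p0r /disp_x rad_coord ang_coord; ring.
have Wx k : is_derive x y (fun z => wx z k) (disp_y x u k).
  apply: (@der_near _ _ (fun z => polar_field e z 0 (lshift N k) * sin (z 0 (rshift N k))
      + z 0 (lshift N k) * cos (z 0 (rshift N k)) * polar_field e z 0 (rshift N k))).
    apply: filterS (near_rad k) => z z0; rewrite polar_fieldl polar_fieldr /wx (_ : pos_x z k = z 0 (lshift N k) * cos (z 0 (rshift N k))).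
      have c1 := cos2Dsin2 (z 0 (rshift N k)).
      rewrite -[in RHS](mul1r (field_x e (pos_x z) (pos_y z) k)) -[in RHS]c1.
      by field.
    by rewrite /pos_x rad_coord ang_coord.
  have hc := der_cos (dX (rshift N k)); have hs := der_sin (dX (rshift N k)).
  have h := derD (derM (dP (lshift N k)) hs) (derM (derM (dX (lshift N k)) hc) (dP (rshift N k))).
  apply: (is_derive_eq h); rewrite p0l p0r /disp_y rad_coord ang_coord; ring.
rewrite /state_form /grad_form /symplectic; apply: eq_bigr => k _.
have -> : dgrad_x e (pos_x x) (pos_y x) (disp_x x y) (disp_y x y) k
    = - (disp_y x u k + e * \sum_i disp_y x u i).
  have [_ <-] := Gx k.
  have -> : (fun z : PS => grad_x e (pos_x z) (pos_y z) k) = (fun z => - (wx z k + e * \sum_i wx z i)).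
    by apply/funext => z; rewrite grad_xE.
  by have [_ ->] := derN (derD (Wx k) (derZ e (@der_sum _ _ _ (index_enum _) predT _ _ x y (fun i _ => Wx i)))).
have -> : dgrad_x e (pos_y x) (pos_x x) (disp_y x y) (disp_x x y) k
    = disp_x x u k + e * \sum_i disp_x x u i.
  have [_ <-] := Gy k.
  have -> : (fun z : PS => grad_x e (pos_y z) (pos_x z) k) = (fun z => - (wy z k + e * \sum_i wy z i)).
    by apply/funext => z; rewrite grad_xE.
  have [_ ->] := derN (derD (Wy k) (derZ e (@der_sum _ _ _ (index_enum _) predT _ _ x y (fun i _ => Wy i)))).
  by rewrite sumrN mulrN opprD !opprK.
by ring.
Qed.

Lemma stable_of_form e x : equilibrium_at e x ->
  (forall y, 0 <= state_form e x y y) ->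
  (forall y, state_form e x y y = 0 -> exists c, y = c *: rotation_mode R N) ->
  (0 < N)%N -> stable_spectrum (jacobian (polar_field e) x).
Proof.
move=> eqx f0 fk N0; have [_ n0 r0 _] := eqx.
pose P : 'M[R]_(N + N) := \matrix_(i, j) symplectic e x (delta_mx 0 i) (delta_mx 0 j).
have PE u v : symplectic e x u v = qform P u v.
  by apply: qform_bilinear => *; [exact: symplectic_linl|exact: symplectic_linr].
have SE y y' : qform (jacobian (polar_field e) x *m P) y y' = state_form e x y y'.
  by rewrite -symplectic_jacobian // PE /qform !mulmxA.
apply: (@stable_spectrum_symplectic R _ _ P _ (rotation_mode R N) erefl).
- apply/matrixP => i j; rewrite mxE mxE [RHS]mxE [in RHS]mxE; exact: symplectic_anti.
- rewrite -row_free_unit -kermx_eq0; apply/eqP/row_matrixP => i; rewrite row0.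
  apply: (symplectic_nondeg n0 r0) => y.
  by rewrite PE /qform -row_mul mulmx_ker row0 mul0mx mxE.
- by apply: qform_symP => u v; rewrite !SE state_form_sym.
- apply/eqP => /rowP /(_ (rshift N (Ordinal N0))) /eqP.
  by rewrite row_mxEr !mxE oner_eq0.
- apply/rowP => j; have := SE (rotation_mode R N) (delta_mx 0 j).
  rewrite state_form_rotation // /qform trmx_delta -colE mxE => ->.
  by rewrite mxE.
- by move=> v; rewrite SE.
- by move=> v; rewrite SE; exact: fk.
Qed.

End Jacobian.

(** * Stability at the minimum of the potential *)

Section PositiveForm.
Variables (R : realType).

Lemma qform_add n (S : 'M[R]_n) u v w : qform S (u + v) w = qform S u w + qform S v w.
Proof. by rewrite /qform !mulmxDl mxE. Qed.

Lemma qform_scale n (S : 'M[R]_n) (a : R) u w : qform S (a *: u) w = a * qform S u w.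
Proof. by rewrite /qform -!scalemxAl mxE. Qed.

(** The Cauchy-Schwarz inequality for a semidefinite form. *)
Lemma psd_isotropic n (S : 'M[R]_n) v : S^T = S -> (forall u, 0 <= qform S u u) ->
  qform S v v = 0 -> v *m S = 0.
Proof.
move=> Ss S0 v0.
have main w : qform S v w = 0.
  have sym := fun a b => qform_sym a b Ss.
  set b := qform S v w; set c := qform S w w.
  have E (a : R) : 0 <= 2 * a * b + a ^+ 2 * c.
    have := S0 (v + a *: w); rewrite qform_add !(sym _ (v + a *: w)) !qform_add.
    rewrite v0 !qform_scale (sym v (a *: w)) qform_scale (sym w (a *: w)) qform_scale (sym w v) -/b -/c.
    by rewrite (_ : 0 + a * b + (a * b + a * (a * c)) = 2 * a * b + a ^+ 2 * c) //; ring.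
  have c0 : 0 <= c by exact: S0.
  have c1 : 0 < c + 1 by lra.
  have := E (- b / (c + 1)).
  have -> : 2 * (- b / (c + 1)) * b + (- b / (c + 1)) ^+ 2 * c = - (b ^+ 2 * (c + 2) / (c + 1) ^+ 2).
    by field; rewrite gt_eqF.
  rewrite oppr_ge0 pmulr_lle0 ?invr_gt0 ?exprn_gt0 // pmulr_lle0; last by lra.
  by move=> h; apply/eqP; rewrite -sqrf_eq0 eq_le h sqr_ge0.
apply/rowP => j; have := main (delta_mx 0 j).
by rewrite /qform trmx_delta -colE mxE => ->; rewrite mxE.
Qed.

Lemma qform_block (m n : nat) (A : 'M[R]_m) (B : 'M[R]_(m, n)) (C : 'M[R]_(n, m)) (D : 'M[R]_n)
    (u : 'rV[R]_m) (v : 'rV[R]_n) :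
  qform (block_mx A B C D) (row_mx u v) (row_mx u v)
  = \sum_i \sum_j u 0 i * A i j * u 0 j + \sum_i \sum_j u 0 i * B i j * v 0 j
    + (\sum_i \sum_j v 0 i * C i j * u 0 j + \sum_i \sum_j v 0 i * D i j * v 0 j).
Proof.
rewrite qformE big_split_ord /=; congr (_ + _); rewrite -big_split; apply: eq_bigr => i _;
  rewrite big_split_ord /=; congr (_ + _); apply: eq_bigr => j _.
- by rewrite !row_mxEl block_mxEul.
- by rewrite row_mxEl row_mxEr block_mxEur.
- by rewrite row_mxEl row_mxEr block_mxEdl.
- by rewrite !row_mxEr block_mxEdr.
Qed.

Variable (N : nat).
Notation PS := 'rV[R]_(N + N).
Notation E := (R * PS)%type.
Implicit Types (t v : 'rV[R]_N) (x y : PS) (k i : 'I_N).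

Lemma hessian_psd t : V_domain t -> (forall u : 'rV[R]_N, V_domain u -> V t <= V u) ->
  forall v, 0 <= qform (hessian (@V R N) t) v v.
Proof.
move=> td tmin v; rewrite leNgt; apply/negP => neg.
have t0 : 0 *: v + t = t by rewrite scale0r add0r.
have d2 : is_derive (0 : R) (1 : R) (fun s : R => \sum_i v 0 i * angle_force (s *: v + t) i)
    (qform (hessian (@V R N) t) v v).
  have h i : is_derive (0 : R) (1 : R) (fun s : R => v 0 i * angle_force (s *: v + t) i)
      (v 0 i * \sum_j hessian (@V R N) t i j * v 0 j).
    apply: derZ; rewrite hessian_mul //.
    apply: (@is_derive_line _ _ (fun u : 'rV[R]_N => angle_force u i)).
    by rewrite t0; exact: der_angle_force.
  have hs := @der_sum _ _ _ (index_enum _) predT _ _ (0 : R) (1 : R) (fun i _ => h i).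
  apply: (is_derive_eq hs); rewrite qformE; apply: eq_bigr => i _.
  by rewrite mulr_sumr; apply: eq_bigr => j _; rewrite mulrA.
have f0 : \sum_i v 0 i * angle_force (0 *: v + t) i = 0.
  by rewrite t0 big1 // => i _; rewrite (V_min_force td tmin) mulr0.
have dec := second_derivative_decr (der_V_line v td) f0 d2 neg.
have dom : \forall s \near (0 : R)^'+, V_domain (s *: v + t).
  exact: (cvg_at_right_filter cvg_id (V_domain_line v td)).
have : \forall s \near (0 : R)^'+, False.
  near=> s; have : V (s *: v + t) < V (0 *: v + t) by near: s.
  by rewrite t0 ltNge tmin //; near: s.
by move=> /filter_ex [].
Unshelve. all: by end_near. Qed.

(** Nondegeneracy confines the kernel of the Hessian to the constants, where the
    square is positive. *)
Lemma min_shifted_posdef t v : (0 < N)%N -> V_domain t ->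
  (forall u : 'rV[R]_N, V_domain u -> V t <= V u) -> V_nondegenerate t ->
  qform (hessian (@V R N) t) v v + (\sum_i v 0 i) ^+ 2 = 0 -> v = 0.
Proof.
move=> N0 td tmin nd /eqP; have psd := hessian_psd td tmin.
rewrite paddr_eq0 ?sqr_ge0 // sqrf_eq0 => /andP[/eqP q0 /eqP s0].
have vH := psd_isotropic (hessian_sym td) psd q0.
have c10 : const_mx 1 != 0 :> 'rV[R]_N.
  by apply/eqP => /rowP /(_ (Ordinal N0)) /eqP; rewrite !mxE oner_eq0.
have [c vc] := mup1_kernel nd c10 (const_hessian td) vH.
move/eqP: s0; rewrite vc; under eq_bigr do rewrite !mxE mulr1.
rewrite sum_ord_cst mulf_eq0 pnatr_eq0 -[N == 0%N]negbK -lt0n N0 /= => /eqP ->.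
by rewrite scale0r.
Qed.

Lemma state_form_linl (e a : R) x y y' w : equilibrium_at e x ->
  state_form e x (a *: y + y') w = a * state_form e x y w + state_form e x y' w.
Proof.
by move=> eqx; rewrite -!symplectic_jacobian // mulmxDl -scalemxAl symplectic_linl.
Qed.

Lemma state_form_square (e a : R) x y y' : equilibrium_at e x ->
  state_form e x (a *: y + y') (a *: y + y')
  = a ^+ 2 * state_form e x y y + 2 * a * state_form e x y y' + state_form e x y' y'.
Proof.
move=> eqx; rewrite state_form_linl // ![state_form e x _ (a *: y + y')]state_form_sym.
by rewrite !state_form_linl // (state_form_sym e x y' y); ring.
Qed.

Lemma derive_radial (f : E -> R) (z : E) v : differentiable f z ->
  'D_((0, row_mx v 0) : E) f z = \sum_i v 0 i * 'D_((0, delta_mx 0 (lshift N i)) : E) f z.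
Proof.
move=> df; rewrite derive_row // big_split_ord /= [X in _ + X]big1 ?addr0.
  by apply: eq_bigr => i _; rewrite row_mxEl.
by move=> i _; rewrite row_mxEr mxE mul0r.
Qed.

Lemma derive_angular (f : E -> R) (z : E) v : differentiable f z ->
  'D_((0, row_mx 0 v) : E) f z = \sum_i v 0 i * 'D_((0, delta_mx 0 (rshift N i)) : E) f z.
Proof.
move=> df; rewrite derive_row // big_split_ord /= [X in X + _]big1 ?add0r.
  by apply: eq_bigr => i _; rewrite row_mxEr.
by move=> i _; rewrite row_mxEl mxE mul0r.
Qed.

Lemma delta_rshift i : delta_mx 0 (rshift N i) = row_mx 0 (delta_mx 0 i) :> PS.
Proof.
apply/rowP => j; rewrite -(splitK j); case: (fintype.split j) => k /=.
  by rewrite row_mxEl !mxE eq_lrshift.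
by rewrite row_mxEr !mxE (inj_eq (@rshift_inj _ _)).
Qed.

Lemma C1_grad_r_at (z : E) k : regular_at z.1 z.2 -> C1 (fun z : E => grad_r z.1 z.2 k) z.
Proof.
move=> reg; apply: (@C1_grad_r R N E fst snd) => //; first exact: C1_eps.
by move=> j; exact: C1_state.
Qed.

Lemma C1_grad_t_at (z : E) k : regular_at z.1 z.2 -> C1 (fun z : E => grad_t z.1 z.2 k) z.
Proof.
move=> reg; apply: (@C1_grad_t R N E fst snd) => //; first exact: C1_eps.
by move=> j; exact: C1_state.
Qed.

(** The Hessian of Phi_e divided by e, for radial displacements scaled by sqrt e;
    the summand 1 makes the rotation positive as well. Both off-diagonal blocks
    use the derivatives of the angular components, which by symmetry also
    represent those of the radial components, and so display the factor sqrt e. *)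
Definition rescaled_hessian (e : R) (z : E) : 'M[R]_(N + N) :=
  block_mx (\matrix_(a, b) 'D_((0, delta_mx 0 (lshift N a)) : E) (fun z : E => grad_r z.1 z.2 b) z)
    (\matrix_(a, b) (Num.sqrt e * 'D_((0, delta_mx 0 (lshift N a)) : E) (fun z : E => grad_t z.1 z.2 b) z))
    (\matrix_(a, b) (Num.sqrt e * 'D_((0, delta_mx 0 (lshift N b)) : E) (fun z : E => grad_t z.1 z.2 a) z))
    (\matrix_(a, b) ('D_((0, delta_mx 0 (rshift N a)) : E) (fun z : E => grad_t z.1 z.2 b) z + 1)).

Lemma qform_rescaled (a b d : 'I_N -> 'I_N -> R) (s : R) (u v : 'rV[R]_N) : \sum_i v 0 i = 0 ->
  qform (block_mx (\matrix_(i, j) a i j) (\matrix_(i, j) (s * b i j))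
    (\matrix_(i, j) (s * b j i)) (\matrix_(i, j) (d i j + 1))) (row_mx u v) (row_mx u v)
  = \sum_i \sum_j u 0 i * a i j * u 0 j + 2 * s * (\sum_i \sum_j u 0 i * b i j * v 0 j)
    + \sum_i \sum_j v 0 i * d i j * v 0 j.
Proof.
move=> sv; rewrite qform_block.
set Q1 := (X in _ = X + _ + _); set Q2 := (X in _ = _ + _ * X + _); set Q3 := (X in _ = _ + X).
have -> : \sum_i \sum_j u 0 i * (\matrix_(i, j) a i j) i j * u 0 j = Q1.
  by apply: eq_bigr => i _; apply: eq_bigr => j _; rewrite mxE.
have -> : \sum_i \sum_j u 0 i * (\matrix_(i, j) (s * b i j)) i j * v 0 j = s * Q2.
  rewrite mulr_sumr; apply: eq_bigr => i _; rewrite mulr_sumr; apply: eq_bigr => j _.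
  by rewrite mxE; ring.
have -> : \sum_i \sum_j v 0 i * (\matrix_(i, j) (s * b j i)) i j * u 0 j = s * Q2.
  rewrite exchange_big mulr_sumr; apply: eq_bigr => i _; rewrite mulr_sumr; apply: eq_bigr => j _.
  by rewrite mxE; ring.
have -> : \sum_i \sum_j v 0 i * (\matrix_(i, j) (d i j + 1)) i j * v 0 j = Q3.
  transitivity (Q3 + \sum_i \sum_j v 0 i * v 0 j).
    rewrite -big_split; apply: eq_bigr => i _; rewrite -big_split; apply: eq_bigr => j _ /=.
    by rewrite mxE; ring.
  by rewrite sum_sum_mul sv mul0r addr0.
by ring.
Qed.

Lemma rescaled_form (e : R) x (u v : 'rV[R]_N) : 0 < e -> equilibrium_at e x ->
  \sum_i v 0 i = 0 ->
  state_form e x (row_mx (Num.sqrt e *: u) v) (row_mx (Num.sqrt e *: u) v)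
  = e * qform (rescaled_hessian e (e, x)) (row_mx u v) (row_mx u v).
Proof.
move=> e0 eqx sv; have [reg _ _ _] := eqx.
have en : e != 0 by rewrite gt_eqF.
have -> : row_mx (Num.sqrt e *: u) v = Num.sqrt e *: row_mx u 0 + row_mx 0 v.
  by rewrite scale_row_mx add_row_mx scaler0 addr0 add0r.
rewrite state_form_square // sqr_sqrtr ?ltW // qform_rescaled //.
have dr k := C1_differentiable (@C1_grad_r_at (e, x) k reg).
have dt k := C1_differentiable (@C1_grad_t_at (e, x) k reg).
have F1 (w : 'rV[R]_N) : state_form e x (row_mx u 0) (row_mx w 0)
    = \sum_k w 0 k * 'D_((0, row_mx u 0) : E) (fun z : E => grad_r z.1 z.2 k) (e, x).
  rewrite state_formE //; apply: eq_bigr => k _.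
  by rewrite row_mxEl row_mxEr [X in _ + X * _]mxE mul0r addr0.
have F2 (y : PS) (w : 'rV[R]_N) : state_form e x y (row_mx 0 w)
    = \sum_k w 0 k * (e * 'D_((0, y) : E) (fun z : E => grad_t z.1 z.2 k) (e, x)).
  rewrite state_formE //; apply: eq_bigr => k _.
  by rewrite row_mxEl row_mxEr [X in X * _ + _]mxE mul0r add0r.
have S1 : state_form e x (row_mx u 0) (row_mx u 0) = \sum_i \sum_j
    u 0 i * 'D_((0, delta_mx 0 (lshift N i)) : E) (fun z : E => grad_r z.1 z.2 j) (e, x) * u 0 j.
  rewrite F1 exchange_big; apply: eq_bigr => k _; rewrite derive_radial // mulr_sumr.
  by apply: eq_bigr => i _; rewrite mulrC.
have S2 : state_form e x (row_mx u 0) (row_mx 0 v) = e * \sum_i \sum_j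
    u 0 i * 'D_((0, delta_mx 0 (lshift N i)) : E) (fun z : E => grad_t z.1 z.2 j) (e, x) * v 0 j.
  rewrite F2 exchange_big mulr_sumr; apply: eq_bigr => k _; rewrite derive_radial // !mulr_sumr.
  by apply: eq_bigr => i _; ring.
have S3 : state_form e x (row_mx 0 v) (row_mx 0 v) = e * \sum_i \sum_j
    v 0 i * 'D_((0, delta_mx 0 (rshift N i)) : E) (fun z : E => grad_t z.1 z.2 j) (e, x) * v 0 j.
  rewrite F2 exchange_big mulr_sumr; apply: eq_bigr => k _; rewrite derive_angular // !mulr_sumr.
  by apply: eq_bigr => i _; ring.
rewrite S1 S2 S3 !mulrDr; congr (_ + _ + _).
by rewrite mulrCA.
Qed.

(** The entries are derivatives of functions that are continuously differentiable
    at e = 0 on the unit circle. *)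
Lemma rescaled_hessian_cvg t (X : R -> PS) : V_domain t ->
  X e @[e --> (0 : R)] --> circle_state t -> forall i j : 'I_(N + N),
  rescaled_hessian e (e, X e) i j @[e --> (0 : R)^'+] -->
   block_mx (2 *: 1%:M) 0 0 (hessian (@V R N) t + const_mx 1) i j.
Proof.
move=> td cX; have reg := regular_circle td.
have cz : (e, X e) @[e --> (0 : R)] --> ((0, circle_state t) : E).
  by apply: cvg_to_pair; [exact: cvg_id|exact: cX].
have Dc (f : E -> R) (w : E) : C1 f (0, circle_state t) ->
    'D_w f (e, X e) @[e --> (0 : R)^'+] --> 'D_w f (0, circle_state t).
  move=> [_ fc]; apply: cvg_at_right_filter.
  exact: (cvg_comp _ _ cz (fc w)).
have sq : Num.sqrt e @[e --> (0 : R)^'+] --> (0 : R).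
  by apply: cvg_at_right_filter; rewrite -[X in _ --> X]sqrtr0; exact: sqrt_continuous.
have sD (f : E -> R) (w : E) : C1 f (0, circle_state t) ->
    Num.sqrt e * 'D_w f (e, X e) @[e --> (0 : R)^'+] --> (0 : R).
  move=> f1; rewrite -[X in _ --> X](mul0r ('D_w f (0, circle_state t))).
  by apply: cvgM; [exact: sq|exact: Dc].
have Cr k := @C1_grad_r_at (0, circle_state t) k reg.
have Ct k := @C1_grad_t_at (0, circle_state t) k reg.
move=> i j; rewrite -(splitK i) -(splitK j).
case: (fintype.split i) => a; case: (fintype.split j) => b /=.
- under eq_fun do rewrite block_mxEul mxE.
  rewrite block_mxEul.
  have -> : (2 *: 1%:M : 'M[R]_N) a b
     = 'D_((0, delta_mx 0 (lshift N a)) : E) (fun z : E => grad_r z.1 z.2 b) (0, circle_state t).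
    have [_ ->] := der_grad_r_circle t (delta_mx 0 (lshift N a)) b.
    by rewrite !mxE eqxx (inj_eq (@lshift_inj _ _)) eq_sym.
  exact: Dc.
- under eq_fun do rewrite block_mxEur mxE.
  by rewrite block_mxEur mxE; exact: sD.
- under eq_fun do rewrite block_mxEdl mxE.
  by rewrite block_mxEdl mxE; exact: sD.
- under eq_fun do rewrite block_mxEdr mxE.
  rewrite block_mxEdr !mxE; apply: cvgD; last exact: cvg_cst.
  have -> : partial b (partial a (@V R N)) t
     = 'D_((0, delta_mx 0 (rshift N a)) : E) (fun z : E => grad_t z.1 z.2 b) (0, circle_state t).
    rewrite delta_rshift; have [_ ->] := der_grad_t_circle (delta_mx 0 a) b td.
    transitivity (hessian (@V R N) t a b); first by rewrite mxE.
    rewrite (bigD1 a) //= [X in _ = _ * X + _]mxE !eqxx mulr1 big1 ?addr0 => [|l la].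
      by rewrite -[in RHS](hessian_sym td) [RHS]mxE.
    by rewrite [X in _ * X]mxE (negbTE la) andbF mulr0.
  exact: Dc.
Qed.

Lemma limit_form_posdef t (y : PS) : (0 < N)%N -> V_domain t ->
  (forall u : 'rV[R]_N, V_domain u -> V t <= V u) -> V_nondegenerate t -> y != 0 ->
  0 < qform (block_mx (2 *: 1%:M) 0 0 (hessian (@V R N) t + const_mx 1)) y y.
Proof.
move=> N0 td tmin nd; rewrite -[y]hsubmxK.
move: (lsubmx y) (rsubmx y) => u v y0; rewrite qform_block.
have E1 : \sum_i \sum_j u 0 i * (2 *: 1%:M : 'M[R]_N) i j * u 0 j = 2 * \sum_i u 0 i ^+ 2.
  rewrite mulr_sumr; apply: eq_bigr => i _; rewrite (bigD1 i) //= !mxE eqxx mulr1.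
  rewrite big1 ?addr0 => [|j ji]; first by ring.
  by rewrite !mxE eq_sym (negbTE ji) mulr0 mulr0 mul0r.
have E4 : \sum_i \sum_j v 0 i * (hessian (@V R N) t + const_mx 1) i j * v 0 j
    = qform (hessian (@V R N) t) v v + (\sum_i v 0 i) ^+ 2.
  rewrite qformE expr2 -sum_sum_mul -big_split; apply: eq_bigr => i _.
  by rewrite -big_split; apply: eq_bigr => j _; rewrite /= [X in _ * X * _]mxE [X in _ * (_ + X) * _]mxE; ring.
have z0 (w w' : 'rV[R]_N) : \sum_i \sum_j w 0 i * (0 : 'M[R]_N) i j * w' 0 j = 0.
  by rewrite big1 // => i _; rewrite big1 // => j _; rewrite mxE mulr0 mul0r.
rewrite E1 E4 !z0 addr0 add0r.
have psd := hessian_psd td tmin v.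
have s0 : 0 <= \sum_i u 0 i ^+ 2 by apply: sumr_ge0 => i _; exact: sqr_ge0.
rewrite lt_neqAle addr_ge0 ?mulr_ge0 ?addr_ge0 ?sqr_ge0 // andbT eq_sym.
apply: contra y0; rewrite paddr_eq0 ?mulr_ge0 ?addr_ge0 ?sqr_ge0 // => /andP[].
rewrite mulf_eq0 pnatr_eq0 /= => /eqP u0 /eqP v0.
rewrite (min_shifted_posdef N0 td tmin nd v0).
suff -> : u = 0 by rewrite row_mx0.
apply/rowP => i; rewrite mxE; apply/eqP; rewrite -sqrf_eq0; apply/eqP.
by apply: (psumr_eq0P _ u0) => // j _; exact: sqr_ge0.
Qed.

(** Split off the rotation, scale the radial part by 1 / sqrt e, and use that
    [rescaled_hessian] is close to a positive definite matrix. *)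
Lemma state_form_definite t (X : R -> PS) : (0 < N)%N -> V_domain t ->
  (forall u : 'rV[R]_N, V_domain u -> V t <= V u) -> V_nondegenerate t ->
  X e @[e --> (0 : R)] --> circle_state t ->
  (\forall e \near (0 : R)^'+, equilibrium_at e (X e)) ->
  \forall e \near (0 : R)^'+, forall y, 0 <= state_form e (X e) y y /\
    (state_form e (X e) y y = 0 -> exists c, y = c *: rotation_mode R N).
Proof.
move=> N0 td tmin nd cX eqX.
have pd : \forall e \near (0 : R)^'+, forall y : PS, y != 0 ->
    0 < qform (rescaled_hessian e (e, X e)) y y.
  apply: (posdef_near (rescaled_hessian_cvg td cX)) => y.
  exact: limit_form_posdef.
have e0 : \forall e \near (0 : R)^'+, 0 < e by exact: nbhs_right_gt.
near=> e => y; have ep : 0 < e by near: e.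
have eqx : equilibrium_at e (X e) by near: e.
have K0 : forall y : PS, y != 0 -> 0 < qform (rescaled_hessian e (e, X e)) y y by near: e.
(* c is the mean angle, so that v has zero sum *)
pose c := (\sum_i rsubmx y 0 i) / N%:R.
pose u := (Num.sqrt e)^-1 *: lsubmx y; pose v := rsubmx y - c *: const_mx 1.
have sn : Num.sqrt e != 0 by rewrite gt_eqF // sqrtr_gt0.
have Nn : (N%:R : R) != 0 by rewrite pnatr_eq0 -lt0n.
have sv : \sum_i v 0 i = 0.
  under eq_bigr do rewrite /v mxE [X in _ + X]mxE [X in _ - X]mxE [X in _ * X]mxE mulr1.
  by rewrite sumrB sum_ord_cst /c; field.
pose y' : PS := row_mx (Num.sqrt e *: u) v.
have yE : y = c *: rotation_mode R N + y'.
  rewrite /rotation_mode scale_row_mx add_row_mx scaler0 add0r /v addrC subrK.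
  by rewrite /u scalerA mulfV // scale1r hsubmxK.
have fE : state_form e (X e) y y = e * qform (rescaled_hessian e (e, X e)) (row_mx u v) (row_mx u v).
  rewrite -rescaled_form // yE state_form_square // !state_form_rotation // !mulr0 !add0r.
  by [].
have [z|nz] := eqVneq (row_mx u v) 0.
  rewrite fE z /qform mul0mx mul0mx mxE mulr0; split=> // _; exists c.
  rewrite yE; suff -> : y' = 0 by rewrite addr0.
  have /eq_row_mx [u0 v0] : row_mx u v = row_mx 0 0 by rewrite z row_mx0.
  by rewrite /y' u0 v0 scaler0 row_mx0.
have p : 0 < state_form e (X e) y y by rewrite fE mulr_gt0 // K0.
by split; [exact: ltW|move=> h; rewrite h ltxx in p].
Unshelve. all: by end_near. Qed.

Theorem stable_branch t : (0 < N)%N -> V_domain t ->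
  (forall u : 'rV[R]_N, V_domain u -> V t <= V u) -> V_critical t -> V_nondegenerate t ->
  exists Qe : R -> config R N,
    (\forall e \near 0^'+, linearly_stable_relative_equilibrium e (Qe e)) /\
    forall j, Qe e j @[e --> 0^'+] --> circle_config t j.
Proof.
move=> N0 td tmin tc nd; have [X [cX hX]] := equilibrium_branch N0 tc nd.
have eqX : \forall e \near (0 : R)^'+, equilibrium_at e (X e).
  have h := cvg_at_right_filter cvg_id hX.
  near=> e; have e0 : 0 < e by [].
  have : e != 0 -> equilibrium_at e (X e) by near: e; exact: h.
  by apply; rewrite gt_eqF.
have def := state_form_definite N0 td tmin nd cX eqX.
exists (fun e => complete_config e (polar (X e))); split.
  near=> e; have eqx : equilibrium_at e (X e) by near: e.
  have f : forall y, 0 <= state_form e (X e) y y /\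
    (state_form e (X e) y y = 0 -> exists c, y = c *: rotation_mode R N) by near: e.
  have [reg n0 r0 g0] := eqx; split.
    by apply: relative_equilibrium_polar => // k; have [] := g0 k.
  exists (X e); split=> //; first by move=> i; rewrite complete_lift.
  by apply: stable_of_form => // y; have [] := f y.
by move=> j; apply: cvg_at_right_filter; exact: branch_cvg.
Unshelve. all: by end_near. Qed.

End PositiveForm.

(** * Distinct families *)

Section FamilyClasses.
Variables (R : realType) (N : nat).
Implicit Types (q : config R N) (t u w : 'rV[R]_N) (i : 'I_N).

Lemma rotation_rotation (a b : R) p : rotation a (rotation b p) = rotation (a + b) p.
Proof. by rewrite /rotation /= cosD sinD; congr (_, _); ring. Qed.

Lemma rotation0 (p : R * R) : rotation 0 p = p.
Proof. by case: p => x y; rewrite /rotation /= cos0 sin0; congr (_, _); ring. Qed.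

Lemma same_family_sym q q' : same_family q q' -> same_family q' q.
Proof.
move=> [a [s [h0 h]]]; exists (- a), s^-1%g; split.
  by rewrite h0 rotation_rotation addNr rotation0.
by move=> i; rewrite h rotation_rotation addNr rotation0 permKV.
Qed.

Lemma same_family_trans q q' q'' : same_family q q' -> same_family q' q'' -> same_family q q''.
Proof.
move=> [a [s [h0 h]]] [b [r [k0 k]]]; exists (b + a), (r * s)%g; split.
  by rewrite k0 h0 rotation_rotation.
by move=> i; rewrite k h rotation_rotation permM.
Qed.

Lemma circle_config_lift t i : circle_config t (lift ord0 i) = (cos (t 0 i), sin (t 0 i)).
Proof.
rewrite /circle_config complete_lift [LHS]surjective_pairing polar_fst polar_snd.
by rewrite /pos_x /pos_y circle_rad circle_ang !mul1r.
Qed.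

(** The vector sum turns with the configuration and does not see the numbering. *)
Lemma same_family_circle u w : same_family (circle_config u) (circle_config w) ->
  exists a (s : 'S_N),
    [/\ forall i, cos (w 0 i) = cos a * cos (u 0 (s i)) - sin a * sin (u 0 (s i)),
        cos_sum w = cos a * cos_sum u - sin a * sin_sum u
      & sin_sum w = sin a * cos_sum u + cos a * sin_sum u].
Proof.
move=> [a [s [_ h]]]; exists a, s.
have hc i : cos (w 0 i) = cos a * cos (u 0 (s i)) - sin a * sin (u 0 (s i)).
  by have := h i; rewrite !circle_config_lift => -[].
have hs i : sin (w 0 i) = sin a * cos (u 0 (s i)) + cos a * sin (u 0 (s i)).
  by have := h i; rewrite !circle_config_lift => -[].
split=> //.
  rewrite /cos_sum (eq_bigr _ (fun i _ => hc i)) sumrB -!mulr_sumr.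
  by congr (_ * _ - _ * _); rewrite [RHS](reindex_inj (@perm_inj _ s)).
rewrite /sin_sum (eq_bigr _ (fun i _ => hs i)) big_split /= -!mulr_sumr.
by congr (_ * _ + _ * _); rewrite [RHS](reindex_inj (@perm_inj _ s)).
Qed.

Lemma balanced_not_same u w : cos_sum u = 0 /\ sin_sum u = 0 ->
  ~ (cos_sum w = 0 /\ sin_sum w = 0) -> ~ same_family (circle_config u) (circle_config w).
Proof.
move=> [u0 v0] wn /same_family_circle [a [s [_ hc hs]]]; apply: wn.
by rewrite hc hs u0 v0 !mulr0 subr0 addr0.
Qed.

(** Both vector sums point in the direction of the first axis, so the rotation is
    trivial and the vortices at angle 0 correspond. *)
Lemma axis_not_same u w : sin_sum u = 0 -> 0 < cos_sum u -> (forall i, cos (u 0 i) != 1) ->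
  sin_sum w = 0 -> 0 < cos_sum w -> (exists i, cos (w 0 i) = 1) ->
  ~ same_family (circle_config u) (circle_config w).
Proof.
move=> su cu un sw cw [i wi] /same_family_circle [a [s [hi hc hs]]].
have sa : sin a = 0.
  move: hs; rewrite su sw mulr0 addr0 => /esym/eqP.
  by rewrite mulf_eq0 (gt_eqF cu) orbF => /eqP.
have ca : cos a = 1.
  have c0 : 0 < cos a by move: cw; rewrite hc sa mul0r subr0 pmulr_lgt0.
  have /eqP := cos2Dsin2 a; rewrite sa expr0n /= addr0 sqrf_eq1 => /orP[/eqP //|/eqP ca].
  by move: c0; rewrite ca oppr_gt0 ltr10.
by have /eqP := un (s i); apply; rewrite -wi hi sa ca mul1r mul0r subr0.
Qed.

End FamilyClasses.

Theorem corollary1 (R : realType) (N : nat) (hN : (3 <= N)%N)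
    (hV : forall t : 'rV[R]_N, V_critical t -> V_nondegenerate t) :
  exists Q : 'I_3 -> config R N,
    [/\ forall a, limit_relative_equilibrium (Q a),
        forall a b, a != b -> ~ same_family (Q a) (Q b)
      & exists a (Qeps : R -> config R N),
          (\forall e \near 0^'+, linearly_stable_relative_equilibrium e (Qeps e))
          /\ forall j, Qeps e j @[e --> 0^'+] --> Q a j].
Proof.
have N2 : (2 <= N)%N by exact: ltnW.
have N0 : (0 < N)%N by exact: ltnW.
have [m md mmin] := @V_has_min R N.
have mc : V_critical m.
  by apply/V_criticalE; split=> // i; exact: V_min_force.
have mn := V_min_sum hN md mmin.
pose g : 'rV[R]_N := ngon N 0.
have gc : V_critical g by exact: ngon_critical.
have g0 := @ngon_sums R N 0 N2.
have [u [uc us up un]] := critical_without_axis R hN.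
have [w [wc ws wp we]] := critical_with_axis R hN.
have pos_sum (v : 'rV[R]_N) : 0 < cos_sum v -> ~ (cos_sum v = 0 /\ sin_sum v = 0).
  by move=> vp [v0 _]; rewrite v0 ltxx in vp.
have uw := axis_not_same us up un ws wp we.
(* the symmetric critical point that is not in the family of the minimum *)
have [c [cc cn mcn]] : exists c : 'rV[R]_N, [/\ V_critical c, ~ (cos_sum c = 0 /\ sin_sum c = 0)
    & ~ same_family (circle_config m) (circle_config c)].
  have [mu|mu] := pselect (same_family (circle_config m) (circle_config u)).
    exists w; split=> //; first exact: pos_sum.
    by move=> mw; apply: uw; apply: same_family_trans mw; exact: same_family_sym.
  by exists u; split=> //; exact: pos_sum.
have gm := balanced_not_same g0 mn; have gcn := balanced_not_same g0 cn.
exists (fun a : 'I_3 => circle_config (nth 0 [:: g; m; c] a)); split.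
- move=> a; apply: critical_limit_equilibrium => //; last apply: hV;
    by case: a => -[|[|[|]]].
- have sep (x y : 'I_3) : (x < y)%N ->
      ~ same_family (circle_config [:: g; m; c]`_x) (circle_config [:: g; m; c]`_y).
    case: x => -[|[|[|//]]] px; case: y => -[|[|[|//]]] py //= _.
  move=> a b; rewrite neq_ltn => /orP[ab|ba]; first exact: sep.
  by move=> /same_family_sym; exact: sep.
- exists (inord 1); rewrite inordK //=.
  by apply: stable_branch => //; exact: hV.
Qed.
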